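(* Let $h\in\mathbb{N}$ and $\pi\in S_h$. Let $(\xi_t)_{t\ge0}$ be a stochastic process and let $(X_t)_{t\ge1}$ denote its increment process, $X_t:=\xi_t-\xi_{t-1}$ for $t\ge 1$. Assume that $(X_t)_{t\ge 1}$ is a stationary, long-range dependent standard Gaussian process (centered, unit variance) with autocovariance function $r(k)=\operatorname{Cov}(X_1,X_{1+k})=L(k)k^{-D}$, $k\ge1$, where $0<D<1$ and $L$ is slowly varying at infinity. Then, as $n\to\infty$, \[ n^{D/2}L^{-1/2}(n)\Bigl(\hat q_n(\pi)-P\bigl(\tilde\Pi(X_1,\ldots,X_h)=\pi\bigr)\Bigr)\longrightarrow \mathcal N\Bigl(0,\,c_D\Bigl(\sum_{j=1}^h\alpha_j\Bigr)^2\Bigr) \] in distribution, where $c_D=\frac{2}{(1-D)(2-D)}$ and the vector $\alpha=(\alpha_1,\ldots,\alpha_h)^t$ is given by $\alpha:=\Sigma_h^{-1}c$, with $\Sigma_h$ the covariance matrix of $(X_1,\ldots,X_h)$ and $c=(c_1,\ldots,c_h)^t$ defined by \[ c_k=E\bigl(1_{\{\tilde\Pi(X_1,\ldots,X_h)=\pi\}}X_k\bigr),\qquad 1\le k\le h. \]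
   Context: $S_h$ denotes the set of permutations of $\{0,\ldots,h\}$, written as $(h+1)$-tuples. For $(x_0,\ldots,x_h)\in\mathbb{R}^{h+1}$ the ordinal pattern is the permutation $\Pi(x_0,\ldots,x_h)=(\pi_0,\ldots,\pi_h)\in S_h$ satisfying $x_{\pi_0}\ge\cdots\ge x_{\pi_h}$ and $\pi_{i-1}>\pi_i$ whenever $x_{\pi_{i-1}}=x_{\pi_i}$, $i=1,\ldots,h$. For $(y_1,\ldots,y_h)\in\mathbb{R}^h$ put $\tilde\Pi(y_1,\ldots,y_h):=\Pi(0,y_1,y_1+y_2,\ldots,y_1+\cdots+y_h)$, so that $\Pi(\xi_t,\ldots,\xi_{t+h})=\tilde\Pi(X_{t+1},\ldots,X_{t+h})$. The estimator is \[ \hat q_n(\pi):=\frac1n\sum_{i=0}^{n-1}1_{\{\Pi(\xi_i,\ldots,\xi_{i+h})=\pi\}}=\frac1n\sum_{i=0}^{n-1}1_{\{\tilde\Pi(X_{i+1},\ldots,X_{i+h})=\pi\}}. \] $\mathcal N(0,0)$ is understood as the Dirac measure at $0$. *)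

(* Defs.v *)
From HB Require Import structures.
From mathcomp Require Import all_boot all_order all_algebra all_fingroup.
From mathcomp Require Import all_classical all_reals all_analysis.
Set Implicit Arguments.
Unset Strict Implicit.
Unset Printing Implicit Defensive.
Import Order.TTheory GRing.Theory Num.Theory.
Import numFieldNormedType.Exports.
Local Open Scope classical_set_scope.
Local Open Scope ring_scope.

Section OrdinalPatterns.
Context {R : realType} {h : nat}.
Implicit Types (x : 'I_h.+1 -> R) (s : 'S_h.+1).

(* [widen_ord (leqnSn h) i] and [lift ord0 i] are i and i + 1 in {0, ..., h} *)
Definition is_ordinal_pattern x s : bool :=
  [forall i : 'I_h,
     let a := s (widen_ord (leqnSn h) i) in
     let b := s (lift ord0 i) in
     (x b <= x a) && ((x a == x b) ==> (b < a)%N)].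

(* The default value 1 is never used, see [ordinal_patternP] *)
Definition ordinal_pattern x : 'S_h.+1 :=
  odflt 1%g [pick s | is_ordinal_pattern x s].

Let leT x : rel 'I_h.+1 :=
  fun i j => (x j < x i) || ((x i == x j) && (j <= i)%N).

Let leT_total x : total (leT x).
Proof.
move=> i j; rewrite /leT; case: (ltgtP (x i) (x j)) => //= _.
exact: leq_total.
Qed.

Let leT_trans x : transitive (leT x).
Proof.
move=> j i k /orP[ji|/andP[/eqP ij lji]] /orP[kj|/andP[/eqP jk lkj]];
  rewrite /leT.
- by rewrite (lt_trans kj ji).
- by rewrite -jk ji.
- by rewrite ij kj.
- by rewrite ij jk eqxx (leq_trans lkj lji) orbT.
Qed.

Let leT_anti x : antisymmetric (leT x).
Proof.
move=> i j; rewrite /leT; case: (ltgtP (x i) (x j)) => //= _ ji.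
by apply/val_inj/eqP; rewrite eqn_leq andbC.
Qed.

Let nth_codom_ord s (i : 'I_h.+1) : nth ord0 (codom s) i = s i.
Proof.
have i_lt : (i < size (enum 'I_h.+1))%N by rewrite size_enum_ord.
by rewrite /codom /image_mem (nth_map ord0 _ _ i_lt) nth_ord_enum.
Qed.

Let is_ordinal_pattern_sorted x s :
  is_ordinal_pattern x s = sorted (leT x) (codom s).
Proof.
have sz : size (codom s) = h.+1 by rewrite size_codom card_ord.
have nthE (k : nat) (kh : (k < h.+1)%N) :
    nth ord0 (codom s) k = s (Ordinal kh) by rewrite -nth_codom_ord.
apply/forallP/(sortedP ord0) => [H k|H i /=].
  rewrite sz ltnS => kh; have := H (Ordinal kh).
  rewrite (nthE k (leqW kh)) (nthE k.+1 kh) /leT /=.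
  have -> : widen_ord (leqnSn h) (Ordinal kh) = Ordinal (leqW kh) :> 'I_h.+1.
    exact/val_inj.
  have -> : lift ord0 (Ordinal kh) = Ordinal (kh : (k.+1 < h.+1)%N).
    exact/val_inj.
  by move=> /andP[]; rewrite le_eqVlt eq_sym => /orP[/eqP ->|->//];
    rewrite eqxx /= => /ltnW ->; rewrite orbT.
have := H i; rewrite sz ltnS => /(_ (ltn_ord i)).
rewrite (nthE i (leqW (ltn_ord i))) (nthE i.+1 (ltn_ord i)) /leT /=.
have -> : widen_ord (leqnSn h) i = Ordinal (leqW (ltn_ord i)) :> 'I_h.+1.
  exact/val_inj.
have -> : lift ord0 i = Ordinal (ltn_ord i : (i.+1 < h.+1)%N).
  exact/val_inj.
set a := s (Ordinal (leqW _)); set b := s (Ordinal _).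
have ba : (b : nat) != a.
  apply/negP => /eqP/val_inj/perm_inj/(congr1 val)/= /eqP.
  by rewrite eqn_leq ltnn.
case/orP => [lt|/andP[/eqP -> le]]; first by rewrite (ltW lt) gt_eqF.
by rewrite lexx eqxx /= ltn_neqAle ba.
Qed.

Lemma is_ordinal_pattern_ex x : exists s, is_ordinal_pattern x s.
Proof.
pose t := sort (leT x) (enum 'I_h.+1).
have tE : perm_eq t (enum 'I_h.+1) by rewrite perm_sort.
have szt : size t = h.+1 by rewrite (perm_size tE) size_enum_ord.
have ut : uniq t by rewrite (perm_uniq tE) enum_uniq.
have inj : injective (fun i : 'I_h.+1 => nth ord0 t i).
  by move=> i j /eqP; rewrite nth_uniq ?szt// => /eqP/val_inj.
exists (perm inj); rewrite is_ordinal_pattern_sorted.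
suff -> : codom (perm inj) = t by exact: sort_sorted.
apply: (@eq_from_nth _ ord0); first by rewrite size_codom card_ord szt.
move=> k; rewrite size_codom card_ord => kh.
by rewrite (nth_codom_ord _ (Ordinal kh)) permE.
Qed.

Lemma is_ordinal_pattern_uniq x s s' :
  is_ordinal_pattern x s -> is_ordinal_pattern x s' -> s = s'.
Proof.
rewrite !is_ordinal_pattern_sorted => ss ss'.
have pE (u : 'S_h.+1) : perm_eq (codom u) (enum 'I_h.+1).
  apply: uniq_perm; rewrite ?enum_uniq//.
    by apply/injectiveP; exact: perm_inj.
  by move=> i; rewrite mem_enum; apply/codomP; exists (u^-1%g i); rewrite permKV.
have e : codom s = codom s'.
  apply: (sorted_eq (@leT_trans x) (@leT_anti x)) => //.
  by rewrite (perm_trans (pE s))// perm_sym.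
apply/permP => i; move/(congr1 (fun t => nth ord0 t i)): e.
by rewrite !nth_codom_ord.
Qed.

Lemma ordinal_patternP x s :
  reflect (ordinal_pattern x = s) (is_ordinal_pattern x s).
Proof.
rewrite /ordinal_pattern; case: pickP => [s' xs'|no] /=.
  apply: (iffP idP) => [xs|<-//]; exact: is_ordinal_pattern_uniq xs' xs.
by exfalso; have [s'] := is_ordinal_pattern_ex x; rewrite no.
Qed.

Lemma ordinal_pattern_shift x (c : R) :
  ordinal_pattern (fun i => x i - c) = ordinal_pattern x.
Proof.
apply/ordinal_patternP/forallP => i /=.
have /ordinal_patternP/forallP/(_ i)/= := erefl (ordinal_pattern x).
by rewrite lerD2r (inj_eq (addIr _)).
Qed.

(* [y i] stands for y_(i+1), as 'I_h starts at 0 *)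
Definition increment_pattern (y : 'I_h -> R) : 'S_h.+1 :=
  ordinal_pattern (fun j : 'I_h.+1 => \sum_(i < h | (i < j)%N) y i).

End OrdinalPatterns.

Section SlowVariation.
Context {R : realType}.

Definition slowly_varying (L : R -> R) : Prop :=
  (exists A : R, measurable_fun `[A, +oo[ L /\
                 forall x, A <= x -> 0 < L x) /\
  (forall a : R, 0 < a -> L (a * x) / L x @[x --> +oo] --> (1 : R)).

End SlowVariation.

Section Laws.
Context {R : realType}.

(* N(m, v), parametrised by the variance v. The second argument of the
   library's [normal_prob] is a standard deviation, and [normal_prob m 0] is
   not the Dirac measure at m. *)
Definition gaussian_law (m v : R) : probability (measurableTypeR R) R :=
  if v == 0 then \d_(m : measurableTypeR R) : probability (measurableTypeR R) R
  else normal_prob m (Num.sqrt v) : probability (measurableTypeR R) R.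

Context d (T : measurableType d) (P : probability T R).

Definition cvg_in_distribution (Z : nat -> T -> R) (mu : probability (measurableTypeR R) R) :=
  (forall n, measurable_fun setT (Z n)) /\
  forall f : R -> R, continuous f -> bounded_fun f ->
    'E_P[f \o Z n]%E @[n --> \oo] --> (\int[mu]_x (f x)%:E)%E.

Definition stationary (Y : nat -> T -> R) : Prop :=
  forall (k n : nat) (t : 'I_n -> nat) (A : set (n.-tuple R)), measurable A ->
    P [set w | A [tuple Y (t i + k)%N w | i < n]] =
    P [set w | A [tuple Y (t i) w | i < n]].

Definition gaussian_process (Y : nat -> T -> R) : Prop :=
  forall (n : nat) (t : 'I_n -> nat) (a : 'I_n -> R),
  exists m v : R, 0 <= v /\
    forall A : set R, measurable A ->
      P [set w | A (\sum_(i < n) a i * Y (t i) w)] = gaussian_law m v A.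

End Laws.

Section Estimation.
Context {R : realType} d (T : measurableType d).

(* Meant for t >= 1 only *)
Definition increment (xi : nat -> T -> R) (t : nat) : T -> R :=
  fun w => xi t w - xi t.-1 w.

Definition pattern_estimator (h : nat) (xi : nat -> T -> R) (s : 'S_h.+1)
    (n : nat) : T -> R :=
  fun w => n%:R^-1 * \sum_(i < n)
    (ordinal_pattern (fun j : 'I_h.+1 => xi (i + j)%N w) == s)%:R.

Context (P : probability T R) (h : nat) (X : nat -> T -> R).

Definition increment_pattern_event (s : 'S_h.+1) : set T :=
  [set w | increment_pattern (fun i : 'I_h => X i.+1 w) = s].

Definition covariance_mx : 'M[R]_h :=
  \matrix_(i, j) fine (covariance P (X i.+1) (X j.+1)).

Definition pattern_coef (s : 'S_h.+1) : 'cV[R]_h :=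
  \col_k fine ('E_P[fun w => \1_(increment_pattern_event s) w * X k.+1 w]).

(* The covariance matrix is nonsingular whenever the autocovariances of the
   stationary process X tend to 0 and X has positive variance; on singular
   matrices [invmx] is the identity. *)
Definition pattern_alpha (s : 'S_h.+1) : 'cV[R]_h :=
  invmx covariance_mx *m pattern_coef s.

End Estimation.

Lemma increment_pattern_increment (R : realType) d (T : measurableType d)
    (h t : nat) (xi : nat -> T -> R) (w : T) :
  increment_pattern (fun i : 'I_h => increment xi (t + i.+1) w) =
  ordinal_pattern (fun j : 'I_h.+1 => xi (t + j)%N w).
Proof.
rewrite -[RHS](ordinal_pattern_shift _ (xi t w)) /increment_pattern.
congr ordinal_pattern; apply/funext => j.
rewrite /increment -(big_ord_widen h
  (fun i => xi (t + i.+1)%N w - xi (t + i.+1).-1 w)) ?leq_ord//.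
rewrite -(big_mkord xpredT (fun i => xi (t + i.+1)%N w - xi (t + i.+1).-1 w)).
under eq_bigr do rewrite addnS /= -addnS.
by rewrite (telescope_sumr (fun i => xi (t + i)%N w)) // addn0.
Qed.

(* Main.v *)
(** The indicator of the pattern [s] at time [i] is almost surely an orthant
    function [f] of the Gaussian window (X_(i+1), ..., X_(i+h)).  Subtracting
    from [f] its mean and its linear regression on the window, whose
    coefficients are the entries of [alpha], leaves a residual whose covariance
    at distance k is O(r(k)^2), hence negligible against n^(2-D) L(n).  Up to
    boundary terms the regressions sum to (sum of [alpha]) (X_1 + ... + X_n),
    which is exactly Gaussian with variance ~ c_D (sum of [alpha])^2 n^(2-D) L(n).

    The covariance bound avoids Hermite expansions.  Let U, V be Gaussian with
    common covariance S and cross-covariance C, where C is dominated by th S as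
    a quadratic form.  If [f] is a trigonometric polynomial, the residual
    covariance is a quadratic form in the kernels cosh(C) - 1 and sinh(C) - C,
    which the Schur product theorem bounds, power by power, by th^2 times the
    same form in S, that is, by th^2 times the residual variance.  This passes
    to bounded pointwise limits, in particular to orthant functions. *)

Require Import Defs.
From HB Require Import structures.
From mathcomp Require Import all_boot all_order all_algebra all_fingroup.
From mathcomp Require Import all_classical all_reals all_analysis.
From mathcomp Require Import measurable_realfun.
From mathcomp Require Import ring lra zify.
Set Implicit Arguments.
Unset Strict Implicit.
Unset Printing Implicit Defensive.
Import Order.TTheory GRing.Theory Num.Theory.
Import numFieldNormedType.Exports.
Local Open Scope classical_set_scope.
Local Open Scope ring_scope.

(** * Slow variation and long-range dependent sums *)

(** The hypothesis on L is pointwise in the scaling factor, whereas sums of covariances need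
    uniformity; this is where the measurability of L enters. Asymptotics of sums then come from a
    recursion from n/2 to n, without integrals or a representation of L. In the covariance bound, th
    has to be proportional to r(k). That requires the covariance matrix of the window to be
    coercive, which is not assumed and has to be derived from r -> 0. The resulting bound th^2 E f^2
    depends on f through its second moment alone, not on its frequencies or its number of terms;
    this is what lets it survive the passage from trigonometric polynomials to discontinuous
    functions. Near lags, where c r(k) may exceed 1, are covered by th = 1. The Gaussian hypothesis
    concerns one-dimensional laws of linear combinations. Everything joint is recovered from E cos N
    and E sin N, which for nondegenerate N come from Stein's identity and a linear differential
    equation. *)

Lemma lebesgue_measure_shift (R : realType) (t : R) (A : set R) :
  measurable A ->
  lebesgue_measure ((fun x => x + t) @^-1` A) = lebesgue_measure A :> \bar R.
Proof.
move=> mA.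
have mshift : @measurable_fun _ _ (measurableTypeR R) (measurableTypeR R) setT (fun x => x + t).
  by apply: measurable_funD; [exact: measurable_id|exact: measurable_cst].
pose f : {mfun (measurableTypeR R) >-> (measurableTypeR R)} :=
  HB.pack ((fun x => x + t) : measurableTypeR R -> measurableTypeR R)
   (isMeasurableFun.Build _ _ (measurableTypeR R) (measurableTypeR R) _ mshift).
pose mu' := pushforward (@lebesgue_measure R) f.
symmetry; apply: (@lebesgue_measure_unique R mu') => //.
move=> _ [[a b] _ <-]; rewrite /= /mu' /pushforward.
rewrite [X in _ = lebesgue_measure X](_ : _ = `](a - t), (b - t)]%classic); last first.
  by apply/seteqP; split=> x /=; rewrite !in_itv/= ltrBlDr lerBrDr.
rewrite !lebesgue_measure_itv/= !lte_fin ltrD2r; case: ifP => // _.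
by rewrite -!EFinB opprB addrA subrK.
Qed.

(** * Uniform convergence theorem for slowly varying functions, in additive form *)

Section UniformConvergence.
Context {R : realType} (g : R -> R) (B : R).
Hypothesis mg : measurable_fun `[B, +oo[ g.
Hypothesis hg : forall t, g (u + t) - g u @[u --> +oo] --> (0 : R).
Local Notation mu := (@lebesgue_measure R).

Let small (v : nat -> R) (e : R) (n : nat) : set R :=
  `[0, 2] `&` \bigcap_(m in [set m | (n <= m)%N])
    [set s | `|g (v m + s) - g (v m)| <= e].

Let measurable_small v (e : R) n : (forall m, B <= v m) -> measurable (small v e n).
Proof.
move=> vB; have -> : small v e n = \bigcap_(m in [set m | (n <= m)%N])
    (`[0, 2] `&` [set s | `|g (v m + s) - g (v m)| <= e]).
  apply/seteqP; split=> [s [s02 sm] m nm|s sm].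
    by split => //; exact: sm.
  split; first by have [] := sm n (leqnn n).
  by move=> m nm; have [] := sm m nm.
apply: bigcap_measurableType => m _.
apply: (measurable_fun_le _ _ _); [exact: measurable_itv| |exact: measurable_cst].
apply: measurableT_comp => //; apply: measurable_funB; last exact: measurable_cst.
apply: (@measurable_comp _ _ _ _ _ _ `[B, +oo[%classic) => //.
  move=> _ [s /= s02 <-]; move: s02; rewrite !in_itv/= andbT => /andP[s0 _].
  by rewrite (le_trans (vB m))// lerDl.
by apply: measurable_funD; [exact: measurable_cst|exact: measurable_id].
Qed.

(** The sets [small v e n] increase to [0, 2] by pointwise convergence, so their measures tend to 2.
    The threshold 3/2 is such that two sets above it cannot be disjoint inside an interval of length
    3. *)
Let small_large v (e : R) : (forall m, B <= v m) -> v @ \oo --> +oo -> 0 < e ->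
  \forall n \near \oo, ((3 / 2)%:E < mu (small v e n))%E.
Proof.
move=> vB vy e0.
have cupE : \bigcup_n small v e n = `[0, 2]%classic.
  apply/seteqP; split=> [s [n _ []]//|s s02].
  have : \forall m \near \oo, `|g (v m + s) - g (v m)| <= e.
    have /cvgrPdist_le/(_ e e0) := cvg_comp _ _ vy (hg s).
    by apply: filterS => m /=; rewrite sub0r normrN.
  by case=> n _ nP; exists n => //; split.
have : mu \o small v e @ \oo --> mu (\bigcup_n small v e n).
  apply: nondecreasing_cvg_mu.
  - by move=> i; exact: measurable_small.
  - by rewrite cupE; exact: measurable_itv.
  - move=> n m nm; apply/subsetPset => s [s02 sm]; split => // k mk.
    by apply: sm => /=; rewrite (leq_trans nm).
rewrite cupE lebesgue_measure_itv/= lte_fin ltr0n/= => cv.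
have lt : ((3 / 2)%:E < 2%:E - 0%:E :> \bar R)%E by rewrite -EFinB subr0 lte_fin; lra.
exact: (cv _ (open_ereal_gt' lt)).
Qed.

(* Otherwise u_n -> oo and 0 <= t_n <= 1 violate the bound.  The sets of s in
   [0, 2] at which g varies little past u_n, and past u_n + t_n, both have
   measure close to 2; after translating the latter by t_n they lie in [0, 3]
   and so meet, which bounds g (u_n + t_n) - g u_n. *)
Lemma uniform_additive (e : R) : 0 < e ->
  exists U : R, forall u t : R, U <= u -> 0 <= t -> t <= 1 -> `|g (u + t) - g u| <= e.
Proof.
move=> e0; apply: contrapT => noU.
have /choice[v vP] : forall n : nat, exists p : R * R,
    [/\ B + n%:R <= p.1, 0 <= p.2, p.2 <= 1 & e < `|g (p.1 + p.2) - g p.1|].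
  move=> n; apply: contrapT => no; apply: noU; exists (B + n%:R) => u t uB t0 t1.
  by rewrite leNgt; apply/negP => lt; apply: no; exists (u, t).
pose u n : R := (v n).1; pose t n : R := (v n).2; pose ut n : R := u n + t n.
have uB n : B <= u n by have [h _ _ _] := vP n; rewrite (le_trans _ h)// lerDl.
have utB n : B <= ut n by have [_ h _ _] := vP n; rewrite (le_trans (uB n))// lerDl.
have nP (w : nat -> R) : (forall n, B + n%:R <= w n) -> w @ \oo --> +oo.
  move=> wP; apply/cvgryPge => A; near=> n.
  rewrite (le_trans _ (wP n))// -lerBlDl.
  by near: n; exact: nbhs_infty_ger.
have uy : u @ \oo --> +oo by apply: nP => n; have [] := vP n.
have uty : ut @ \oo --> +oo.
  by apply: nP => n; have [h1 h2 _ _] := vP n; rewrite (le_trans h1)// lerDl.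
have e2 : 0 < e / 2 by rewrite divr_gt0.
have [n [lu lut]] : exists n, ((3 / 2)%:E < mu (small u (e / 2) n))%E /\
    ((3 / 2)%:E < mu (small ut (e / 2) n))%E.
  have h1 := small_large uB uy e2; have h2 := small_large utB uty e2.
  near \oo => n; exists n; split; near: n; [exact: h1|exact: h2].
have mS1 := measurable_small (e / 2) n uB.
have mS2 := measurable_small (e / 2) n utB.
have [unB t0 t1 lt] := vP n; rewrite -/(u n) -/(t n) in unB t0 t1 lt.
pose A := small u (e / 2) n.
pose C := (fun x => x + (- t n)) @^-1` small ut (e / 2) n.
have mC : measurable C.
  rewrite /C -[X in measurable X]setTI.
  by apply: measurable_funD => //; exact: measurable_cst.
have muC : mu C = mu (small ut (e / 2) n).
  exact: lebesgue_measure_shift.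
have AC0 : A `&` C = set0.
  apply/seteqP; split => // s [[_ As] [_ Cs]].
  have := As n (leqnn n); have := Cs n (leqnn n) => /=.
  rewrite /ut (_ : u n + t n + (s - t n) = u n + s); last by ring.
  move=> h1 h2.
  move: lt; apply/negP; rewrite -leNgt.
  have -> : g (u n + t n) - g (u n) =
    (g (u n + s) - g (u n)) - (g (u n + s) - g (u n + t n)) by ring.
  by rewrite (le_trans (ler_normB _ _))//; lra.
have : (mu (A `|` C) <= mu (`[0%R, 3%R]%classic : set R))%E.
  apply: le_measure; rewrite ?inE; [exact: measurableU|exact: measurable_itv|].
  have k1 (x : R) : 0 <= x <= 2 -> 0 <= x <= 3 by move=> /andP[h0 h2]; apply/andP; split; lra.
  have k2 (x y : R) : 0 <= y -> y <= 1 -> 0 <= x - y <= 2 -> 0 <= x <= 3.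
    by move=> h h' /andP[h0 h2]; apply/andP; split; lra.
  by move=> s [[+ _]|[+ _]] /=; rewrite !in_itv/=; [exact: k1|exact: (k2 s (t n))].
have muAC : mu (A `|` C) = (mu A + mu C)%E by apply: measureU.
rewrite muAC muC lebesgue_measure_itv/= lte_fin ltr0n/= -EFinB subr0.
apply/negP; rewrite -ltNge.
have -> : (3%:E = (3 / 2)%:E + (3 / 2)%:E :> \bar R)%E by rewrite -EFinD; congr EFin; lra.
exact: lteD.
Unshelve. all: by end_near. Qed.

End UniformConvergence.

(** In logarithmic coordinates g u = ln (L (exp u)), slow variation becomes the additive hypothesis,
    and a factor a in [1, 2] becomes a shift ln a in [0, 1]. *)
Lemma slowly_varying_uniform (R : realType) (L : R -> R) (e : R) :
  slowly_varying L -> 0 < e ->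
  exists X : R, forall x a : R, X <= x -> 1 <= a -> a <= 2 ->
    0 < L x /\ `|L (a * x) / L x - 1| <= e.
Proof.
move=> [[A [mL L0]] Lcvg] e0.
pose A1 := Num.max A 1.
have A10 : 0 < A1 by rewrite lt_max ltr01 orbT.
have L0' x : A1 <= x -> 0 < L x.
  by move=> A1x; apply: L0; rewrite (le_trans _ A1x)// le_max lexx.
pose g u := ln (L (expR u)).
have Aexp u : ln A1 <= u -> A1 <= expR u.
  by move=> Au; rewrite -(@lnK _ A1)// ler_expR.
have mg : measurable_fun `[ln A1, +oo[ ((@ln R) \o (L \o @expR R)).
  apply: (@measurable_comp _ _ _ _ _ _ (`]0, +oo[%classic : set R)) => //.
  - move=> _ [s /= s02 <-]; move: s02; rewrite !in_itv/= !andbT => /Aexp.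
    exact: L0'.
  - apply: open_continuous_measurable_fun; first exact: interval_open.
    by move=> x; rewrite inE/= in_itv/= andbT; exact: continuous_ln.
  apply: (@measurable_comp _ _ _ _ _ _ (`[A, +oo[%classic : set R)) => //.
    move=> _ [s /= s02 <-]; move: s02; rewrite !in_itv/= !andbT => /Aexp.
    by apply: le_trans; rewrite le_max lexx.
  by apply: measurable_funTS; apply: continuous_measurable_fun; exact: continuous_expR.
have expRy : @expR R u @[u --> +oo] --> +oo.
  apply/cvgryPge => M; near=> u; rewrite (le_trans _ (expR_ge1Dx u))//.
  rewrite -lerBlDl; near: u; apply: nbhs_pinfty_ge; exact: num_real.
have hg t : g (u + t) - g u @[u --> +oo] --> (0 : R).
  rewrite /g; have := Lcvg _ (expR_gt0 t) => h.
  have : ln (L (expR t * expR u) / L (expR u)) @[u --> +oo] --> ln 1.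
    apply: (cvg_comp (fun u => L (expR t * expR u) / L (expR u)) (@ln R)); last exact: (continuous_ln ltr01).
    exact: (cvg_comp _ _ expRy h).
  rewrite ln1; apply: cvg_trans; apply: near_eq_cvg; near=> u.
  have uA : ln A1 <= u by near: u; apply: nbhs_pinfty_ge; exact: num_real.
  have utA : ln A1 <= u + t.
    by rewrite -lerBlDr; near: u; apply: nbhs_pinfty_ge; exact: num_real.
  by rewrite -expRD addrC ln_div ?posrE ?L0' ?Aexp// addrC.
(* An additive error ln (1 + e) exponentiates to at most 1 + e from above; from below, exp (- t) >=
   1 - t and ln (1 + e) <= e give 1 - e. *)
have e1 : 0 < ln (1 + e) by rewrite ln_gt0// ltrDl.
have [U UP] := uniform_additive mg hg e1.
exists (expR (Num.max U (ln A1))) => x a Xx a1 a2.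
have x0 : 0 < x by rewrite (lt_le_trans _ Xx)// expR_gt0.
have a0 : 0 < a by rewrite (lt_le_trans _ a1).
have : Num.max U (ln A1) <= ln x by rewrite -ler_expR lnK.
rewrite ge_max => /andP[Ux Ax].
have A1x : A1 <= x by rewrite -[x]lnK//; exact: Aexp.
have Lx := L0' _ A1x; split => //.
have Lax : 0 < L (a * x).
  by apply: L0'; rewrite (le_trans A1x)// ler_peMl// ltW.
have la1 : ln a <= 1.
  rewrite (@le_trans _ _ (ln (1 + 1)))//; last by rewrite le_ln1Dx// (lt_trans _ ltr01)// ltrN10.
  by rewrite ler_ln ?posrE.
have := UP _ _ Ux (ln_ge0 a1) la1.
rewrite /= -lnM ?posrE// !lnK ?posrE// ?mulr_gt0// (mulrC x) -ln_div ?posrE//.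
set y := L (a * x) / L x => ly.
have y0 : 0 < y by rewrite divr_gt0.
move: ly; rewrite !ler_norml => /andP[ly1 ly2]; apply/andP; split.
  have h : 1 - ln (1 + e) <= y.
    rewrite -[y]lnK ?posrE//; apply: le_trans (_ : expR (- ln (1 + e)) <= _); last by rewrite ler_expR.
    by rewrite (le_trans _ (expR_ge1Dx _)).
  have : ln (1 + e) <= e by rewrite le_ln1Dx// (lt_trans _ e0)// ltrN10.
  by move=> ?; lra.
have : y <= 1 + e.
  by rewrite -ler_ln ?posrE// addr_gt0.
by move=> ?; lra.
Unshelve. all: by end_near. Qed.

(** * Halving recursions and the discrete Karamata theorem *)

(** Strong induction first bounds x; then each halving contracts the bound by q up to a small error,
    and k halvings are available as soon as n >= N 2^k. The index N is at least 2 so that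
    [uphalf n < n]. *)
Lemma halving_cvg0 (R : realType) (x : nat -> R) (q : R) :
  0 <= q -> q < 1 ->
  (forall e : R, 0 < e -> \forall n \near \oo, `|x n| <= q * `|x (uphalf n)| + e) ->
  x @ \oo --> 0.
Proof.
move=> q0 q1 xe; apply/cvgrPdist_le => d d0.
(* With this error term, d / 2 is the fixed point of t |-> q t + g. *)
pose g := (1 - q) * (d / 2).
have g0 : 0 < g by rewrite mulr_gt0 ?divr_gt0// subr_gt0.
have [N [N2 xN]] : exists N, (2 <= N)%N /\ forall n, (N <= n)%N -> `|x n| <= q * `|x (uphalf n)| + g.
  have [N _ NP] := xe g g0.
  exists (maxn N 2); split; first by rewrite leq_maxr.
  by move=> n; rewrite geq_max => /andP[Nn _]; exact: NP.
pose B := \sum_(i < N) `|x i| + d.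
have B0 : 0 <= B by apply: addr_ge0; [exact: sumr_ge0|exact: ltW].
have xB n : `|x n| <= B.
  have [k] := ubnP n; elim: k n => // k IH n; rewrite ltnS => nk.
  have [Nn|nN] := leqP N n; last first.
    rewrite /B (bigD1 (Ordinal nN))//= -addrA lerDl.
    by apply: addr_ge0; [exact: sumr_ge0|exact: ltW].
  apply: (le_trans (xN _ Nn)).
  have /IH h : (uphalf n < k)%N by rewrite uphalf_half; lia.
  have : q * `|x (uphalf n)| <= q * B by rewrite ler_wpM2l.
  have : (1 - q) * (d / 2) <= (1 - q) * B.
    rewrite ler_wpM2l ?subr_ge0 ?ltW//.
    have : d <= B by rewrite lerDr sumr_ge0.
    by move: d0; clear; lra.
  by rewrite -/g; lra.
have xk k n : (N * 2 ^ k <= n)%N -> `|x n| <= q ^+ k * B + d / 2.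
  elim: k n => [|k IH] n.
    by rewrite expn0 muln1 expr0 mul1r => _; rewrite (le_trans (xB n))// lerDl ltW// divr_gt0.
  rewrite expnS mulnCA => nk.
  have Nn : (N <= n)%N by apply: leq_trans nk; rewrite mulnCA leq_pmulr// muln_gt0 expn_gt0.
  apply: (le_trans (xN _ Nn)).
  have h : `|x (uphalf n)| <= q ^+ k * B + d / 2.
    by apply: IH; rewrite uphalf_half; move: nk; set z := (N * 2 ^ k)%N; lia.
  have : q * `|x (uphalf n)| <= q * (q ^+ k * B + d / 2) by rewrite ler_wpM2l.
  by rewrite /g exprS mulrDr -mulrA; lra.
have [k kP] : exists k, q ^+ k * B <= d / 2.
  have : q ^+ k * B @[k --> \oo] --> 0 * B.
    by apply: cvgMl; apply: cvg_expr; rewrite ger0_norm.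
  rewrite mul0r => /cvgrPdist_le/(_ (d / 2)) []; first by rewrite divr_gt0.
  move=> k _ /(_ k (leqnn k)); rewrite sub0r normrN => h; exists k.
  by rewrite (le_trans (ler_norm _)).
exists (N * 2 ^ k)%N => // n /= /xk h; rewrite sub0r normrN.
by rewrite (le_trans h)//; lra.
Qed.

(** The derivative of x^s at 1 along the increments -1/n, after factoring out n^s. It allows k^(s-1)
    to be replaced by a difference that telescopes. *)
Lemma powR_diff_ratio_cvg (R : realType) (s : R) : 0 < s ->
  (n%:R `^ s - n.-1%:R `^ s) / s / n%:R `^ (s - 1) @[n --> \oo] --> (1 : R).
Proof.
move=> s0.
have in1 : (1 : R) \in `]0, +oo[ by rewrite in_itv/= ltr01.
have d1 : is_derive (1 : R) (1 : R) (@powR R ^~ s) s.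
  apply: DeriveDef; first exact: derivable_powR.
  by rewrite -derive1E powR_derive1// powR1 mulr1.
have [/cvg_ex[l lP]] := d1; rewrite /derive (cvg_lim _ lP)// => ls.
move: lP; rewrite ls => /cvgr_dnbhsP lP.
have {}lP (u : nat -> R) : (forall n, u n != 0) -> u @ \oo --> 0 ->
    (u n)^-1 * ((u n + 1) `^ s - 1) @[n --> \oo] --> s.
  move=> u0 uc; have := lP u (conj u0 uc); apply: cvg_trans; apply: near_eq_cvg.
  by near=> n; rewrite /= powR1 [u n *: 1]mulr1.
have h : (- (n.+1%:R)^-1 : R)^-1 * ((- (n.+1%:R)^-1 + 1) `^ s - 1) @[n --> \oo] --> s.
  apply: lP => [n|]; first by rewrite oppr_eq0 invr_eq0 pnatr_eq0.
  by rewrite -[0]oppr0; apply: cvgN; exact: cvg_harmonic.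
rewrite -[X in X @ _ --> _]/(fun n => _) -cvg_shiftS/=.
have : (- (n.+1%:R)^-1 : R)^-1 * ((- (n.+1%:R)^-1 + 1) `^ s - 1) / s @[n --> \oo] --> s / s.
  exact: cvgMl.
rewrite divff ?gt_eqF//; apply: cvg_trans; apply: near_eq_cvg; near=> n.
have n0 : 0 < n.+1%:R :> R by rewrite ltr0n.
have -> : - (n.+1%:R)^-1 + 1 = n%:R / n.+1%:R :> R.
  by rewrite -(natr1 n); field; rewrite natr1 gt_eqF.
have iv : (n.+1%:R^-1 : R) `^ s = (n.+1%:R `^ s)^-1.
  by rewrite -powR_inv1// -powRrM mulN1r powRN.
rewrite powRM ?invr_ge0// iv.
rewrite powRB ?powRr1//; last by apply/implyP => _; rewrite gt_eqF.
rewrite invrN invrK.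
have p0 : n.+1%:R `^ s != 0 :> R by rewrite gt_eqF// powR_gt0.
field.
by rewrite p0 !gt_eqF.
Unshelve. all: by end_near. Qed.

(* Slow variation along the integers.  Uniformity over the dyadic block
   [n/2, n] suffices, because sums are compared with their first half. *)
Definition seq_slowly_varying (R : realType) (l : nat -> R) : Prop :=
  forall e : R, 0 < e -> \forall n \near \oo, forall k, (uphalf n <= k <= n)%N ->
    0 < l k /\ `|l k / l n - 1| <= e.

Lemma slowly_varying_seq (R : realType) (L : R -> R) :
  slowly_varying L -> seq_slowly_varying (fun n => L n%:R).
Proof.
move=> svL e e0.
(* Uniformity controls L n / L k; inverting a ratio within 1/2 of 1 at most doubles its distance to
   1. *)
pose d := Num.min (e / 2) (1 / 2).
have d0 : 0 < d by rewrite lt_min !divr_gt0.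
have [X XP] := slowly_varying_uniform svL d0.
near=> n => k /andP[mk kn].
have Xm : X <= (uphalf n)%:R.
  suff : X *+ 2 <= n%:R.
    have : (n <= (uphalf n).*2)%N by rewrite uphalf_half; lia.
    rewrite -(ler_nat R) -muln2 natrM; rewrite mulr2n; lra.
  by near: n; exact: nbhs_infty_ger.
have Xk : X <= k%:R by rewrite (le_trans Xm)// ler_nat.
have Xn : X <= n%:R by rewrite (le_trans Xk)// ler_nat.
have n0 : (2 <= n)%N by near: n; exists 2.
have k0 : 0 < k%:R :> R by rewrite ltr0n; move: mk; rewrite uphalf_half; lia.
have a1 : 1 <= n%:R / k%:R :> R by rewrite ler_pdivlMr// mul1r ler_nat.
have a2 : n%:R / k%:R <= 2 :> R.
  by rewrite ler_pdivrMr// -natrM ler_nat; move: mk; rewrite uphalf_half; lia.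
have [Lk] := XP _ _ Xk a1 a2; rewrite divfK ?gt_eqF// => h.
have [Ln _] := XP _ _ Xn (lexx 1) (ler1n _ 2).
split => //; move: h.
have : d <= e / 2 by rewrite ge_min lexx.
have : d <= 1 / 2 by rewrite ge_min lexx orbT.
rewrite !ler_norml => d1 d2 /andP[].
rewrite lerBrDl ler_pdivlMr// lerBlDl ler_pdivrMr// => h1 h2.
have e1 : 0 <= (e - 2 * d) * L n%:R by apply: mulr_ge0; [lra|exact: ltW].
apply/andP; split.
  rewrite lerBrDl ler_pdivlMr//.
  have : (1 - 2 * d) * L n%:R <= (1 - 2 * d) * ((1 + d) * L k%:R) by rewrite ler_wpM2l//; lra.
  have : 0 <= d * (1 + 2 * d) * L k%:R by apply: mulr_ge0 (ltW Lk); apply: mulr_ge0; lra.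
  by move: e1; clear; nra.
rewrite lerBlDl ler_pdivrMr//.
have : (1 + 2 * d) * ((1 - d) * L k%:R) <= (1 + 2 * d) * L n%:R by rewrite ler_wpM2l//; lra.
have : 0 <= d * (1 - 2 * d) * L k%:R by apply: mulr_ge0 (ltW Lk); apply: mulr_ge0; lra.
by move: e1; clear; nra.
Unshelve. all: by end_near. Qed.

(** Rounding up costs something: [uphalf n] is at most 3 n / 4 once n >= 2. This is the contraction
    factor in every use of [halving_cvg0]. *)
Lemma uphalf_powR_le (R : realType) (s : R) (n : nat) : 0 <= s -> (2 <= n)%N ->
  (uphalf n)%:R `^ s / n%:R `^ s <= (3 / 4) `^ s.
Proof.
move=> s0 n2; have n0 : 0 < n%:R :> R by rewrite ltr0n (leq_trans _ n2).
rewrite ler_pdivrMr ?powR_gt0// -powRM//.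
apply: ge0_ler_powR => //; rewrite ?nnegrE ?mulr_ge0//.
have : (4 * uphalf n <= 3 * n)%N by rewrite uphalf_half; lia.
by rewrite -(ler_nat R) !natrM; lra.
Qed.

(** The normalized error x obeys a halving recursion. The first half of the sum reproduces x at n/2
    with a factor below 1; on the second half l is nearly constant and k^(s-1) is nearly [dk k],
    whose sum telescopes. *)
Lemma power_sum_cvg (R : realType) (l : nat -> R) (s : R) : 0 < s ->
  seq_slowly_varying l ->
  (\sum_(1 <= k < n.+1) k%:R `^ (s - 1) * l k) / (n%:R `^ s * l n)
    @[n --> \oo] --> s^-1.
Proof.
move=> s0 svl.
pose U n : R := \sum_(1 <= k < n.+1) k%:R `^ (s - 1) * l k.
pose x n := U n / (n%:R `^ s * l n) - s^-1.
apply/subr_cvg0; rewrite -/x.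
pose p : R := (3 / 4) `^ s.
have p0 : 0 < p by rewrite powR_gt0.
have p1 : p < 1.
  have := @gt0_ltr_powR R s s0 (3 / 4) 1; rewrite powR1 -/p; apply; rewrite ?nnegrE//; lra.
pose q := (1 + p) / 2.
apply: (@halving_cvg0 _ x q); rewrite /q; [lra|lra|move=> e e0].
(* The errors [Mb] and [Eb] add up to 4 D / s, hence e s / 4; the bound (1 - p) / 2 keeps p (1 + D)
   below (1 + p) / 2; the bound 1 absorbs a product of two errors. *)
pose D := Num.min (Num.min 1 (e * s / 4)) ((1 - p) / 2).
have D0 : 0 < D by rewrite !lt_min ltr01 !divr_gt0 ?mulr_gt0 ?subr_gt0.
have D1 : D <= 1 by rewrite !ge_min lexx.
have De : D <= e * s / 4 by rewrite !ge_min lexx orbT.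
have Dp : D <= (1 - p) / 2 by rewrite !ge_min lexx !orbT.
pose dk k : R := (k%:R `^ s - k.-1%:R `^ s) / s.
have dk_cvg : k%:R `^ (s - 1) / dk k @[k --> \oo] --> (1 : R).
  have h := powR_diff_ratio_cvg s0.
  have : ((n%:R `^ s - n.-1%:R `^ s) / s / n%:R `^ (s - 1))^-1 @[n --> \oo] --> (1 : R)^-1.
    by apply: cvgV => //; exact: oner_neq0.
  rewrite invr1; apply: cvg_trans; apply: near_eq_cvg; near=> n.
  by rewrite /= invfM invrK mulrC.
have svD := svl D D0.
have /cvgrPdist_le/(_ D D0)[K _ KP] := dk_cvg.
have dk0 k : (0 < k)%N -> 0 < dk k.
  move=> k0; rewrite divr_gt0// subr_gt0; apply: gt0_ltr_powR => //; rewrite ?nnegrE//.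
  by rewrite ltr_nat prednK.
have tele m n : (m <= n)%N -> \sum_(m.+1 <= k < n.+1) dk k = (n%:R `^ s - m%:R `^ s) / s.
  move=> mn; rewrite /dk -mulr_suml; congr (_ / s).
  by rewrite big_add1/= (telescope_sumr (fun i => i%:R `^ s)).
near=> n; pose m := uphalf n.
have n2 : (2 <= n)%N by near: n; exists 2.
have Km : (K <= m)%N.
  suff : (K.*2 <= n)%N by rewrite /m uphalf_half; clear; lia.
  by near: n; exists K.*2.
have mn : (m <= n)%N by rewrite /m uphalf_half; clear; lia.
have m0 : (0 < m)%N by rewrite /m uphalf_half; move: n2; clear; lia.
have n0 : (0 < n)%N by rewrite (leq_trans m0).
have ln : forall k, (m <= k <= n)%N -> 0 < l k /\ `|l k / l n - 1| <= D.
  by rewrite /m; near: n; exact: svD.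
have [ln0 _] : 0 < l n /\ `|l n / l n - 1| <= D by apply: ln; rewrite mn leqnn.
have [lm0 lmn] : 0 < l m /\ `|l m / l n - 1| <= D by apply: ln; rewrite mn leqnn.
have ns0 : 0 < n%:R `^ s :> R by rewrite powR_gt0// ltr0n.
have ms0 : 0 < m%:R `^ s :> R by rewrite powR_gt0// ltr0n.
pose A := m%:R `^ s / n%:R `^ s * (l m / l n).
pose E := (\sum_(m.+1 <= k < n.+1) (k%:R `^ (s - 1) * l k - l n * dk k)) / (n%:R `^ s * l n).
(* The middle term corrects for l m in place of l n in front of the limit s^-1; the last one gathers
   the errors of the second half. *)
have xE : x n = x m * A + s^-1 * (m%:R `^ s / n%:R `^ s) * (l m / l n - 1) + E.
  rewrite /x /E /A /U (@big_cat_nat _ _ _ m.+1 1 n.+1)//= sumrB -mulr_sumr tele//.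
  by field; rewrite !gt_eqF.
have r0 : 0 <= m%:R `^ s / n%:R `^ s :> R by rewrite divr_ge0// ltW.
have r1 : m%:R `^ s / n%:R `^ s <= p by exact: uphalf_powR_le (ltW s0) n2.
have Aq : `|A| <= (1 + p) / 2.
  rewrite normrM ger0_norm//.
  have : `|l m / l n| <= 1 + D.
    by rewrite -[X in `|X|](subrK 1) addrC (le_trans (ler_normD _ _))// normr1 lerD2l.
  move=> h; apply: (@le_trans _ _ (p * (1 + D))); first by rewrite ler_pM.
  have : p * D <= 1 * D by rewrite ler_wpM2r// ltW.
  by move: Dp; clear; lra.
have Eb : `|E| <= 3 * D / s.
  rewrite normrM [X in _ * X]gtr0_norm ?invr_gt0 ?mulr_gt0//.
  rewrite ler_pdivrMr ?mulr_gt0// (le_trans (ler_norm_sum _ _ _))//.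
  apply: (@le_trans _ _ (\sum_(m.+1 <= k < n.+1) 3 * D * l n * dk k)).
    apply: ler_sum_nat => k /andP[mk kn].
    have [lk0 lkn] : 0 < l k /\ `|l k / l n - 1| <= D by apply: ln; rewrite (ltnW mk).
    have d0 : 0 < dk k by apply: dk0; rewrite (leq_trans _ mk).
    have : `|1 - k%:R `^ (s - 1) / dk k| <= D by apply: KP; rewrite /= (leq_trans Km)// ltnW.
    set a := k%:R `^ (s - 1) / dk k; set b := l k / l n in lkn.
    have -> : k%:R `^ (s - 1) * l k - l n * dk k = (a * b - 1) * (l n * dk k).
      by rewrite /a /b; field; rewrite !gt_eqF.
    move=> h; rewrite normrM (gtr0_norm (mulr_gt0 ln0 d0)) -[leRHS]mulrA.
    rewrite ler_pM2r; last exact: mulr_gt0.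
    have -> : a * b - 1 = (b - 1) - (1 - a) * (b - 1) - (1 - a) by ring.
    rewrite (le_trans (ler_normB _ _))// (_ : 3 * D = D + 1 * D + D); last by ring.
    rewrite lerD// (le_trans (ler_normB _ _))// lerD// normrM ler_pM//.
    exact: le_trans D1.
  rewrite -mulr_sumr tele//.
  have -> : 3 * D / s * (n%:R `^ s * l n) = 3 * D * l n * (n%:R `^ s / s) by ring.
  apply: ler_wpM2l; first by apply: mulr_ge0 (ltW ln0); apply: mulr_ge0 (ltW D0).
  by rewrite ler_pM2r ?invr_gt0// gerBl ltW.
have Mb : `|s^-1 * (m%:R `^ s / n%:R `^ s) * (l m / l n - 1)| <= D / s.
  rewrite normrM ger0_norm; last by rewrite mulr_ge0// invr_ge0 ltW.
  have : s^-1 * (m%:R `^ s / n%:R `^ s) <= s^-1.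
    by rewrite ger_pMr ?invr_gt0// (le_trans r1)// ltW.
  move=> h; rewrite [leRHS]mulrC ler_pM//; by rewrite mulr_ge0// invr_ge0 ltW.
rewrite xE (le_trans (ler_normD _ _))//.
have -> : e = e * s / 4 * 4 / s by field; rewrite gt_eqF.
rewrite (le_trans (lerD (ler_normD _ _) (lexx _)))// -addrA lerD//.
  by rewrite normrM mulrC ler_wpM2r.
apply: (le_trans (lerD Mb Eb)); rewrite -mulrDl ler_pM2r ?invr_gt0//; lra.
Unshelve. all: by end_near. Qed.

(** Makes a second application of [power_sum_cvg] possible, to partial sums that are a power times a
    sequence equivalent to a multiple of l. *)
Lemma seq_slowly_varying_equiv (R : realType) (l l' : nat -> R) (c : R) : 0 < c ->
  l' n / l n @[n --> \oo] --> c -> seq_slowly_varying l -> seq_slowly_varying l'.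
Proof.
move=> c0 cvg svl e e0.
(* Three ratios within d <= 1/4 of 1, one of them inverted, have a product within 8 d of 1. *)
pose d := Num.min (e / 8) (1 / 4).
have d0 : 0 < d by rewrite lt_min !divr_gt0.
have d1 : d <= e / 8 by rewrite ge_min lexx.
have d2 : d <= 1 / 4 by rewrite ge_min lexx orbT.
have [K _ KP] : \forall n \near \oo, `|c - l' n / l n| <= d * c.
  by move/cvgrPdist_le: cvg; apply; rewrite mulr_gt0.
have svd := svl d d0.
near=> n => k /andP[mk kn].
have Km : (K <= uphalf n)%N.
  suff : (K.*2 <= n)%N by rewrite uphalf_half; lia.
  by near: n; exists K.*2.
have H : forall k, (uphalf n <= k <= n)%N -> 0 < l k /\ `|l k / l n - 1| <= d.
  by near: n; exact: svd.
have [lk hk] := H k (introT andP (conj mk kn)).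
have [ln _] : 0 < l n /\ `|l n / l n - 1| <= d by apply: H; rewrite leqnn (leq_trans mk).
have := KP k (leq_trans Km mk) => /=; have := KP n (leq_trans (leq_trans Km mk) kn) => /=.
set a := l' n / l n; set b := l' k / l k => ha hb.
have {}ha : `|a / c - 1| <= d.
  by rewrite -(ler_pM2r c0) -[X in _ * X](gtr0_norm c0) -normrM mulrBl mul1r divfK ?gt_eqF// distrC.
have {}hb : `|b / c - 1| <= d.
  by rewrite -(ler_pM2r c0) -[X in _ * X](gtr0_norm c0) -normrM mulrBl mul1r divfK ?gt_eqF// distrC.
have lE : l' k / l' n = (b / c) / (a / c) * (l k / l n).
  have [a0|a0] := eqVneq (l' n) 0; first by rewrite /a a0 !mul0r invr0 !mulr0 mul0r.
  by rewrite /a /b; field; rewrite a0 !gt_eqF.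
move: ha hb hk; rewrite !ler_norml => /andP[a1 a2] /andP[b1 b2] /andP[k1 k2].
have l'k : 0 < l' k.
  have : 0 < b / c by lra.
  by rewrite pmulr_lgt0 ?invr_gt0// pmulr_lgt0 ?invr_gt0.
split => //; rewrite lE; move: a1 a2 b1 b2 k1 k2.
move: (a / c) (b / c) (l k / l n) => x y z x1 x2 y1 y2 z1 z2.
have x0 : 0 < x by lra.
apply/andP; split.
  rewrite lerBrDl mulrAC ler_pdivlMr//.
  have : (1 - d) * (1 - d) <= y * z by apply: ler_pM; lra.
  have : (1 - e) * x <= (1 - e) * x by [].
  have : 0 <= (e - 8 * d) * x by apply: mulr_ge0; lra.
  have : (1 - 8 * d) * x <= 1 - 4 * d.
    have [h|h] := leP 0 (1 - 8 * d); last by apply: (@le_trans _ _ 0); [rewrite nmulr_rle0// ltW|lra].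
    apply: (@le_trans _ _ ((1 - 8 * d) * (1 + d))); first by rewrite ler_wpM2l//; lra.
    by move: d0 d2; clear; nra.
  by move: d0 d2; clear; nra.
rewrite lerBlDl mulrAC ler_pdivrMr//.
have : y * z <= (1 + d) * (1 + d) by apply: ler_pM; lra.
have : 0 <= (e - 8 * d) * x by apply: mulr_ge0; lra.
have : (1 + 8 * d) * (1 - d) <= (1 + 8 * d) * x by rewrite ler_wpM2l//; lra.
by move: d0 d2; clear; nra.
Unshelve. all: by end_near. Qed.

(** * Sums of long-range dependent covariances *)

Definition ndist (i j : nat) : nat := (i - j + (j - i))%N.

Lemma ndistC i j : ndist i j = ndist j i. Proof. by rewrite /ndist addnC. Qed.

Lemma ndistxx i : ndist i i = 0%N. Proof. by rewrite /ndist subnn. Qed.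

(** Grouping off-diagonal pairs by their larger index gives partial sums of partial sums, the shape
    to which the discrete Karamata theorem applies twice. *)
Lemma toeplitz_sum (R : realType) (f : nat -> R) n :
  \sum_(i < n) \sum_(j < n) f (ndist i j) =
  n%:R * f 0%N + 2 * \sum_(m < n) \sum_(1 <= k < m.+1) f k.
Proof.
elim: n => [|n IH]; first by rewrite !big_ord0 mul0r mulr0 addr0.
rewrite big_ord_recr/=.
under eq_bigr do rewrite big_ord_recr/=.
rewrite big_split/= IH big_ord_recr/= [X in _ = _ + 2 * X]big_ord_recr/= ndistxx.
have -> : \sum_(i < n) f (ndist n i) = \sum_(i < n) f (ndist i n).
  by apply: eq_bigr => i _; rewrite ndistC.
have -> : \sum_(i < n) f (ndist i n) = \sum_(1 <= k < n.+1) f k.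
  rewrite big_add1/= big_mkord (reindex_inj rev_ord_inj)/=.
  by apply: eq_bigr => i _; congr f; rewrite /ndist /=; have := ltn_ord i; clear; lia.
by rewrite -natr1; ring.
Qed.

Section LongRange.
Context {R : realType} (D : R) (l r : nat -> R).
Hypothesis (D0 : 0 < D) (D1 : D < 1).
Hypothesis svl : seq_slowly_varying l.
Hypothesis rE : forall k, (1 <= k)%N -> r k = l k * k%:R `^ (- D).

Let r_gt0 k : (1 <= k)%N -> 0 < l k -> 0 < r k.
Proof. by move=> k1 lk; rewrite rE// mulr_gt0// powR_gt0// ltr0n. Qed.

(** The factor 4 is 2 times 2. Both l j and l k lie within 1/3 of l (k + h), and (1 + 1/3) / (1 -
    1/3) = 2; moreover k <= 2 j and D < 1 give j^-D <= 2 k^-D. The lemma controls all covariances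
    between two windows of length h at distance k. *)
Lemma long_range_shift h : \forall k \near \oo,
  forall j, (k <= j + h)%N -> (j <= k + h)%N -> 0 < r j <= 4 * r k.
Proof.
have e0 : 0 < 1 / 3 :> R by rewrite divr_gt0.
have [K _ KP] := svl e0.
near=> k => j kj jk.
have Kk : (K <= k)%N by near: k; exists K.
(* This puts k - h, hence j, in the dyadic block that ends at k + h. *)
have hk : (3 * h < k)%N by near: k; exists (3 * h).+1.
have H := KP (k + h)%N (leq_trans Kk (leq_addr _ _)).
have [lj hj] : 0 < l j /\ `|l j / l (k + h) - 1| <= 1 / 3.
  by apply: H; rewrite jk andbT uphalf_half; move: kj hk; clear; lia.
have [lk hk'] : 0 < l k /\ `|l k / l (k + h) - 1| <= 1 / 3.
  by apply: H; rewrite leq_addr andbT uphalf_half; move: kj hk; clear; lia.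
have [lkh _] : 0 < l (k + h) /\ `|l (k + h) / l (k + h) - 1| <= 1 / 3.
  by apply: H; rewrite leqnn andbT uphalf_half; move: kj hk; clear; lia.
have j1 : (1 <= j)%N by move: kj hk; clear; lia.
have k1 : (1 <= k)%N by move: hk; clear; lia.
rewrite r_gt0//= !rE//.
have ljk : l j <= 2 * l k.
  move: hj hk'; rewrite !ler_norml => /andP[_] + /andP[+ _].
  rewrite lerBlDl ler_pdivrMr// lerBrDl ler_pdivlMr//; lra.
have -> : 4 * (l k * k%:R `^ (- D)) = 2 * l k * (2 * k%:R `^ (- D)) by ring.
apply: ler_pM => //; [exact: ltW|].
have k0 : 0 < k%:R :> R by rewrite ltr0n.
have j0 : 0 < j%:R :> R by rewrite ltr0n.
rewrite !powRN -ler_pdivrMl// mulrC -invfM lef_pV2 ?posrE ?mulr_gt0 ?powR_gt0//.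
apply: (@le_trans _ _ ((2 * j%:R) `^ D)).
  apply: ge0_ler_powR; [exact: ltW|by rewrite nnegrE|by rewrite nnegrE mulr_ge0|].
  by rewrite -natrM ler_nat; move: kj hk; clear; lia.
rewrite powRM ?ler0n// mulrC ler_pM2l ?powR_gt0//.
by apply: ler1_powR; [rewrite ler1n|exact: ltW].
Unshelve. all: by end_near. Qed.

(** Since l may be unbounded, the decay is not immediate from the formula. By slow variation r n is
    at most a factor p / (1 - d) < 1 times r at n/2, and the halving recursion concludes. *)
Lemma long_range_cvg0 : r @ \oo --> 0.
Proof.
pose p : R := (3 / 4) `^ D.
have p0 : 0 < p by rewrite powR_gt0.
have p1 : p < 1.
  have := @gt0_ltr_powR R _ D0 (3 / 4) 1; rewrite powR1 -/p; apply; rewrite ?nnegrE//; lra.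
pose q := (1 + p) / 2.
apply: (@halving_cvg0 _ _ q); rewrite /q; [lra|lra|move=> e e0].
pose d := (1 - p) / 3.
have d0 : 0 < d by rewrite divr_gt0// subr_gt0.
have svd := svl d0.
near=> n; pose m := uphalf n.
have n2 : (2 <= n)%N by near: n; exists 2.
have mn : (m <= n)%N by rewrite /m uphalf_half; clear; lia.
have m1 : (0 < m)%N by rewrite /m uphalf_half; move: n2; clear; lia.
have H : forall k, (m <= k <= n)%N -> 0 < l k /\ `|l k / l n - 1| <= d.
  by rewrite /m; near: n; exact: svd.
have [ln _] : 0 < l n /\ `|l n / l n - 1| <= d by apply: H; rewrite leqnn mn.
have [lm hm] : 0 < l m /\ `|l m / l n - 1| <= d by apply: H; rewrite leqnn mn.
have n0 : 0 < n%:R :> R by rewrite ltr0n (leq_trans m1).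
have m0 : 0 < m%:R :> R by rewrite ltr0n.
rewrite !gtr0_norm ?r_gt0// ?(leq_trans m1)//.
rewrite (@le_trans _ _ ((1 + p) / 2 * r m))//; last by rewrite lerDl ltW.
have pn : 0 < n%:R `^ D :> R by rewrite powR_gt0.
have pm : 0 < m%:R `^ D :> R by rewrite powR_gt0.
have r1 : m%:R `^ D / n%:R `^ D <= p by exact: uphalf_powR_le (ltW D0) n2.
rewrite !rE ?(leq_trans m1)// !powRN.
have -> : l n / n%:R `^ D = (m%:R `^ D / n%:R `^ D) * (l n / m%:R `^ D).
  by field; rewrite !gt_eqF.
have h2 : l n <= l m / (1 - d).
  have d1 : 0 < 1 - d by rewrite /d; move: p0 p1; lra.
  rewrite ler_pdivlMr// mulrC -ler_pdivlMr//.
  by move: hm; rewrite ler_norml => /andP[+ _]; lra.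
apply: (@le_trans _ _ (p * (l m / (1 - d) / m%:R `^ D))).
  apply: ler_pM => //; first by rewrite divr_ge0// ltW.
  by rewrite ler_pM2r ?invr_gt0.
have -> : p * (l m / (1 - d) / m%:R `^ D) = p / (1 - d) * (l m / m%:R `^ D) by ring.
rewrite ler_pM2r ?divr_gt0//.
rewrite ler_pdivrMr /d; move: p0 p1; nra.
Unshelve. all: by end_near. Qed.

Let nrm n : R := n%:R `^ (2 - D) * l n.

(** The ratio is the inverse of n^(1-D) l n, which grows because D < 1, again by halving. Diagonal
    terms, finitely many lags and boundary terms are all negligible through this limit. *)
Lemma long_range_normalizer : n%:R / nrm n @[n --> \oo] --> 0.
Proof.
have s0 : 0 < 1 - D by rewrite subr_gt0.
pose p : R := (3 / 4) `^ (1 - D).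
have p0 : 0 < p by rewrite powR_gt0.
have p1 : p < 1.
  have := @gt0_ltr_powR R _ s0 (3 / 4) 1; rewrite powR1 -/p; apply; rewrite ?nnegrE//; lra.
pose q := (1 + p) / 2.
apply: (@halving_cvg0 _ _ q); rewrite /q; [lra|lra|move=> e e0].
pose d := (1 - p) / 2.
have d0 : 0 < d by rewrite divr_gt0// subr_gt0.
have svd := svl d0.
near=> n; pose m := uphalf n.
have n2 : (2 <= n)%N by near: n; exists 2.
have mn : (m <= n)%N by rewrite /m uphalf_half; clear; lia.
have m1 : (0 < m)%N by rewrite /m uphalf_half; move: n2; clear; lia.
have H : forall k, (m <= k <= n)%N -> 0 < l k /\ `|l k / l n - 1| <= d.
  by rewrite /m; near: n; exact: svd.
have [ln _] : 0 < l n /\ `|l n / l n - 1| <= d by apply: H; rewrite leqnn mn.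
have [lm hm] : 0 < l m /\ `|l m / l n - 1| <= d by apply: H; rewrite leqnn mn.
have n0 : 0 < n%:R :> R by rewrite ltr0n (leq_trans m1).
have m0 : 0 < m%:R :> R by rewrite ltr0n.
have E k : 0 < k%:R :> R -> k%:R / nrm k = (k%:R `^ (1 - D) * l k)^-1.
  move=> k0; rewrite /nrm (_ : 2 - D = 1 + (1 - D)); last by ring.
  rewrite powRD; last by apply/implyP => _; rewrite gt_eqF.
  by rewrite powRr1 ?ltW// -mulrA invfM mulrA divff ?gt_eqF// mul1r.
have pn : 0 < n%:R `^ (1 - D) :> R by rewrite powR_gt0.
have pm : 0 < m%:R `^ (1 - D) :> R by rewrite powR_gt0.
rewrite !E// !gtr0_norm ?invr_gt0 ?mulr_gt0//.
have -> : (n%:R `^ (1 - D) * l n)^-1 = (m%:R `^ (1 - D) / n%:R `^ (1 - D)) * (l m / l n) * (m%:R `^ (1 - D) * l m)^-1.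
  by field; rewrite !gt_eqF.
rewrite (@le_trans _ _ ((1 + p) / 2 * (m%:R `^ (1 - D) * l m)^-1))//; last by rewrite lerDl ltW.
rewrite ler_pM2r ?invr_gt0 ?mulr_gt0//.
have r1 : m%:R `^ (1 - D) / n%:R `^ (1 - D) <= p by exact: uphalf_powR_le (ltW s0) n2.
have h2 : l m / l n <= 1 + d by move: hm; rewrite ler_norml => /andP[_]; lra.
apply: (@le_trans _ _ (p * (1 + d))); first by rewrite ler_pM// divr_ge0// ltW.
have : p * d <= 1 * d by rewrite ler_wpM2r// ltW.
by rewrite /d; lra.
Unshelve. all: by end_near. Qed.

Let S m := \sum_(1 <= k < m.+1) r k.

Let SE : S n / (n%:R `^ (1 - D) * l n) @[n --> \oo] --> (1 - D)^-1.
Proof.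
have s0 : 0 < 1 - D by rewrite subr_gt0.
have := power_sum_cvg s0 svl; apply: cvg_trans; apply: near_eq_cvg; near=> n.
congr (_ / _); apply: eq_big_nat => k /andP[k1 _]; rewrite rE// mulrC; congr (_ * _ `^ _); ring.
Unshelve. all: by end_near. Qed.

(** The discrete Karamata theorem is applied to r, which gives 1 / (1 - D), and then to the partial
    sums S n = n^(1-D) [l2 n], which gives 1 / (2 - D). The factor 2 comes from the symmetry in (i,
    j). *)
Lemma long_range_double_sum :
  (\sum_(i < n) \sum_(j < n) r (ndist i j)) / nrm n @[n --> \oo] -->
  2 / ((1 - D) * (2 - D)).
Proof.
have s0 : 0 < 1 - D by rewrite subr_gt0.
have s1 : 0 < 2 - D by rewrite subr_gt0 (lt_trans D1)// ltrDl.
pose l2 n := S n / n%:R `^ (1 - D).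
have l2l : l2 n / l n @[n --> \oo] --> (1 - D)^-1.
  have := SE; apply: cvg_trans; apply: near_eq_cvg; near=> n.
  by rewrite /l2 invfM mulrA.
have c0 : 0 < (1 - D)^-1 by rewrite invr_gt0.
have svl2 := seq_slowly_varying_equiv c0 l2l svl.
have h := power_sum_cvg s1 svl2.
have hn : (n%:R)^-1 @[n --> \oo] --> (0 : R).
  by rewrite -cvg_shiftS/=; exact: cvg_harmonic.
have h0 := long_range_normalizer.
(* The double sum stops at S (n - 1) while the power sum includes S n; the term 1 / n is the
   normalized S n. *)
have : r 0%N * (n%:R / nrm n) + 2 * ((\sum_(1 <= k < n.+1) k%:R `^ (2 - D - 1) * l2 k) / (n%:R `^ (2 - D) * l2 n)
   - (n%:R)^-1) * (l2 n / l n)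
  @[n --> \oo] --> r 0%N * 0 + 2 * ((2 - D)^-1 - 0) * (1 - D)^-1.
  apply: cvgD; first exact: cvgMr.
  by apply: cvgM => //; apply: cvgMr; apply: cvgB.
rewrite mulr0 add0r subr0 (_ : 2 / ((1 - D) * (2 - D)) = 2 * (2 - D)^-1 * (1 - D)^-1); last first.
  by field; rewrite !gt_eqF.
apply: cvg_trans; apply: near_eq_cvg.
have svd := svl ltr01; have svd2 := svl2 1 ltr01.
near=> n.
have n0 : 0 < n%:R :> R by rewrite ltr0n; near: n; exists 1%N.
have H : forall k, (uphalf n <= k <= n)%N -> 0 < l k /\ `|l k / l n - 1| <= 1.
  by near: n; exact: svd.
have H2 : forall k, (uphalf n <= k <= n)%N -> 0 < l2 k /\ `|l2 k / l2 n - 1| <= 1.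
  by near: n; exact: svd2.
have hh : (uphalf n <= n <= n)%N by rewrite leqnn uphalf_half; clear; lia.
have [ln _] := H n hh; have [l2n _] := H2 n hh.
have -> : \sum_(1 <= k < n.+1) k%:R `^ (2 - D - 1) * l2 k = \sum_(1 <= k < n.+1) S k.
  apply: eq_big_nat => k /andP[k1 _]; rewrite /l2 (_ : 2 - D - 1 = 1 - D); last by ring.
  by rewrite mulrC divfK// gt_eqF// powR_gt0// ltr0n.
rewrite toeplitz_sum; set W := \sum_(m < n) _.
have -> : \sum_(1 <= k < n.+1) S k = W + S n.
  rewrite /W -(big_mkord xpredT S) big_nat_recr//=; last by near: n; exists 1%N.
  rewrite [X in _ = X + _]big_ltn//=; last by near: n; exists 1%N.
  by rewrite [S 0]/S [X in _ = X + _ + _]big_geq// add0r.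
have -> : S n = l2 n * n%:R `^ (1 - D) by rewrite /l2 divfK// gt_eqF// powR_gt0.
rewrite /nrm (_ : 2 - D = 1 + (1 - D)); last by ring.
rewrite powRD; last by apply/implyP => _; rewrite gt_eqF.
rewrite powRr1 ?ltW//.
by field; rewrite !gt_eqF// powR_gt0.
Unshelve. all: by end_near. Qed.


(** Beyond some lag K, f is at most g r and contributes at most about g c. The finitely many smaller
    lags involve O(n) pairs, negligible by [long_range_normalizer]. *)
Lemma long_range_negligible (f : nat -> R) :
  (forall k, 0 <= f k) ->
  (forall e, 0 < e -> \forall k \near \oo, f k <= e * r k) ->
  (\sum_(i < n) \sum_(j < n) f (ndist i j)) / nrm n @[n --> \oo] --> 0.
Proof.
move=> f0 fr; apply/cvgrPdist_le => e e0.
pose c := 2 / ((1 - D) * (2 - D)).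
have c0 : 0 < c.
  have s0 : 0 < 1 - D by rewrite subr_gt0.
  have s1 : 0 < 2 - D by rewrite subr_gt0 (lt_trans D1)// ltrDl.
  by rewrite divr_gt0// mulr_gt0.
(* Then g (c + 1) = e / 2, where c + 1 eventually bounds the normalized double sum of r. *)
pose g := e / (2 * c + 2).
have g0 : 0 < g by rewrite divr_gt0// addr_gt0// mulr_gt0.
have [K _ KP] := fr g g0.
(* The absolute value accounts for small lags, at which r may be negative. *)
pose M := \sum_(k < K) (f k + g * `|r k|).
have M0 : 0 <= M by apply: sumr_ge0 => k _; rewrite addr_ge0// mulr_ge0// ltW.
have fb k : f k <= g * r k + M * (k < K)%:R.
  have [Kk|kK] := leqP K k; first by rewrite mulr0 addr0; exact: KP.
  rewrite mulr1 /M (bigD1 (Ordinal kK))//= addrA.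
  rewrite (@le_trans _ _ (g * r k + (f k + g * `|r k|)))//.
    have hr : - r k <= `|r k| by rewrite -normrN ler_norm.
    have : 0 <= g * (r k + `|r k|) by apply: mulr_ge0 (ltW g0) _; lra.
    by rewrite mulrDr; lra.
  by rewrite addrA lerDl sumr_ge0// => i _; rewrite addr_ge0// mulr_ge0// ltW.
have hK n : \sum_(i < n) \sum_(j < n) (ndist i j < K)%:R <= n%:R * (1 + 2 * K%:R) :> R.
  rewrite (toeplitz_sum (fun k => (k < K)%:R)) mulrDr lerD//.
    by rewrite ler_wpM2l// lern1; case: (_ < _)%N.
  rewrite mulrCA ler_pM2l//.
  have -> : n%:R * K%:R = \sum_(m < n) K%:R :> R by rewrite sumr_const card_ord -[RHS]mulr_natl.
  apply: ler_sum => m _.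
  rewrite -natr_sum ler_nat.
  apply: (@leq_trans (minn m K)); last exact: geq_minr.
  elim: (m : nat) => [|i IH]; first by rewrite big_nil.
  by rewrite big_nat_recr//=; move: IH; case: ltnP; clear; lia.
have h1 := long_range_double_sum.
have h0 := long_range_normalizer.
have : g * (c + 1) + M * (1 + 2 * K%:R) * (n%:R / nrm n) @[n --> \oo] --> g * (c + 1) + M * (1 + 2 * K%:R) * 0.
  by apply: cvgD; [exact: cvg_cst|exact: cvgMr].
rewrite mulr0 addr0 => h2.
have ge : g * (c + 1) < e.
  have c2 : 0 < 2 * c + 2 by move: c0; lra.
  rewrite /g mulrAC ltr_pdivrMr// ltr_pM2l//; move: c0; lra.
have h3 := cvgr_lt _ h2 _ ge.
have /cvgrPdist_le/(_ 1 ltr01) h4 := h1.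
have svd := svl ltr01.
near=> n.
have n1 : (1 <= n)%N by near: n; exists 1%N.
have H : forall k, (uphalf n <= k <= n)%N -> 0 < l k /\ `|l k / l n - 1| <= 1.
  by near: n; exact: svd.
have [ln _] : 0 < l n /\ `|l n / l n - 1| <= 1.
  by apply: H; rewrite leqnn uphalf_half; clear; lia.
have nn : 0 < nrm n by rewrite mulr_gt0// powR_gt0// ltr0n.
have hc : `|c - (\sum_(i < n) \sum_(j < n) r (ndist i j)) / nrm n| <= 1 by near: n; exact: h4.
have h5 : g * (c + 1) + M * (1 + 2 * K%:R) * (n%:R / nrm n) < e by near: n; exact: h3.
rewrite sub0r normrN ger0_norm; last first.
  by apply: divr_ge0 (ltW nn); apply: sumr_ge0 => i _; exact: sumr_ge0.
apply: le_trans (ltW h5).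
apply: (@le_trans _ _ (g * ((\sum_(i < n) \sum_(j < n) r (ndist i j)) / nrm n) + M * (1 + 2 * K%:R) * (n%:R / nrm n))); last first.
  by rewrite lerD2r ler_pM2l//; move: hc; rewrite ler_norml => /andP[+ _]; lra.
rewrite !mulrA -mulrDl ler_pM2r ?invr_gt0//.
apply: (@le_trans _ _ (g * (\sum_(i < n) \sum_(j < n) r (ndist i j)) + M * \sum_(i < n) \sum_(j < n) (ndist i j < K)%:R)); last first.
  by rewrite lerD2l -mulrA ler_wpM2l// mulrC.
rewrite !mulr_sumr -big_split/=; apply: ler_sum => i _.
by rewrite !mulr_sumr -big_split/=; apply: ler_sum => j _.
Unshelve. all: by end_near. Qed.

End LongRange.

Section GramKernels.
Context {R : realType}.

(** * Positive semidefinite kernels *)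

Definition psd (I : finType) (K : I -> I -> R) : Prop :=
  forall x : I -> R, 0 <= \sum_i \sum_j x i * x j * K i j.

(** A finite sum of rank-one kernels. In this form closure under entrywise products is immediate, so
    the Schur product theorem reduces to [psd_gram]. *)
Definition gram (I : finType) (K : I -> I -> R) : Prop :=
  exists s : seq (I -> R), forall i j, K i j = \sum_(v <- s) v i * v j.

Lemma gram_psd (I : finType) (K : I -> I -> R) : gram K -> psd K.
Proof.
move=> [s Ks] x.
have -> : \sum_i \sum_j x i * x j * K i j = \sum_(v <- s) (\sum_i x i * v i) ^+ 2.
  under eq_bigr => i _ do under eq_bigr => j _ do rewrite Ks mulr_sumr.
  under eq_bigr => i _ do rewrite exchange_big/=.
  rewrite exchange_big/=; apply: eq_bigr => v _.
  rewrite expr2 mulr_suml; apply: eq_bigr => i _; rewrite mulr_sumr.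
  by apply: eq_bigr => j _; ring.
by apply: sumr_ge0 => v _; exact: sqr_ge0.
Qed.

Lemma gramM (I : finType) (K K' : I -> I -> R) :
  gram K -> gram K' -> gram (fun i j => K i j * K' i j).
Proof.
move=> [s Ks] [s' Ks']; exists [seq (fun i => v i * w i) | v <- s, w <- s'] => i j.
rewrite big_allpairs_dep/= Ks Ks' mulr_suml; apply: eq_bigr => v _.
by rewrite mulr_sumr; apply: eq_bigr => w _; ring.
Qed.

Lemma gramX (I : finType) (K : I -> I -> R) k :
  gram K -> gram (fun i j => K i j ^+ k).
Proof.
move=> gK; elim: k => [|k IH].
  by exists [:: fun=> 1] => i j; rewrite big_seq1 mulr1.
have [s sP] := gramM gK IH; exists s => i j; rewrite -sP; exact: exprS.
Qed.

(* Gaussian elimination: K - K_ia K_aj / K_aa is psd with one nonzero row fewer. *)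
Lemma psd_gram (I : finType) (K : I -> I -> R) :
  (forall i j, K i j = K j i) -> psd K -> gram K.
Proof.
have [n] := ubnP #|[pred i | [exists j, K i j != 0]]|.
elim: n K => // n IH K; rewrite ltnS => cn Ksym Kpsd.
have [[a Ka]|no] := pselect (exists a, [exists j, K a j != 0]); last first.
  exists [::] => i j; rewrite big_nil; apply: contrapT => /eqP Kij; apply: no.
  by exists i; apply/existsP; exists j.
pose e i : R := (i == a)%:R.
have esum (F : I -> R) : \sum_i e i * F i = F a.
  rewrite (bigD1 a)//= /e eqxx mul1r big1 ?addr0// => i /negbTE ->.
  by rewrite mul0r.
have shiftE (x : I -> R) t : \sum_i \sum_j (x i + t * e i) * (x j + t * e j) * K i j =
    \sum_i \sum_j x i * x j * K i j + 2 * t * (\sum_j x j * K a j) + t ^+ 2 * K a a.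
  transitivity (\sum_i (\sum_j x i * x j * K i j + t * (x i * (\sum_j e j * K i j))
     + t * (e i * (\sum_j x j * K i j)) + t ^+ 2 * (e i * (\sum_j e j * K i j)))).
    apply: eq_bigr => i _; rewrite !mulr_sumr -!big_split/=.
    by apply: eq_bigr => j _; ring.
  rewrite !big_split/= -!mulr_sumr !esum.
  under [in X in _ + t * X + _ + _]eq_bigr => i _ do rewrite esum Ksym.
  ring.
have Kaa0 : 0 <= K a a.
  have := Kpsd e; under eq_bigr => i _ do under eq_bigr => j _ do rewrite -mulrA.
  by under eq_bigr => i _ do rewrite -mulr_sumr esum; rewrite esum.
have [Kaa|Kaa] := eqVneq (K a a) 0.
  exfalso; move/existsP: Ka => [b Kab].
  have bE : \sum_j (j == b)%:R * K a j = K a b.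
    rewrite (bigD1 b)//= eqxx mul1r big1 ?addr0// => i /negbTE ->.
    by rewrite mul0r.
  pose q := \sum_i \sum_j (i == b)%:R * (j == b)%:R * K i j.
  have H t : 0 <= q + 2 * t * K a b.
    have := Kpsd (fun i => (i == b)%:R + t * e i).
    by rewrite shiftE Kaa mulr0 addr0 bE.
  (* If K_aa = 0 and K_ab <> 0, the form at e_b + t e_a is affine in t with nonzero slope; at this t
     it equals -1. *)
  have := H (- (q + 1) / (2 * K a b)).
  have -> : 2 * (- (q + 1) / (2 * K a b)) * K a b = - (q + 1) by field.
  lra.
have Kaa1 : 0 < K a a by rewrite lt_neqAle eq_sym Kaa.
pose K' i j := K i j - K i a * K a j / K a a.
have K'sym i j : K' i j = K' j i.
  by rewrite /K' (Ksym i j) (Ksym i a) (Ksym a j); ring.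
have K'psd : psd K'.
  (* The minimizer of the form of K along x + t e_a; the minimum is the form of K' at x. *)
  move=> x; pose t := - (\sum_j x j * K a j) / K a a.
  have -> : \sum_i \sum_j x i * x j * K' i j =
      \sum_i \sum_j (x i + t * e i) * (x j + t * e j) * K i j; last exact: Kpsd.
  rewrite shiftE /K'.
  transitivity (\sum_i \sum_j x i * x j * K i j - (\sum_i x i * K a i) * (\sum_j x j * K a j) / K a a).
    rewrite mulr_suml mulr_suml -sumrB; apply: eq_bigr => i _.
    rewrite mulr_sumr mulr_suml -sumrB; apply: eq_bigr => j _.
    by rewrite (Ksym i a); ring.
  by rewrite /t; field.
have [s sP] : gram K'.
  apply: IH => //; apply: leq_trans cn; apply: proper_card.
  apply/properP; split.
    apply/fintype.subsetP => i; rewrite !inE => /existsP[j K'ij].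
    apply: contraT => /existsPn Ki0; move: K'ij.
    have Ki k : K i k = 0 by have := Ki0 k; rewrite negbK => /eqP.
    by rewrite /K' !Ki mul0r mul0r subrr eqxx.
  exists a; first by rewrite inE.
  rewrite inE; apply/existsPn => j; rewrite negbK /K'.
  by rewrite mulrAC divff// mul1r subrr.
exists ((fun i => K i a / Num.sqrt (K a a)) :: s) => i j.
rewrite big_cons -sP /K' (Ksym a j) mulrACA -invfM -expr2 sqr_sqrtr//.
by ring.
Qed.

(* The blocks (th S, C; C^T, th S) form a psd kernel; so do its entrywise
   powers, and testing them against (x, - x) or (x, x) bounds C^k by (th S)^k. *)
Lemma gram_cross_power (I : finType) (S C : I -> I -> R) (th : R) :
  (forall i j, S i j = S j i) ->
  (forall x y : I -> R, 0 <= th * \sum_i \sum_j x i * x j * S i j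
      + 2 * \sum_i \sum_j x i * y j * C i j + th * \sum_i \sum_j y i * y j * S i j) ->
  forall k (x : I -> R), `|\sum_i \sum_j x i * x j * C i j ^+ k| <=
    th ^+ k * \sum_i \sum_j x i * x j * S i j ^+ k.
Proof.
move=> Ssym Kpos k x.
pose K (a b : I + I) := match a, b with
  | inl i, inl j => th * S i j | inl i, inr j => C i j
  | inr i, inl j => C j i | inr i, inr j => th * S i j end.
have Ksym a b : K a b = K b a by case: a b => [i|i] [j|j] //=; rewrite Ssym.
have sumE (f : I + I -> I + I -> R) : \sum_a \sum_b f a b =
  \sum_i \sum_j f (inl i) (inl j) + \sum_i \sum_j f (inl i) (inr j)
  + \sum_i \sum_j f (inr i) (inl j) + \sum_i \sum_j f (inr i) (inr j).
  rewrite big_sumType/= -addrA; congr (_ + _).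
    by rewrite -big_split/=; apply: eq_bigr => i _; rewrite big_sumType.
  by rewrite -big_split/=; apply: eq_bigr => i _; rewrite big_sumType.
have swap (x' y : I -> R) j' : \sum_i \sum_j x' i * y j * C j i ^+ j' =
    \sum_i \sum_j y i * x' j * C i j ^+ j'.
  rewrite exchange_big/=; apply: eq_bigr => i _; apply: eq_bigr => j _.
  by rewrite (mulrC (x' j)).
have Kpsd : psd K.
  move=> z; rewrite sumE/=; have := Kpos (z \o inl) (z \o inr).
  have -> : \sum_i \sum_j z (inr i) * z (inl j) * C j i =
      \sum_i \sum_j z (inl i) * z (inr j) * C i j.
    rewrite exchange_big/=; apply: eq_bigr => i _; apply: eq_bigr => j _.
    by rewrite (mulrC (z (inr _))).
  have thE (F : I -> I -> R) (G : I -> I -> R) : \sum_i \sum_j F i j * (th * G i j) =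
      th * \sum_i \sum_j F i j * G i j.
    rewrite mulr_sumr; apply: eq_bigr => i _; rewrite mulr_sumr.
    by apply: eq_bigr => j _; ring.
  by rewrite !thE /=; lra.
have Kk := gram_psd (gramX k (psd_gram Ksym Kpsd)).
have thE (F : I -> I -> R) : \sum_i \sum_j F i j * (th * S i j) ^+ k =
    th ^+ k * \sum_i \sum_j F i j * S i j ^+ k.
  rewrite mulr_sumr; apply: eq_bigr => i _; rewrite mulr_sumr.
  by apply: eq_bigr => j _; rewrite exprMn; ring.
have Q e : e * e = 1 -> 0 <= th ^+ k * \sum_i \sum_j x i * x j * S i j ^+ k +
    e * \sum_i \sum_j x i * x j * C i j ^+ k.
  move=> ee; have := Kk (fun a => match a with inl i => x i | inr i => e * x i end).
  rewrite sumE/= (swap (fun i => e * x i) x) !thE.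
  have -> : \sum_i \sum_j e * x i * (e * x j) * S i j ^+ k = \sum_i \sum_j x i * x j * S i j ^+ k.
    apply: eq_bigr => i _; apply: eq_bigr => j _.
    by rewrite mulrACA ee mul1r.
  have -> : \sum_i \sum_j x i * (e * x j) * C i j ^+ k = e * \sum_i \sum_j x i * x j * C i j ^+ k.
    rewrite mulr_sumr; apply: eq_bigr => i _; rewrite mulr_sumr.
    by apply: eq_bigr => j _; ring.
  lra.
rewrite ler_norml; apply/andP; split.
  by have := Q 1 (mulr1 1); lra.
have m1 : (-1) * (-1) = 1 :> R by rewrite mulrNN mulr1.
by have := Q _ m1; lra.
Qed.

End GramKernels.

(** * Coercivity of Toeplitz covariance matrices *)

(** A substitute for the least eigenvalue. With y such that S y = x, the form of S is nonnegative at
    x - K^-1 y, its cross term is |x|^2, and its value at y is the form of W at x, at most K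
    |x|^2. *)
Lemma psd_unit_coercive (R : realType) n (S W : 'I_n -> 'I_n -> R) :
  (forall p q, \sum_k W p k * S k q = (p == q)%:R) ->
  (forall p q, S p q = S q p) -> psd S ->
  exists2 lam, 0 < lam & forall x : 'I_n -> R,
    lam * \sum_p x p ^+ 2 <= \sum_p \sum_q x p * x q * S p q.
Proof.
move=> WS Ssym Spsd.
pose K := \sum_p \sum_q `|W p q| + 1.
have K0 : 0 < K by rewrite ltr_wpDl// sumr_ge0// => p _; exact: sumr_ge0.
exists K^-1 => [|x]; first by rewrite invr_gt0.
set N := \sum_p x p ^+ 2.
pose y q := \sum_p x p * W p q.
have yS r : \sum_q y q * S q r = x r.
  transitivity (\sum_p x p * \sum_q W p q * S q r).
    under eq_bigr => q _ do rewrite /y mulr_suml.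
    rewrite exchange_big/=; apply: eq_bigr => p _; rewrite mulr_sumr.
    by apply: eq_bigr => q _; rewrite mulrA.
  rewrite (bigD1 r)//= WS eqxx mulr1 big1 ?addr0// => p pr.
  by rewrite WS (negbTE pr) mulr0.
have yx : \sum_p \sum_q x p * y q * S p q = N.
  apply: eq_bigr => p _; rewrite expr2 -{3}(yS p) mulr_sumr.
  by apply: eq_bigr => q _; rewrite Ssym mulrA.
have yy : \sum_p \sum_q y p * y q * S p q = \sum_p \sum_q x p * x q * W q p.
  apply: eq_bigr => p _; transitivity (y p * x p).
    rewrite -(yS p) mulr_sumr; apply: eq_bigr => q _.
    by rewrite Ssym mulrA.
  by rewrite mulrC /y mulr_sumr; apply: eq_bigr => q _; rewrite mulrA.
clearbody y.
have yyN : \sum_p \sum_q x p * x q * W q p <= K * N.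
  apply: (@le_trans _ _ (\sum_p \sum_q `|W q p| * N)).
    apply: ler_sum => p _; apply: ler_sum => q _.
    rewrite (le_trans (ler_norm _))// normrM mulrC ler_wpM2l//.
    have h a : x a ^+ 2 <= N by rewrite /N (bigD1 a)//= lerDl sumr_ge0// => i _; exact: sqr_ge0.
    rewrite normrM; have := h p; have := h q.
    rewrite -(real_normK (num_real (x p))) -(real_normK (num_real (x q))).
    move: `|x p| `|x q| => a b h1 h2.
    have := sqr_ge0 (a - b); rewrite sqrrB; lra.
  rewrite exchange_big/=; under eq_bigr => p _ do rewrite -mulr_suml.
  rewrite -mulr_suml ler_wpM2r//; last by rewrite lerDl.
  by apply: sumr_ge0 => p _; exact: sqr_ge0.
have := Spsd (fun p => x p - K^-1 * y p).
have -> : \sum_i \sum_j (x i - K^-1 * y i) * (x j - K^-1 * y j) * S i j =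
   \sum_i \sum_j x i * x j * S i j - K^-1 * (\sum_i \sum_j x i * y j * S i j)
   - K^-1 * (\sum_i \sum_j x i * y j * S i j) + K^-1 ^+ 2 * \sum_i \sum_j y i * y j * S i j.
  have E2 : \sum_i \sum_j x i * y j * S i j = \sum_i \sum_j y i * x j * S i j.
    rewrite exchange_big/=; apply: eq_bigr => p _; apply: eq_bigr => q _.
    by rewrite Ssym (mulrC (x q)).
  rewrite {2}E2; move: K^-1 => c.
  rewrite !mulr_sumr -!sumrB -big_split/=; apply: eq_bigr => p _.
  rewrite !mulr_sumr -!sumrB -big_split/=; apply: eq_bigr => q _; ring.
rewrite yx yy; set F := \sum_i \sum_j _ => h.
have : K^-1 ^+ 2 * (\sum_p \sum_q x p * x q * W q p) <= K^-1 ^+ 2 * (K * N).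
  by rewrite ler_wpM2l// sqr_ge0.
have -> : K^-1 ^+ 2 * (K * N) = K^-1 * N by field; rewrite gt_eqF.
by move: h; lra.
Qed.

Section Toeplitz.
Context {R : realType} (r : nat -> R).
Hypothesis r0 : r 0%N = 1.
Hypothesis r_cvg0 : r @ \oo --> 0.
Hypothesis rpsd : forall n (t : 'I_n -> nat), psd (fun i j => r (ndist (t i) (t j))).

Definition toeplitz_mx n : 'M[R]_n := \matrix_(i, j) r (ndist i j).

Let form n (a : 'I_n -> R) := \sum_i \sum_j a i * a j * r (ndist i j).

Let unit_coercive n : toeplitz_mx n \in unitmx ->
  exists2 lam, 0 < lam & forall x : 'I_n -> R, lam * \sum_p x p ^+ 2 <= form x.
Proof.
move=> un; apply: (@psd_unit_coercive _ _ _ (fun p q => invmx (toeplitz_mx n) p q)).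
- move=> p q; have := congr1 (fun A : 'M[R]_n => A p q) (mulVmx un).
  by rewrite !mxE => <-; apply: eq_bigr => k _; rewrite !mxE.
- by move=> p q; rewrite ndistC.
- exact: rpsd.
Qed.

(* A vector of zero energy annihilates a psd kernel, and, by stationarity, so do
   all of its translates. *)
Let kernel_shift n (a : 'I_n -> R) : form a = 0 ->
  forall t m, \sum_i a i * r (ndist (t + i)%N m) = 0.
Proof.
move=> fa t m; set q := \sum_i _.
pose tt (i : 'I_n.+1) := if (i < n)%N then (t + i)%N else m.
(* The translated block has zero energy, so with the extra coefficient - q at time m the whole form
   equals - q^2, which must be nonnegative. *)
pose aa (i : 'I_n.+1) := if unlift ord_max i is Some j then a j else (- q).
have aaw i : aa (widen_ord (leqnSn n) i) = a i.
  rewrite /aa (_ : widen_ord _ _ = lift ord_max i) ?liftK//.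
  by apply/val_inj; rewrite /= /bump leqNgt ltn_ord.
have aam : aa ord_max = - q by rewrite /aa unlift_none.
have ttw i : tt (widen_ord (leqnSn n) i) = (t + i)%N by rewrite /tt/= ltn_ord.
have ttm : tt ord_max = m by rewrite /tt/= ltnn.
have inner (u : nat) : \sum_j aa j * r (ndist u (tt j)) =
    \sum_j a j * r (ndist u (t + j)) - q * r (ndist u m).
  rewrite big_ord_recr/= aam ttm mulNr; congr (_ - _).
  by apply: eq_bigr => j _; rewrite aaw ttw.
have := rpsd tt aa.
have -> : \sum_i \sum_j aa i * aa j * r (ndist (tt i) (tt j)) =
    \sum_i aa i * \sum_j aa j * r (ndist (tt i) (tt j)).
  by apply: eq_bigr => i _; rewrite mulr_sumr; apply: eq_bigr => j _; rewrite mulrA.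
under eq_bigr => i _ do rewrite inner.
rewrite big_ord_recr/= aam ttm ndistxx r0 mulr1.
have -> : \sum_j a j * r (ndist m (t + j)) = q.
  by apply: eq_bigr => j _; rewrite ndistC.
rewrite subrr mulr0 addr0.
under eq_bigr => i _ do rewrite aaw ttw mulrBr mulrCA.
rewrite sumrB -mulr_sumr -/q.
have -> : \sum_(i < n) a i * (\sum_(j < n) a j * r (ndist (t + i) (t + j))) = 0.
  rewrite -[RHS]fa; apply: eq_bigr => i _; rewrite mulr_sumr; apply: eq_bigr => j _.
  by rewrite mulrA /ndist !subnDl.
rewrite sub0r -expr2 oppr_ge0 => q0.
by apply/eqP; rewrite -sqrf_eq0 eq_le q0 sqr_ge0.
Qed.

(* Read r as the covariance of a stationary sequence Y.  A singular matrix of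
   size p + 1 gives a linear recurrence, which expresses every Y_t through
   Y_0, ..., Y_(p-1).  The coefficients stay bounded in t by coercivity in size
   p, so r -> 0 would force the variance 1 of Y_t to tend to 0. *)
Lemma toeplitz_coercive n :
  exists2 lam, 0 < lam & forall x : 'I_n -> R, lam * \sum_p x p ^+ 2 <= form x.
Proof.
elim: n => [|p [lam lam0 IH]].
  by exists 1 => // x; rewrite /form !big_ord0 mulr0.
have [un|] := boolP (toeplitz_mx p.+1 \in unitmx); first exact: unit_coercive.
rewrite unitmxE unitfE negbK => /det0P[v v0 vS]; exfalso.
pose a i := v ord0 i.
have fa : form a = 0.
  rewrite /form exchange_big/= big1// => j _.
  have := congr1 (fun A : 'rV[R]_p.+1 => A ord0 j) vS; rewrite !mxE => h.
  transitivity (a j * \sum_i a i * r (ndist i j)).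
    by rewrite mulr_sumr; apply: eq_bigr => i _; rewrite mulrCA mulrA.
  rewrite [X in _ * X](_ : _ = 0) ?mulr0// -[RHS]h.
  by apply: eq_bigr => i _; rewrite mxE.
have ker := kernel_shift fa.
(* If the last coefficient vanishes there is no recurrence, but then a is a zero-energy vector of
   size p, excluded by the induction hypothesis. *)
have [ap|ap] := eqVneq (a ord_max) 0.
  pose a' (i : 'I_p) := a (widen_ord (leqnSn p) i).
  have fa' : form a' = 0.
    rewrite -fa /form big_ord_recr/= [X in _ = _ + X]big1 ?addr0; last first.
      by move=> j _; rewrite ap !mul0r.
    apply: eq_bigr => i _; rewrite big_ord_recr/= ap mulr0 mul0r addr0.
    by apply: eq_bigr.
  have := IH a'; rewrite fa' pmulr_rle0// => s0.
  have a'0 i : a' i = 0.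
    have : a' i ^+ 2 <= 0.
      by apply: le_trans s0; rewrite (bigD1 i)//= lerDl sumr_ge0// => j _; exact: sqr_ge0.
    by rewrite le_eqVlt ltNge sqr_ge0 orbF sqrf_eq0 => /eqP.
  move/negP: v0; apply; apply/eqP/rowP => i; rewrite mxE.
  have [j ->|->] := unliftP ord_max i; last exact: ap.
  have := a'0 j; rewrite /a' /a; congr (v _ _ = _); apply/val_inj.
  by rewrite /= /bump leqNgt ltn_ord.
(* Here f stands for m |-> Cov(Y_n, Y_m), to be expressed through Y_0, ..., Y_(p-1). *)
pose span (f : nat -> R) := exists b : 'I_p -> R, forall m, f m = \sum_i b i * r (ndist i m).
have span0 : span (fun=> 0).
  by exists (fun=> 0) => m; rewrite big1// => i _; rewrite mul0r.
have spanD f g : span f -> span g -> span (fun m => f m + g m).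
  move=> [b bP] [c cP]; exists (fun i => b i + c i) => m.
  by rewrite bP cP -big_split/=; apply: eq_bigr => i _; rewrite mulrDl.
have spanZ c f : span f -> span (fun m => c * f m).
  move=> [b bP]; exists (fun i => c * b i) => m.
  by rewrite bP mulr_sumr; apply: eq_bigr => i _; rewrite mulrA.
have spanX n : span (fun m => r (ndist n m)).
  have [k] := ubnP n; elim: k n => // k IHk n; rewrite ltnS => nk.
  have [np|pn] := ltnP n p.
    exists (fun i => (i == Ordinal np)%:R) => m.
    rewrite (bigD1 (Ordinal np))//= eqxx mul1r big1 ?addr0// => i /negbTE ->.
    by rewrite mul0r.
  have spanS (s : seq 'I_p) : span (fun m => \sum_(i <- s) - (a (widen_ord (leqnSn p) i) / a ord_max) * r (ndist (n - p + i)%N m)).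
    elim: s => [|i s IHs].
      by rewrite (_ : (fun _ => _) = (fun=> 0))//; apply/funext => m; rewrite big_nil.
    rewrite (_ : (fun _ => _) = (fun m => (- (a (widen_ord (leqnSn p) i) / a ord_max)) * r (ndist (n - p + i)%N m) +
      \sum_(j <- s) - (a (widen_ord (leqnSn p) j) / a ord_max) * r (ndist (n - p + j)%N m))); last first.
      by apply/funext => m; rewrite big_cons.
    apply: spanD => //; apply: spanZ; apply: IHk.
    by apply: leq_trans nk; rewrite -[X in (_ < X)%N](subnK pn) ltn_add2l.
  have := spanS (index_enum _); congr span; apply/funext => m.
  have := ker (n - p)%N m; rewrite big_ord_recr/= subnK// => /eqP.
  rewrite addrC addr_eq0 => /eqP h.
  have -> : r (ndist n m) = (a ord_max * r (ndist n m)) / a ord_max by field.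
  rewrite h mulNr mulr_suml -sumrN; apply: eq_bigr => i _.
  by rewrite mulNr mulrAC.
(* Coercivity and form b = 1 give b_i^2 <= lam^-1, and B^2 exceeds lam^-1 without a square root
   being taken. *)
pose B := 1 + lam^-1.
have B0 : 0 < B by rewrite addr_gt0// invr_gt0.
(* Chosen so that p B e < 1, against the variance 1 of Y_n. *)
pose e := (2 * (p%:R * B + 1))^-1.
have e0 : 0 < e by rewrite invr_gt0 mulr_gt0// ltr_wpDl// mulr_ge0// ltW.
have [N _ NP] : \forall k \near \oo, `|r k| <= e.
  by move/cvgrPdist_le: r_cvg0 => /(_ _ e0); apply: filterS => k; rewrite sub0r normrN.
pose n := (N + p)%N.
have [b bP] := spanX n.
have fb : form b = 1.
  rewrite -r0 -(ndistxx n) bP /form exchange_big/=; apply: eq_bigr => j _.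
  rewrite ndistC bP mulr_sumr; apply: eq_bigr => i _; ring.
have bB i : `|b i| <= B.
  have h : b i ^+ 2 <= lam^-1.
    rewrite -(ler_pM2l lam0) divff ?gt_eqF// -fb; apply: le_trans (IH b).
    rewrite ler_pM2l// (bigD1 i)//= lerDl sumr_ge0// => j _; exact: sqr_ge0.
  have l0 : 0 < lam^-1 by rewrite invr_gt0.
  rewrite -(real_normK (num_real (b i))) in h.
  rewrite leNgt; apply/negP => lt.
  have : B ^+ 2 < `|b i| ^+ 2 by rewrite ltr_pXn2r// nnegrE ltW.
  rewrite /B sqrrD; have := sqr_ge0 lam^-1; lra.
have : r (ndist n n) <= p%:R * (B * e).
  rewrite bP; have -> : p%:R * (B * e) = \sum_(i < p) B * e.
    by rewrite sumr_const card_ord -[RHS]mulr_natl.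
  apply: ler_sum => i _; rewrite (le_trans (ler_norm _))// normrM ler_pM//.
  by apply: NP; rewrite /= /ndist /n; have := ltn_ord i; lia.
rewrite ndistxx r0 mulrA; apply/negP; rewrite -ltNge /e.
rewrite ltr_pdivrMr ?mulr_gt0//; last by rewrite ltr_wpDl// mulr_ge0// ltW.
have : 0 <= p%:R * B by rewrite mulr_ge0// ltW.
by rewrite mul1r; lra.
Qed.

Lemma toeplitz_unit n : toeplitz_mx n \in unitmx.
Proof.
have [lam lam0 co] := toeplitz_coercive n.
rewrite unitmxE unitfE; apply/negP => /det0P[v v0 vS].
have := co (v ord0).
have -> : form (v ord0) = 0.
  rewrite /form exchange_big/= big1// => j _.
  have := congr1 (fun A : 'rV[R]_n => A ord0 j) vS; rewrite !mxE => h.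
  transitivity (v ord0 j * \sum_i v ord0 i * r (ndist i j)).
    by rewrite mulr_sumr; apply: eq_bigr => i _; rewrite mulrCA mulrA.
  rewrite [X in _ * X](_ : _ = 0) ?mulr0// -[RHS]h.
  by apply: eq_bigr => i _; rewrite mxE.
rewrite pmulr_rle0// => s0; move/negP: v0; apply; apply/eqP/rowP => i; rewrite mxE.
have : v ord0 i ^+ 2 <= 0.
  by apply: le_trans s0; rewrite (bigD1 i)//= lerDl sumr_ge0// => j _; exact: sqr_ge0.
by rewrite le_eqVlt ltNge sqr_ge0 orbF sqrf_eq0 => /eqP.
Qed.

End Toeplitz.

(** * Gaussian variables *)

Section Expectation.
Context {R : realType} d (T : measurableType d) (P : probability T R).
Implicit Types f g : T -> R.

Definition intg f : Prop := P.-integrable setT (EFin \o f).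
(** Real-valued so that [ring] and [lra] apply; meaningful under [intg f], which the linearity
    lemmas therefore require. *)
Definition Ex f : R := (\int[P]_x f x)%R.
Definition sq_intg f : Prop := measurable_fun setT f /\ intg (fun w => f w ^+ 2).

Lemma intg_meas f : intg f -> measurable_fun setT f.
Proof. by move=> /integrableP[/measurable_EFinP]. Qed.

Lemma intg_le f g : measurable_fun setT f -> (forall w, `|f w| <= g w) -> intg g -> intg f.
Proof.
move=> mf fg ig; apply: le_integrable ig => //; first exact/measurable_EFinP.
by move=> x _; rewrite /= lee_fin (le_trans (fg x))// ler_norm.
Qed.

Lemma intg_cst (c : R) : intg (fun=> c).
Proof. exact: finite_measure_integrable_cst. Qed.

Lemma intg_bounded f (B : R) : measurable_fun setT f -> (forall w, `|f w| <= B) -> intg f.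
Proof. by move=> mf fB; apply: (intg_le mf fB); exact: intg_cst. Qed.

Lemma intgD f g : intg f -> intg g -> intg (fun w => f w + g w).
Proof. by move=> hf hg; exact: (integrableD measurableT hf hg). Qed.

Lemma intgZ (c : R) f : intg f -> intg (fun w => c * f w).
Proof. by move=> hf; exact: (integrableZl measurableT c hf). Qed.

Lemma intgB f g : intg f -> intg g -> intg (fun w => f w - g w).
Proof. by move=> hf hg; exact: (integrableB measurableT hf hg). Qed.

Lemma intg_sum (I : Type) (s : seq I) (F : I -> T -> R) :
  (forall i, intg (F i)) -> intg (fun w => \sum_(i <- s) F i w).
Proof.
move=> hF; elim: s => [|i s IH].
  by under eq_fun do rewrite big_nil; exact: intg_cst.
by under eq_fun do rewrite big_cons; exact: intgD.
Qed.

Lemma ExD f g : intg f -> intg g -> Ex (fun w => f w + g w) = Ex f + Ex g.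
Proof. by move=> hf hg; exact: RintegralD. Qed.

Lemma ExB f g : intg f -> intg g -> Ex (fun w => f w - g w) = Ex f - Ex g.
Proof. by move=> hf hg; exact: RintegralB. Qed.

Lemma ExZ (c : R) f : intg f -> Ex (fun w => c * f w) = c * Ex f.
Proof. by move=> hf; exact: RintegralZl. Qed.

Lemma Ex_cst (c : R) : Ex (fun=> c) = c.
Proof. rewrite /Ex Rintegral_cst//. have -> : fine (P [set: T]) = 1 by rewrite probability_setT.
by rewrite mulr1. Qed.

Lemma Ex_sum (I : Type) (s : seq I) (F : I -> T -> R) :
  (forall i, intg (F i)) -> Ex (fun w => \sum_(i <- s) F i w) = \sum_(i <- s) Ex (F i).
Proof.
move=> hF; elim: s => [|i s IH].
  by under eq_fun do rewrite big_nil; rewrite Ex_cst big_nil.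
under eq_fun do rewrite big_cons.
by rewrite ExD ?IH ?big_cons//; exact: intg_sum.
Qed.

Lemma Ex_le f g : intg f -> intg g -> (forall w, f w <= g w) -> Ex f <= Ex g.
Proof. by move=> hf hg fg; apply: le_Rintegral. Qed.

Lemma Ex_ge0 f : (forall w, 0 <= f w) -> 0 <= Ex f.
Proof. by move=> hf; apply: Rintegral_ge0. Qed.

Lemma Ex_norm f : intg f -> `|Ex f| <= Ex (fun w => `|f w|).
Proof. by move=> hf; apply: le_normr_Rintegral. Qed.

Lemma Ex_dct (F : nat -> T -> R) f g :
  (forall n, measurable_fun setT (F n)) -> measurable_fun setT f ->
  (forall w, F n w @[n --> \oo] --> f w) ->
  (forall n w, `|F n w| <= g w) -> intg g ->
  Ex (F n) @[n --> \oo] --> Ex f.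
Proof.
move=> mF mf Ff Fg ig.
have [|||||intf _] := @dominated_convergence _ _ _ P setT measurableT
  (fun n w => (F n w)%:E) (EFin \o f) (EFin \o g).
- by move=> n; exact/measurable_EFinP.
- exact/measurable_EFinP.
- by apply: aeW => w _; apply/fine_cvgP; split; [exact: nearW|exact: Ff].
- exact: ig.
- by apply: aeW => w n _; rewrite /= lee_fin.
have fin : (\int[P]_x (f x)%:E)%E \is a fin_num by exact: (integrable_fin_num measurableT intf).
move=> h; apply: fine_cvg; rewrite /Ex /Rintegral fineK//.
Qed.

Lemma sq_intg_meas f : sq_intg f -> measurable_fun setT f.
Proof. by case. Qed.

Lemma sq_intgM f g : sq_intg f -> sq_intg g -> intg (fun w => f w * g w).
Proof.
move=> [mf hf] [mg hg]; apply: intg_le (intgD hf hg); first exact: measurable_funM.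
move=> w; rewrite normrM -(real_normK (num_real (f w))) -(real_normK (num_real (g w))).
move: `|f w| `|g w| (normr_ge0 (f w)) (normr_ge0 (g w)) => a b a0 b0.
have := sqr_ge0 (a - b); rewrite sqrrB; have : 0 <= a * b by rewrite mulr_ge0.
lra.
Qed.

Lemma sq_intg_bounded f (B : R) : measurable_fun setT f -> (forall w, `|f w| <= B) -> sq_intg f.
Proof.
move=> mf fB; split => //; apply: (@intg_bounded _ (B ^+ 2)).
  by apply: measurable_funX.
by move=> w; rewrite normrX lerXn2r// nnegrE (le_trans _ (fB w)).
Qed.

Lemma sq_intg_cst (c : R) : sq_intg (fun=> c).
Proof. by apply: (@sq_intg_bounded _ `|c|). Qed.

Lemma sq_intg_intg f : sq_intg f -> intg f.
Proof.
move=> hf; have := sq_intgM hf (sq_intg_cst 1).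
by under eq_fun do rewrite mulr1.
Qed.

Lemma sq_intgZ (c : R) f : sq_intg f -> sq_intg (fun w => c * f w).
Proof.
move=> [mf hf]; split; first exact: measurable_funM.
by under eq_fun do rewrite exprMn; exact: intgZ.
Qed.

Lemma sq_intgD f g : sq_intg f -> sq_intg g -> sq_intg (fun w => f w + g w).
Proof.
move=> hf hg; have [mf if2] := hf; have [mg ig2] := hg.
split; first exact: measurable_funD.
under eq_fun do rewrite sqrrD.
by apply: intgD => //; apply: intgD => //; under eq_fun do rewrite -mulr_natl; apply: intgZ; exact: sq_intgM.
Qed.

Lemma sq_intgB f g : sq_intg f -> sq_intg g -> sq_intg (fun w => f w - g w).
Proof.
move=> hf hg; have := sq_intgD hf (sq_intgZ (-1) hg).
by under eq_fun do rewrite mulN1r.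
Qed.

Lemma sq_intg_sum (I : Type) (s : seq I) (F : I -> T -> R) :
  (forall i, sq_intg (F i)) -> sq_intg (fun w => \sum_(i <- s) F i w).
Proof.
move=> hF; elim: s => [|i s IH].
  by under eq_fun do rewrite big_nil; exact: sq_intg_cst.
by under eq_fun do rewrite big_cons; exact: sq_intgD.
Qed.

Lemma Ex_sum2 (I J : Type) (s : seq I) (t : seq J) (F : I -> T -> R) (G : J -> T -> R) :
  (forall i, sq_intg (F i)) -> (forall j, sq_intg (G j)) ->
  Ex (fun w => (\sum_(i <- s) F i w) * (\sum_(j <- t) G j w)) =
  \sum_(i <- s) \sum_(j <- t) Ex (fun w => F i w * G j w).
Proof.
move=> hF hG; under eq_fun do rewrite mulr_suml.
rewrite Ex_sum => [|i]; last by apply: sq_intgM => //; exact: sq_intg_sum.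
apply: eq_bigr => i _; under eq_fun do rewrite mulr_sumr.
by rewrite Ex_sum// => j; exact: sq_intgM.
Qed.

Lemma Ex_ae f g : measurable_fun setT f -> measurable_fun setT g ->
  {ae P, forall w, f w = g w} -> Ex f = Ex g.
Proof.
move=> mf mg fg; congr fine; apply: ae_eq_integral => //.
- exact/measurable_EFinP.
- exact/measurable_EFinP.
- by apply: filterS fg => w /= ->.
Qed.

End Expectation.

(** * Normal laws: Stein's identity and characteristic functions *)

Section NormalIntegral.
Context {R : realType}.
Local Notation mu := (@lebesgue_measure R).

Lemma integral_normal_prob (m s : R) f U : measurable U -> measurable_fun U f ->
  (\int[normal_prob m s]_(x in U) `|f x| < +oo)%E ->
  (\int[normal_prob m s]_(x in U) f x = \int[mu]_(x in U) (f x * (normal_pdf m s x)%:E))%E.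
Proof.
move=> mU mf finf.
rewrite -(Radon_Nikodym_change_of_variables (normal_prob_dominates m s))//=; last first.
  by apply/integrableP; split.
apply: ae_eq_integral => //.
- apply: emeasurable_funM => //; apply: (measurable_int mu).
  apply: (integrableS _ _ (@subsetT _ _)) => //=.
  by apply: Radon_Nikodym_integrable; exact: normal_prob_dominates.
- apply: emeasurable_funM => //=; apply/measurableT_comp => //=.
  by apply/measurable_funTS; exact: measurable_normal_pdf.
- apply: ae_eqe_mul2l => /=.
  rewrite Radon_NikodymE//=; first exact: normal_prob_dominates.
  move=> dom; case: cid => /= h [h1 h2 h3].
  apply: integral_ae_eq => //=.
  + exact: integrableS h2.
  + by apply/measurable_funTS/measurableT_comp =>//; exact: measurable_normal_pdf.
  + by move=> E E01 mE; rewrite -h3.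
Qed.

End NormalIntegral.

(** The fundamental theorem of calculus on [- n, n], then dominated convergence. It plays the role
    of integration by parts in Stein's identity. *)
Lemma integral_derivative_eq0 (R : realType) (F f : R -> R) :
  (forall x : R, is_derive x (1 : R) F (f x)) -> continuous f ->
  lebesgue_measure.-integrable setT (EFin \o f) ->
  F n%:R @[n --> \oo] --> 0 -> F (- n%:R) @[n --> \oo] --> 0 ->
  (\int[lebesgue_measure]_x (f x)%:E = 0)%E.
Proof.
move=> dF cf intf F0 FN0.
pose fn (n : nat) x := (f x * \1_(`[- n.+1%:R, n.+1%:R]%classic : set R) x)%:E.
have mf : measurable_fun setT f by exact: continuous_measurable_fun.
have fnE n : (\int[lebesgue_measure]_x fn n x = (F n.+1%:R - F (- n.+1%:R))%:E)%E.
  transitivity (\int[lebesgue_measure]_(x in (`[- n.+1%:R, n.+1%:R]%classic : set R)%R) (f x)%:E)%E.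
    rewrite [RHS]integral_mkcond; apply: eq_integral => x _.
    by rewrite /fn patchE indicE; case: ifPn => _; rewrite ?mulr1 ?mulr0.
  have nn : - n.+1%:R < n.+1%:R :> R by rewrite gtrN// ltr0n.
  have cF x : {for x, continuous F}.
    by apply: differentiable_continuous; apply/derivable1_diffP; have [] := dF x.
  rewrite (@continuous_FTC2 _ f F)// ?EFinB//.
  - by apply: continuous_subspaceT => x; exact: cf.
  - split => [x _||]; first by have [] := dF x.
      by apply: cvg_at_right_filter; exact: cF.
    by apply: cvg_at_left_filter; exact: cF.
  - by move=> x _; rewrite derive1E; have [_ ->] := dF x.
have [|||||_ _] := @dominated_convergence _ _ _ lebesgue_measure setT measurableT
  fn (EFin \o f) (EFin \o (fun x => `|f x|)).
- move=> n; apply/measurable_EFinP; apply: measurable_funM => //.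
- exact/measurable_EFinP.
- apply: aeW => x _; apply: cvg_near_cst; near=> n.
  rewrite /fn /= indicE mem_set ?mulr1//= in_itv/= -ler_norml.
  rewrite (@le_trans _ _ n%:R) ?ler_nat//.
  by near: n; exact: nbhs_infty_ger.
- exact: integrable_norm.
- apply: aeW => x n _; rewrite /fn/= lee_fin normrM ler_piMr//.
  by rewrite indicE; case: (_ \in _); rewrite ?normr1 ?normr0.
under eq_fun do rewrite fnE.
have h : (F n.+1%:R - F (- n.+1%:R))%:E @[n --> \oo] --> (0%:E : \bar R).
  apply: cvg_EFin; first exact: nearW.
  rewrite /comp /= -[0](subrr 0); apply: cvgB.
    by rewrite (cvg_shiftS (fun n => F n%:R)).
  by rewrite (cvg_shiftS (fun n => F (- n%:R))).
by move=> h'; apply: cvg_unique h' h.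
Unshelve. all: by end_near. Qed.

(** The product of phi with the integrating factor exp (v t^2 / 2) has zero derivative. *)
Lemma linear_ode_sol (R : realType) (phi : R -> R) (v : R) :
  (forall t : R, is_derive t (1 : R) phi (- v * t * phi t)) ->
  forall t, phi t = phi 0 * expR (- v * t ^+ 2 / 2).
Proof.
move=> dphi t.
pose h (x : R) := phi x * expR (v * x ^+ 2 / 2).
have dh x : is_derive x (1 : R) h 0.
  have de : is_derive x (1 : R) (fun y : R => expR (v * y ^+ 2 / 2)) (v * x * expR (v * x ^+ 2 / 2)).
    have d1 : is_derive x (1 : R) (fun y : R => v * y ^+ 2 / 2) (v * x).
      have -> : (fun y : R => v * y ^+ 2 / 2) = (v / 2) \*: (fun y : R => y ^+ 2).
        by apply/funext => y /=; rewrite [LHS]mulrAC.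
      have E : (v / 2) * (x * 1 + x * 1) = v * x :> R by field.
      by apply: is_derive_eq; exact: E.
    rewrite mulrC; exact: (@is_derive1_comp _ (@expR R) _ _ _ _ _ d1).
  have := is_deriveM (dphi x) de => /is_derive_eq; apply.
  rewrite !/(_ *: _) /=; ring.
have : h t = h 0 by exact: is_derive_0_is_cst.
rewrite /h expr0n/= mulr0 mul0r expR0 mulr1 => <-.
rewrite -mulrA -expRD (_ : _ + _ = 0) ?expR0 ?mulr1//; by field.
Qed.

Section LawTransfer.
Context {R : realType} d (T : measurableType d) (P : probability T R).
Variables (N : T -> R) (Q : probability (measurableTypeR R) R).
Hypothesis mN : measurable_fun setT N.
Hypothesis law : forall A : set R, measurable A -> P [set w | A (N w)] = Q A.

Lemma law_integral (g : R -> R) : measurable_fun setT g -> intg P (g \o N) ->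
  Q.-integrable setT (EFin \o g) /\ (\int[Q]_x (g x)%:E = \int[P]_w (g (N w))%:E)%E.
Proof.
move=> mg ig.
have mN' : @measurable_fun _ _ T (measurableTypeR R) setT N by exact: mN.
pose N' : {mfun T >-> (measurableTypeR R)} :=
  HB.pack (N : T -> measurableTypeR R) (isMeasurableFun.Build _ _ T (measurableTypeR R) _ mN').
have E (f : R -> \bar R) : (\int[Q]_x f x = \int[pushforward P N']_x f x)%E.
  by apply: eq_measure_integral => A mA _; exact: (esym (law mA)).
have mgE : measurable_fun setT (EFin \o g) by exact/measurable_EFinP.
split.
  apply/integrableP; split; first exact: mgE.
  rewrite E ge0_integral_pushforward//; last exact: measurableT_comp.
  by rewrite preimage_setT; have /integrableP[] := ig.
rewrite E integral_pushforward// preimage_setT//; exact: ig.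
Qed.

End LawTransfer.

Section NormalDensity.
Context {R : realType} (m s : R).
Hypothesis s0 : s != 0.

Let pdfE : normal_pdf m s = fun x => normal_peak s * expR (- (x - m) ^+ 2 / (s ^+ 2 *+ 2)).
Proof. exact: normal_pdfE. Qed.

Lemma is_derive_normal_pdf (x : R) :
  is_derive x (1 : R) (normal_pdf m s) (- ((x - m) / s ^+ 2) * normal_pdf m s x).
Proof.
rewrite pdfE.
have d1 : is_derive x (1 : R) (fun y : R => - (y - m) ^+ 2 / (s ^+ 2 *+ 2)) (- ((x - m) / s ^+ 2)).
  have -> : (fun y : R => - (y - m) ^+ 2 / (s ^+ 2 *+ 2)) =
      (- (s ^+ 2 *+ 2)^-1) \*: (fun y : R => (y - m) ^+ 2).
    by apply/funext => y /=; rewrite [RHS]mulNr mulNr mulrC.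
  have E : - (s ^+ 2 *+ 2)^-1 * ((x - m) * 1 + (x - m) * 1) = - ((x - m) / s ^+ 2).
    by rewrite -mulr_natr; field.
  have d0 : is_derive x (1 : R) (fun y : R => y - m) 1.
    by apply: is_derive_eq; rewrite subr0.
  by apply: is_derive_eq; exact: E.
have d2 := @is_derive1_comp _ (@expR R) _ _ _ _ (is_derive_expR _) d1.
have E (e : R) : normal_peak s * (e * - ((x - m) / s ^+ 2)) =
    - ((x - m) / s ^+ 2) * (normal_peak s * e) by ring.
rewrite -E; exact: (is_deriveZ (normal_peak s) d2).
Qed.

(** From exp (- z) <= 1 / z. Quadratic decay is enough against the linear growth allowed in
    [normal_stein]. *)
Lemma normal_pdf_decay (x : R) : x != m ->
  normal_pdf m s x <= normal_peak s * (2 * s ^+ 2) / (x - m) ^+ 2.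
Proof.
move=> xm; rewrite pdfE -mulrA.
apply: ler_wpM2l; first exact: normal_peak_ge0.
have y0 : 0 < (x - m) ^+ 2 by rewrite exprn_even_gt0//= subr_eq0.
have v0 : 0 < s ^+ 2 by rewrite exprn_even_gt0.
have z0 : 0 < (x - m) ^+ 2 / (s ^+ 2 *+ 2) by rewrite divr_gt0// mulrn_wgt0.
have -> : 2 * s ^+ 2 / (x - m) ^+ 2 = ((x - m) ^+ 2 / (s ^+ 2 *+ 2))^-1.
  by rewrite invf_div mulr_natl.
rewrite mulNr expRN lef_pV2 ?posrE ?expR_gt0//.
by rewrite (le_trans _ (expR_ge1Dx _))// lerDr.
Qed.

Lemma normal_pdf_tail (g : R -> R) (A B : R) (u : nat -> R) :
  (forall x, `|g x| <= A + B * `|x - m|) -> 0 <= A -> 0 <= B ->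
  (fun n => `|u n - m|) @ \oo --> +oo ->
  g (u n) * normal_pdf m s (u n) @[n --> \oo] --> 0.
Proof.
move=> gAB A0 B0 uy; apply/cvgrPdist_le => e e0.
pose K := (A + B) * (normal_peak s * (2 * s ^+ 2)).
have K0 : 0 <= K.
  by rewrite mulr_ge0 ?addr_ge0// mulr_ge0 ?normal_peak_ge0// mulr_ge0// sqr_ge0.
near=> n.
have y1 : 1 <= `|u n - m| by near: n; move/cvgryPge : uy; exact.
have yK : K / e <= `|u n - m| by near: n; move/cvgryPge : uy; exact.
have y0 : 0 < `|u n - m| by rewrite (lt_le_trans ltr01).
have um : u n != m by rewrite -subr_eq0 -normr_gt0.
rewrite sub0r normrN normrM (ger0_norm (normal_pdf_ge0 _ _ _)).
apply: (@le_trans _ _ ((A + B) * `|u n - m| * (normal_peak s * (2 * s ^+ 2) / (u n - m) ^+ 2))).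
  apply: ler_pM => //; [exact: normal_pdf_ge0| |exact: normal_pdf_decay].
  by rewrite (le_trans (gAB _))// mulrDl lerD2r ler_peMr.
rewrite -(real_normK (num_real (u n - m))).
have -> : (A + B) * `|u n - m| * (normal_peak s * (2 * s ^+ 2) / `|u n - m| ^+ 2) = K / `|u n - m|.
  by rewrite /K; field; rewrite gt_eqF.
by rewrite ler_pdivrMr// mulrC -ler_pdivrMr.
Unshelve. all: by end_near. Qed.

End NormalDensity.

Section NormalLaw.
Context {R : realType} d (T : measurableType d) (P : probability T R).
Variables (N : T -> R) (m s : R).
Hypothesis s0 : s != 0.
Hypothesis sN : sq_intg P N.
Hypothesis law : forall A : set R, measurable A -> P [set w | A (N w)] = normal_prob m s A.
Let mN := sq_intg_meas sN.

(** Stein's identity. The derivative of g times the density is g' - s^-2 g (x - m) times the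
    density, and its integral vanishes since g grows at most linearly. *)
Lemma normal_stein (g g' : R -> R) (A B : R) :
  (forall x : R, is_derive x (1 : R) g (g' x)) -> continuous g' ->
  (forall x, `|g x| <= A + B * `|x - m|) -> 0 <= A -> 0 <= B ->
  intg P (g' \o N) -> intg P (fun w => g (N w) * (N w - m)) ->
  Ex P (fun w => g (N w) * (N w - m)) = s ^+ 2 * Ex P (g' \o N).
Proof.
move=> dg cg' gAB A0 B0 ig' igN.
have cg : continuous g.
  by move=> x; apply: differentiable_continuous; apply/derivable1_diffP; have [] := dg x.
have cN : continuous (fun x : R => x - m).
  by move=> x; apply: cvgB; [exact: cvg_id|exact: cvg_cst].
have cp : continuous (normal_pdf m s) by exact: continuous_normal_pdf.
pose f x := g' x - (s ^+ 2)^-1 * (g x * (x - m)).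
have cf : continuous f.
  move=> x; apply: cvgB; first exact: cg'.
  by apply: cvgM; [exact: cvg_cst|apply: cvgM; [exact: cg|exact: cN]].
have mf : measurable_fun setT f by exact: continuous_measurable_fun.
have if_ : intg P (f \o N) by apply: intgB => //; exact: intgZ.
have [iQ EQ] := law_integral mN law mf if_.
have /integrableP[mQ finQ] := iQ.
have h1 := integral_normal_prob measurableT mQ finQ.
have ifp : lebesgue_measure.-integrable setT (EFin \o (fun x => f x * normal_pdf m s x)).
  apply/integrableP; split.
    by apply/measurable_EFinP; apply: measurable_funM => //; exact: measurable_normal_pdf.
  have : (\int[normal_prob m s]_x `|(`|f x|)%:E| < +oo)%E.
    by under eq_integral do rewrite /= normr_id; exact: finQ.
  move=> finQ'; have := finQ; rewrite (integral_normal_prob measurableT _ finQ'); last first.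
    by apply/measurable_EFinP; apply: measurableT_comp.
  apply: le_lt_trans; rewrite le_eqVlt; apply/orP; left; apply/eqP; apply: eq_integral => x _.
  by rewrite /= normrM (ger0_norm (normal_pdf_ge0 _ _ _)).
have F' (x : R) : is_derive x (1 : R) (g * normal_pdf m s) (f x * normal_pdf m s x).
  have := is_deriveM (dg x) (is_derive_normal_pdf m s0 x).
  have E : g x * (- ((x - m) / s ^+ 2) * normal_pdf m s x) + normal_pdf m s x * g' x
     = f x * normal_pdf m s x by rewrite /f; ring.
  by rewrite -E.
have z := integral_derivative_eq0 F' _ ifp.
have := h1; rewrite EQ; under [in X in _ = X]eq_integral do rewrite -EFinM.
rewrite z.
- move=> h2; have : Ex P (f \o N) = 0 by rewrite /Ex /Rintegral h2.
  rewrite /f /comp ExB//; last exact: intgZ.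
  rewrite ExZ// => /eqP; rewrite subr_eq0 => /eqP ->.
  by rewrite mulrA mulfV ?mul1r// expf_neq0.
- by move=> x; apply: cvgM; [exact: cf|exact: cp].
- apply: (normal_pdf_tail s0 gAB A0 B0); apply/cvgryPge => a; near=> n.
  rewrite (le_trans _ (ler_norm _))// lerBrDr; near: n; exact: nbhs_infty_ger.
- apply: (normal_pdf_tail s0 gAB A0 B0); apply/cvgryPge => a; near=> n.
  rewrite distrC (le_trans _ (ler_norm _))// opprK -lerBlDl; near: n; exact: nbhs_infty_ger.
Unshelve. all: by end_near. Qed.

Let intg_bdd (g : R -> R) (B : R) : continuous g -> (forall x, `|g x| <= B) -> intg P (g \o N).
Proof.
move=> cg gB; apply: (@intg_bounded _ _ _ _ _ B) => [|w]; last exact: gB.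
by apply: measurableT_comp => //; exact: continuous_measurable_fun.
Qed.

Let iN : intg P N. Proof. exact: sq_intg_intg. Qed.

Lemma normal_mean : Ex P N = m.
Proof.
have := @normal_stein (fun=> 1) (fun=> 0) 1 0.
rewrite /comp Ex_cst mulr0 => h.
have : Ex P (fun w => 1 * (N w - m)) = 0.
  apply: h => //.
  - by move=> x; exact: cst_continuous.
  - by move=> x; rewrite normr1 mul0r addr0.
  - exact: intg_cst.
  - by apply: intgZ; apply: intgB => //; exact: intg_cst.
under eq_fun do rewrite mul1r.
by rewrite ExB// ?Ex_cst; [move/eqP; rewrite subr_eq0 => /eqP|exact: intg_cst].
Qed.

Lemma normal_variance : Ex P (fun w => (N w - m) ^+ 2) = s ^+ 2.
Proof.
have := @normal_stein (fun x => x - m) (fun=> 1) 0 1.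
rewrite /comp Ex_cst mulr1; apply => //.
- by move=> x; apply: is_derive_eq; rewrite subr0.
- by move=> x; exact: cst_continuous.
- by move=> x; rewrite mul1r add0r.
- exact: intg_cst.
- by apply: sq_intgM; apply: sq_intgB => //; exact: sq_intg_cst.
Qed.

Hypothesis m0 : m = 0.

Let contM (t : R) : continuous (fun x : R => t * x).
Proof. by move=> x; apply: cvgM; [exact: cvg_cst|exact: cvg_id]. Qed.

Let dM (t x : R) : is_derive x (1 : R) (fun x : R => t * x) t.
Proof. by apply: is_derive_eq; rewrite [_ *: _]mulr1. Qed.

Let cont_cos (t : R) : continuous (fun x : R => cos (t * x)).
Proof. by move=> x; apply: continuous_comp; [exact: contM|exact: continuous_cos]. Qed.

Let cont_sin (t : R) : continuous (fun x : R => sin (t * x)).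
Proof. by move=> x; apply: continuous_comp; [exact: contM|exact: continuous_sin]. Qed.

Let norm_cos x : `|cos x| <= 1 :> R.
Proof. by rewrite ler_norml cos_geN1 cos_le1. Qed.

Let norm_sin x : `|sin x| <= 1 :> R.
Proof. by rewrite ler_norml sin_geN1 sin_le1. Qed.

Let i_cos t : intg P (fun w => cos (t * N w)).
Proof. exact: (@intg_bdd (fun x => cos (t * x)) 1 (@cont_cos t)). Qed.

Let i_sin t : intg P (fun w => sin (t * N w)).
Proof. exact: (@intg_bdd (fun x => sin (t * x)) 1 (@cont_sin t)). Qed.

Let stein_sin t : Ex P (fun w => sin (t * N w) * N w) = s ^+ 2 * (t * Ex P (fun w => cos (t * N w))).
Proof.
have ic := i_cos t.
have -> : (fun w => sin (t * N w) * N w) = (fun w => sin (t * N w) * (N w - m)).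
  by apply/funext => w; rewrite m0 subr0.
rewrite -ExZ//; apply: (@normal_stein (fun x => sin (t * x)) (fun x => t * cos (t * x)) 1 0) => //.
- move=> x; have := @is_derive1_comp _ (@sin R) _ _ _ _ (is_derive_sin _) (dM t x).
  by rewrite mulrC.
- by move=> x; apply: cvgM; [exact: cvg_cst|exact: cont_cos].
- by move=> x; rewrite mul0r addr0.
- exact: intgZ.
- rewrite m0; under eq_fun do rewrite subr0; apply: intg_le (integrable_norm iN) => //.
    by apply: measurable_funM => //; exact: intg_meas (i_sin t).
  by move=> w; rewrite normrM ler_piMl.
Qed.

Let stein_cos t : Ex P (fun w => cos (t * N w) * N w) = s ^+ 2 * (- t * Ex P (fun w => sin (t * N w))).
Proof.
have ic := i_sin t.
have -> : (fun w => cos (t * N w) * N w) = (fun w => cos (t * N w) * (N w - m)).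
  by apply/funext => w; rewrite m0 subr0.
rewrite -ExZ//; apply: (@normal_stein (fun x => cos (t * x)) (fun x => - t * sin (t * x)) 1 0) => //.
- move=> x; have E : - sin (t * x) * t = - t * sin (t * x) by ring.
  by rewrite -E; exact: (@is_derive1_comp _ (@cos R) _ _ _ _ (is_derive_cos _) (dM t x)).
- by move=> x; apply: cvgM; [exact: cvg_cst|exact: cont_sin].
- by move=> x; rewrite mul0r addr0.
- exact: intgZ.
- rewrite m0; under eq_fun do rewrite subr0; apply: intg_le (integrable_norm iN) => //.
    by apply: measurable_funM => //; exact: intg_meas (i_cos t).
  by move=> w; rewrite normrM ler_piMl.
Qed.

Let deriv_under (c c' : R -> R) (t : R) :
  (forall x : R, is_derive x (1 : R) c (c' x)) -> continuous c -> (forall x, `|c x| <= 1) ->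
  (forall x, `|c' x| <= 1) ->
  is_derive t (1 : R) (fun t => Ex P (fun w => c (t * N w))) (Ex P (fun w => c' (t * N w) * N w)).
Proof.
move=> dc cc c1 c1'.
have dcN (x : R) w : is_derive x (1 : R) (fun y : R => c (y * N w)) (c' (x * N w) * N w).
  have d1 : is_derive x (1 : R) (fun y : R => y * N w) (N w).
    by under eq_fun do rewrite mulrC; exact: dM.
  exact: (@is_derive1_comp _ c _ _ _ _ (dc _) d1).
have Ia : `]t - 1, t + 1[%classic t by rewrite /= in_itv/= gtrBl ltrDl ltr01.
have h1 (x : R) : `]t - 1, t + 1[%classic x -> P.-integrable setT (EFin \o (fun w => c (x * N w))).
  move=> _; apply: (@intg_bdd (fun y => c (x * y)) 1) => [y|y]; last exact: c1.
  by apply: continuous_comp; [exact: contM|exact: cc].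
have h2 (x : R) w : `]t - 1, t + 1[%classic x -> setT w -> derivable (fun y : R => c (y * N w)) x (1 : R).
  by move=> _ _; have [] := dcN x w.
have h3 w : 0 <= `|N w| by [].
have pE (x : R) w : partial1of2 (fun (y : R) w => c (y * N w)) x w = c' (x * N w) * N w.
  by rewrite partial1of2E; have [_ ->] := dcN x w.
have h4 (x : R) w : `]t - 1, t + 1[%classic x -> setT w -> `|partial1of2 (fun (y : R) w => c (y * N w)) x w| <= `|N w|.
  by move=> _ _; rewrite pE normrM ler_piMl.
have iN' : P.-integrable setT (EFin \o (fun w => `|N w|)) by exact: (integrable_norm iN).
apply: DeriveDef.
  exact: (derivable_under_integral measurableT Ia h1 h2 h3 iN' h4).
rewrite -derive1E.
rewrite (differentiation_under_integral measurableT Ia h1 h2 h3 iN' h4).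
by rewrite /Ex; apply: eq_Rintegral => w _; rewrite pE.
Qed.

(** Differentiation under the integral gives - E (sin (t N) N), and Stein's identity turns it into -
    s^2 t E cos (t N): a linear differential equation in t. *)
Lemma normal_cos : Ex P (fun w => cos (N w)) = expR (- s ^+ 2 / 2).
Proof.
have dphi (t : R) : is_derive t (1 : R) (fun t => Ex P (fun w => cos (t * N w)))
    (- s ^+ 2 * t * Ex P (fun w => cos (t * N w))).
  have h1 x : `|- sin x| <= 1 :> R by rewrite normrN.
  have <- : Ex P (fun w => - sin (t * N w) * N w) = - s ^+ 2 * t * Ex P (fun w => cos (t * N w)).
    rewrite mulNr mulNr -mulrA -stein_sin -mulN1r -ExZ.
      by congr Ex; apply/funext => w; rewrite mulN1r mulNr.
    apply: intg_le (integrable_norm iN) => //.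
      by apply: measurable_funM => //; exact: intg_meas (i_sin t).
    by move=> w; rewrite normrM ler_piMl.
  exact: (@deriv_under (@cos R) (fun x => - sin x) t _ (@continuous_cos R) norm_cos h1).
have H := linear_ode_sol dphi 1; rewrite /= in H.
have -> : (fun w => cos (N w)) = (fun w => cos (1 * N w)).
  by apply/funext => w; rewrite mul1r.
rewrite H expr1n mulr1 (_ : (fun w => cos (0 * N w)) = (fun=> 1)) ?Ex_cst ?mul1r//.
by apply/funext => w; rewrite mul0r cos0.
Qed.

Lemma normal_sin : Ex P (fun w => sin (N w)) = 0.
Proof.
have dphi (t : R) : is_derive t (1 : R) (fun t => Ex P (fun w => sin (t * N w)))
    (- s ^+ 2 * t * Ex P (fun w => sin (t * N w))).
  have <- : Ex P (fun w => cos (t * N w) * N w) = - s ^+ 2 * t * Ex P (fun w => sin (t * N w)).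
    by rewrite stein_cos; ring.
  exact: (@deriv_under (@sin R) (@cos R) t _ (@continuous_sin R) norm_sin norm_cos).
have H := linear_ode_sol dphi 1; rewrite /= in H.
have -> : (fun w => sin (N w)) = (fun w => sin (1 * N w)).
  by apply/funext => w; rewrite mul1r.
rewrite H (_ : (fun w => sin (0 * N w)) = (fun=> 0)) ?Ex_cst ?mul0r//.
by apply/funext => w; rewrite mul0r sin0.
Qed.

End NormalLaw.

Section GaussianLaw.
Context {R : realType} d (T : measurableType d) (P : probability T R).
Variables (N : T -> R) (m v : R).
Hypothesis v0 : 0 <= v.
Hypothesis sN : sq_intg P N.
Hypothesis law : forall A : set R, measurable A -> P [set w | A (N w)] = gaussian_law m v A.
Let mN := sq_intg_meas sN.

Let dirac_case (g : R -> R) : v = 0 -> measurable_fun setT g -> Ex P (g \o N) = g m.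
Proof.
move=> v00 mg.
have ae : {ae P, forall w, (g \o N) w = g m}.
  exists [set w | N w != m]; split.
  - rewrite (_ : [set _ | _] = N @^-1` (~` [set m])); last first.
      by apply/seteqP; split => w /=; [move/eqP|move=> h; apply/eqP].
    by rewrite -[X in measurable X]setTI; apply: mN => //; exact: measurableC.
  - have -> : [set w | N w != m] = [set w | (~` [set m]) (N w)].
      by apply/seteqP; split => w /=; [move/eqP|move=> h; apply/eqP].
    rewrite law; last exact: measurableC.
    by rewrite /gaussian_law v00 eqxx /= diracE memNset//= => h; exact: h.
  - move=> w /= h; apply/negP => /eqP Nm; apply: h; by rewrite Nm.
rewrite -(Ex_cst P (g m)); apply: Ex_ae => //.
exact: measurableT_comp.
Qed.

Lemma gaussian_moments : Ex P N = m /\ Ex P (fun w => N w ^+ 2) = m ^+ 2 + v.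
Proof.
have [v00|vn0] := eqVneq v 0.
  split; first by have := @dirac_case id v00 (@measurable_id _ _ _).
  have mg2 : measurable_fun setT (fun x : R => x ^+ 2).
    by apply: continuous_measurable_fun; exact: exprn_continuous.
  by rewrite v00 addr0; exact: (dirac_case v00 mg2).
have s0 : Num.sqrt v != 0 by rewrite gt_eqF// sqrtr_gt0 lt_neqAle eq_sym vn0.
have lawN : forall A : set R, measurable A -> P [set w | A (N w)] = normal_prob m (Num.sqrt v) A.
  by move=> A mA; rewrite law// /gaussian_law (negbTE vn0).
have EN := normal_mean s0 sN lawN.
split; first by [].
have := normal_variance s0 sN lawN; rewrite sqr_sqrtr// => <-.
have iN := sq_intg_intg sN; have [_ iN2] := sN.
have -> : (fun w => (N w - m) ^+ 2) = (fun w => N w ^+ 2 - 2 * m * N w + m ^+ 2).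
  by apply/funext => w; ring.
rewrite ExD; [|by apply: intgB => //; exact: intgZ|exact: intg_cst].
by rewrite ExB//; [rewrite ExZ// EN Ex_cst; ring|exact: intgZ].
Qed.

Lemma gaussian_trig : m = 0 ->
  Ex P (fun w => cos (N w)) = expR (- v / 2) /\ Ex P (fun w => sin (N w)) = 0.
Proof.
move=> m0; have [v00|vn0] := eqVneq v 0.
  split.
    have := @dirac_case (@cos R) v00; rewrite m0 cos0 v00 oppr0 mul0r expR0; apply.
    by apply: continuous_measurable_fun; exact: continuous_cos.
  have := @dirac_case (@sin R) v00; rewrite m0 sin0; apply.
  by apply: continuous_measurable_fun; exact: continuous_sin.
have s0 : Num.sqrt v != 0 by rewrite gt_eqF// sqrtr_gt0 lt_neqAle eq_sym vn0.
have lawN : forall A : set R, measurable A -> P [set w | A (N w)] = normal_prob m (Num.sqrt v) A.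
  by move=> A mA; rewrite law// /gaussian_law (negbTE vn0).
split; last exact: (normal_sin s0 sN lawN m0).
by have := normal_cos s0 sN lawN m0; rewrite sqr_sqrtr.
Qed.

End GaussianLaw.

Lemma cvg_seq_sum (R : realType) (I : Type) (s : seq I) (f : I -> nat -> R) (l : I -> R) :
  (forall i, f i n @[n --> \oo] --> l i) ->
  \sum_(i <- s) f i n @[n --> \oo] --> \sum_(i <- s) l i.
Proof.
move=> fl; elim: s => [|i s IH].
  by under eq_fun do rewrite big_nil; rewrite big_nil; exact: cvg_cst.
by under eq_fun do rewrite big_cons; rewrite big_cons; exact: cvgD.
Qed.

(** * Power series bounds for the residual kernels *)

Section HyperbolicTails.
Context {R : realType}.

(** The kernels cosh z - 1 and sinh z - z are the even and odd parts of the exponential series from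
    degree 2 on. They arise as covariances of cosines without their means and of sines without their
    linear parts. *)
Definition cosh_tail (z : R) : R := (expR z + expR (- z)) / 2 - 1.
Definition sinh_tail (z : R) : R := (expR z - expR (- z)) / 2 - z.

(** A single series carries both kernels, parity selecting the coefficient, so that each power of
    the covariance can be bounded separately. *)
Lemma hyperbolic_tail_cvg (x y z : R) :
  \sum_(2 <= k < n) (if odd k then y else x) * z ^+ k / k`!%:R @[n --> \oo] -->
  x * cosh_tail z + y * sinh_tail z.
Proof.
pose h1 : series (exp_coeff z) @ \oo --> expR z := is_cvg_series_exp_coeff z.
pose h2 : series (exp_coeff (- z)) @ \oo --> expR (- z) := is_cvg_series_exp_coeff (- z).
have : x * ((series (exp_coeff z) n + series (exp_coeff (- z)) n) / 2 - 1) +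
  y * ((series (exp_coeff z) n - series (exp_coeff (- z)) n) / 2 - z) @[n --> \oo] -->
  x * cosh_tail z + y * sinh_tail z.
  apply: cvgD; apply: cvgMr; (apply: cvgB; last exact: cvg_cst); apply: cvgMl.
    exact: cvgD.
  exact: cvgB.
apply: cvg_trans; apply: near_eq_cvg; near=> n.
have n2 : (2 <= n)%N by near: n; exists 2.
have -> : \sum_(2 <= k < n) (if odd k then y else x) * z ^+ k / k`!%:R =
  \sum_(0 <= k < n) (if odd k then y else x) * z ^+ k / k`!%:R - x - y * z.
  rewrite [in RHS]big_ltn ?(leq_trans _ n2)// [in RHS]big_ltn//=.
  by rewrite expr0 expr1 !fact0 ?factS !divr1 mulr1; ring.
have -> : \sum_(0 <= k < n) (if odd k then y else x) * z ^+ k / k`!%:R =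
    (x + y) / 2 * series (exp_coeff z) n + (x - y) / 2 * series (exp_coeff (- z)) n.
  rewrite /series/= !mulr_sumr -big_split/=; apply: eq_bigr => k _.
  rewrite /exp_coeff/= exprNn -signr_odd; move: (z ^+ k) (k`!%:R^-1) => a b.
  by case: (odd k); rewrite ?expr1 ?expr0; field.
by field.
Unshelve. all: by end_near. Qed.

(** The term of degree k gains th^k by [gram_cross_power]; as the series start at degree 2 and th <=
    1, each gains at least th^2. The terms in S are nonnegative, so they can be summed. *)
Lemma hyperbolic_tail_bound (I : finType) (S C : I -> I -> R) (th : R) (x y : I -> R) :
  0 <= th <= 1 ->
  (forall i j, S i j = S j i) ->
  psd S ->
  (forall x y : I -> R, 0 <= th * \sum_i \sum_j x i * x j * S i j
      + 2 * \sum_i \sum_j x i * y j * C i j + th * \sum_i \sum_j y i * y j * S i j) ->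
  `|\sum_i \sum_j (x i * x j * cosh_tail (C i j) + y i * y j * sinh_tail (C i j))| <=
  th ^+ 2 * \sum_i \sum_j (x i * x j * cosh_tail (S i j) + y i * y j * sinh_tail (S i j)).
Proof.
move=> /andP[th0 th1] Ssym Spsd Cpos.
pose t k i := if odd k then y i else x i.
pose F (M : I -> I -> R) n := \sum_(2 <= k < n) (\sum_i \sum_j t k i * t k j * M i j ^+ k) / k`!%:R.
have FE M : F M @ \oo --> \sum_i \sum_j (x i * x j * cosh_tail (M i j) + y i * y j * sinh_tail (M i j)).
  have : (fun n => \sum_i \sum_j \sum_(2 <= k < n) (if odd k then y i * y j else x i * x j) * M i j ^+ k / k`!%:R) @ \oo
     --> \sum_i \sum_j (x i * x j * cosh_tail (M i j) + y i * y j * sinh_tail (M i j)).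
    apply: cvg_seq_sum => i; apply: cvg_seq_sum => j; exact: hyperbolic_tail_cvg.
  apply: cvg_trans; apply: near_eq_cvg; near=> n.
  have -> : F M n = \sum_(2 <= k < n) \sum_i \sum_j (if odd k then y i * y j else x i * x j) * M i j ^+ k / k`!%:R.
    apply: eq_bigr => k _; rewrite mulr_suml; apply: eq_bigr => i _; rewrite mulr_suml.
    by apply: eq_bigr => j _; rewrite /t; case: odd.
  rewrite [RHS]exchange_big/=; apply: eq_bigr => i _; rewrite [RHS]exchange_big/=.
  by apply: eq_bigr.
have FS := FE S; have FC := FE C.
have h n : `|F C n| <= th ^+ 2 * F S n.
  rewrite /F mulr_sumr (le_trans (ler_norm_sum _ _ _))//; apply: ler_sum_nat => k /andP[k2 _].
  rewrite normrM [X in _ * X]ger0_norm ?invr_ge0// mulrA ler_wpM2r ?invr_ge0//.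
  apply: (le_trans (gram_cross_power Ssym Cpos k (t k))).
  apply: ler_wpM2r; first exact: (gram_psd (gramX k (psd_gram Ssym Spsd))).
  by apply: ler_wiXn2l.
have hC : `|F C n| @[n --> \oo] --> `|\sum_i \sum_j (x i * x j * cosh_tail (C i j) + y i * y j * sinh_tail (C i j))|.
  exact: cvg_norm.
have hS : th ^+ 2 * F S n @[n --> \oo] --> th ^+ 2 * \sum_i \sum_j (x i * x j * cosh_tail (S i j) + y i * y j * sinh_tail (S i j)).
  exact: cvgMr.
by apply: (ler_cvg_to hC hS); exact: nearW.
Unshelve. all: by end_near. Qed.

End HyperbolicTails.

(** * Trigonometric moments of jointly Gaussian variables *)

Section GaussianSpace.
Context {R : realType} d (T : measurableType d) (P : probability T R).

(* The characteristic functions of all linear combinations make finite families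
   in H jointly Gaussian; nothing else about the laws is needed. *)
Definition gaussian_space (H : (T -> R) -> Prop) : Prop :=
  [/\ forall N N', H N -> H N' -> H (fun w => N w + N' w),
      forall c N, H N -> H (fun w => c * N w),
      forall N, H N -> sq_intg P N /\ Ex P N = 0 &
      forall N, H N -> Ex P (fun w => cos (N w)) = expR (- Ex P (fun w => N w ^+ 2) / 2)
                   /\ Ex P (fun w => sin (N w)) = 0].

Variable H : (T -> R) -> Prop.
Hypothesis gH : gaussian_space H.
Local Notation cov A B := (Ex P (fun w => A w * B w)).
Local Notation wt A := (expR (- cov A A / 2)).

Let HD N N' : H N -> H N' -> H (fun w => N w + N' w). Proof. by case: gH => h _ _ _; exact: h. Qed.
Let HZ c N : H N -> H (fun w => c * N w). Proof. by case: gH => _ h _ _; exact: h. Qed.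
Let Hsq N : H N -> sq_intg P N. Proof. by case: gH => _ _ h _ /h[]. Qed.
Let HE N : H N -> Ex P N = 0. Proof. by case: gH => _ _ h _ /h[]. Qed.
Let Hcos N : H N -> Ex P (fun w => cos (N w)) = wt N.
Proof.
by case: gH => _ _ _ h /h[-> _]; congr (expR (- Ex P _ / 2)); apply/funext => w; rewrite expr2.
Qed.
Let Hsin N : H N -> Ex P (fun w => sin (N w)) = 0. Proof. by case: gH => _ _ _ h /h[]. Qed.

Let norm_cos x : `|cos x| <= 1 :> R.
Proof. by rewrite ler_norml cos_geN1 cos_le1. Qed.

Let norm_sin x : `|sin x| <= 1 :> R.
Proof. by rewrite ler_norml sin_geN1 sin_le1. Qed.

Let mcos N : H N -> measurable_fun setT (fun w => cos (N w)).
Proof.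
move=> hN; apply: measurableT_comp; last exact: sq_intg_meas (Hsq hN).
by apply: continuous_measurable_fun; exact: continuous_cos.
Qed.

Let msin N : H N -> measurable_fun setT (fun w => sin (N w)).
Proof.
move=> hN; apply: measurableT_comp; last exact: sq_intg_meas (Hsq hN).
by apply: continuous_measurable_fun; exact: continuous_sin.
Qed.

Let sqcos N : H N -> sq_intg P (fun w => cos (N w)).
Proof. by move=> hN; apply: (@sq_intg_bounded _ _ _ _ _ 1) => //; exact: mcos. Qed.

Let sqsin N : H N -> sq_intg P (fun w => sin (N w)).
Proof. by move=> hN; apply: (@sq_intg_bounded _ _ _ _ _ 1) => //; exact: msin. Qed.

Let covD A B : H A -> H B ->
  cov (fun w => A w + B w) (fun w => A w + B w) = cov A A + 2 * cov A B + cov B B.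
Proof.
move=> hA hB.
have iAA := sq_intgM (Hsq hA) (Hsq hA); have iAB := sq_intgM (Hsq hA) (Hsq hB).
have iBB := sq_intgM (Hsq hB) (Hsq hB).
have -> : (fun w => (A w + B w) * (A w + B w)) = (fun w => A w * A w + 2 * (A w * B w) + B w * B w).
  by apply/funext => w; ring.
by rewrite ExD//; [rewrite ExD ?ExZ//; exact: intgZ|apply: intgD => //; exact: intgZ].
Qed.

Let covN A B : H A -> H B -> cov A (fun w => - 1 * B w) = - cov A B.
Proof.
move=> hA hB; rewrite -[RHS]mulN1r -ExZ; last exact: sq_intgM (Hsq hA) (Hsq hB).
by congr Ex; apply/funext => w; ring.
Qed.

Let covNN B : cov (fun w => - 1 * B w) (fun w => - 1 * B w) = cov B B.
Proof. by congr Ex; apply/funext => w; ring. Qed.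

Let ExcosD A B : H A -> H B ->
  Ex P (fun w => cos (A w + B w)) = wt A * wt B * expR (- cov A B).
Proof.
move=> hA hB; by rewrite (Hcos (HD hA hB)) (covD hA hB) -!expRD; congr expR; field.
Qed.

Let ExcosB A B : H A -> H B ->
  Ex P (fun w => cos (A w - B w)) = wt A * wt B * expR (cov A B).
Proof.
move=> hA hB; have := ExcosD hA (HZ (-1) hB).
rewrite (covN hA hB) covNN opprK => <-; congr Ex; apply/funext => w.
by rewrite mulN1r.
Qed.

Lemma gaussian_cos_cos A B : H A -> H B ->
  cov (fun w => cos (A w)) (fun w => cos (B w)) =
  wt A * wt B * ((expR (cov A B) + expR (- cov A B)) / 2).
Proof.
move=> hA hB.
have i1 : intg P (fun w => cos (A w - B w)).
  apply: (@intg_bounded _ _ _ _ _ 1) => //; have := mcos (HD hA (HZ (-1) hB)).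
  by under eq_fun do rewrite mulN1r.
have i2 : intg P (fun w => cos (A w + B w)).
  by apply: (@intg_bounded _ _ _ _ _ 1) => //; exact: (mcos (HD hA hB)).
have -> : (fun w => cos (A w) * cos (B w)) = (fun w => 2^-1 * (cos (A w - B w) + cos (A w + B w))).
  by apply/funext => w; rewrite cosB cosD; field.
rewrite ExZ ?ExD//; last exact: intgD.
by rewrite (ExcosB hA hB) (ExcosD hA hB); field.
Qed.

Lemma gaussian_sin_sin A B : H A -> H B ->
  cov (fun w => sin (A w)) (fun w => sin (B w)) =
  wt A * wt B * ((expR (cov A B) - expR (- cov A B)) / 2).
Proof.
move=> hA hB.
have i1 : intg P (fun w => cos (A w - B w)).
  apply: (@intg_bounded _ _ _ _ _ 1) => //; have := mcos (HD hA (HZ (-1) hB)).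
  by under eq_fun do rewrite mulN1r.
have i2 : intg P (fun w => cos (A w + B w)).
  by apply: (@intg_bounded _ _ _ _ _ 1) => //; exact: (mcos (HD hA hB)).
have -> : (fun w => sin (A w) * sin (B w)) = (fun w => 2^-1 * (cos (A w - B w) - cos (A w + B w))).
  by apply/funext => w; rewrite cosB cosD; field.
rewrite ExZ ?ExB//; last exact: intgB.
by rewrite (ExcosB hA hB) (ExcosD hA hB); field.
Qed.

Lemma gaussian_cos_sin A B : H A -> H B ->
  cov (fun w => cos (A w)) (fun w => sin (B w)) = 0.
Proof.
move=> hA hB.
have h1 := HD hB hA; have h2 := HD hB (HZ (-1) hA).
have i1 : intg P (fun w => sin (B w + A w)) by apply: (@intg_bounded _ _ _ _ _ 1) => //; exact: msin h1.
have i2 : intg P (fun w => sin (B w + -1 * A w)) by apply: (@intg_bounded _ _ _ _ _ 1) => //; exact: msin h2.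
have -> : (fun w => cos (A w) * sin (B w)) = (fun w => 2^-1 * (sin (B w + A w) + sin (B w + -1 * A w))).
  by apply/funext => w; rewrite mulN1r sinB sinD; field.
by rewrite ExZ ?ExD//; [rewrite (Hsin h1) (Hsin h2) addr0 mulr0|exact: intgD].
Qed.

Let quot_cvg (f : R -> R) (x l : R) : f 0 = 0 -> is_derive (0 : R) (1 : R) f l ->
  n.+1%:R * f (n.+1%:R^-1 * x) @[n --> \oo] --> l * x.
Proof.
move=> f0 df; have [->|x0] := eqVneq x 0.
  by under eq_fun do rewrite mulr0 f0 mulr0; rewrite mulr0; exact: cvg_cst.
have [/cvg_ex[l' lP]] := df; rewrite /derive (cvg_lim _ lP)// => ls.
move: lP; rewrite ls => /cvgr_dnbhsP lP.
have := lP (fun n => n.+1%:R^-1 * x).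
have u0 n : n.+1%:R^-1 * x != 0 by rewrite mulf_neq0// invr_eq0 pnatr_eq0.
have uc : n.+1%:R^-1 * x @[n --> \oo] --> 0.
  by rewrite -[0](mul0r x); apply: cvgMl; exact: cvg_harmonic.
move=> /(_ (conj u0 uc)) h.
have {}h : (n.+1%:R^-1 * x)^-1 * f (n.+1%:R^-1 * x) @[n --> \oo] --> l.
  move: h; apply: cvg_trans; apply: near_eq_cvg; near=> n.
  by rewrite /= f0 subr0 addr0 [_ *: 1]mulr1.
have : (n.+1%:R^-1 * x)^-1 * f (n.+1%:R^-1 * x) * x @[n --> \oo] --> l * x by exact: cvgMl.
apply: cvg_trans; apply: near_eq_cvg; near=> n.
move: (f _) => y; rewrite invfM invrK; field.
by rewrite ?x0 ?natr1 ?pnatr_eq0.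
Unshelve. all: by end_near. Qed.

Let sin_quot_cvg (x : R) : n.+1%:R * sin (n.+1%:R^-1 * x) @[n --> \oo] --> x.
Proof.
have := @quot_cvg (@sin R) x 1 (sin0 R); rewrite mul1r; apply.
by have := is_derive_sin (0 : R); rewrite cos0.
Qed.

Let sinh_quot_cvg (x : R) : n.+1%:R * ((expR (n.+1%:R^-1 * x) - expR (- (n.+1%:R^-1 * x))) / 2) @[n --> \oo] --> x.
Proof.
have := @quot_cvg (fun y => (expR y - expR (- y)) / 2) x 1.
rewrite mul1r oppr0 subrr mul0r; apply => //.
have d1 : is_derive (0 : R) (1 : R) (fun y : R => expR (- y)) (- 1).
  have := @is_derive1_comp _ (@expR R) -%R (0 : R) _ _ (is_derive_expR _) (is_deriveNid (0 : R) (1 : R)).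
  by rewrite oppr0 expR0 mul1r.
have d2 := is_deriveB (is_derive_expR (0 : R)) d1.
have E : 2^-1 * (expR 0 - (-1)) = 1 :> R by rewrite expR0; field.
have -> : (fun y : R => (expR y - expR (- y)) / 2) = 2^-1 \*: (fun y : R => expR y - expR (- y)).
  by apply/funext => y; rewrite /= mulrC.
by apply: is_derive_eq; exact: E.
Qed.

Let sin_quot_le (x : R) n : `|n.+1%:R * sin (n.+1%:R^-1 * x)| <= `|x|.
Proof.
have sin_le (y : R) : `|sin y| <= `|y|.
  have h z : 0 <= z -> sin z <= z :> R.
    move=> z0; have [c _] := @MVT_segment R (@sin R) (@cos R) 0 z z0 (fun x _ => is_derive_sin x) (continuous_subspaceT (@continuous_sin R)).
    by rewrite sin0 !subr0 => ->; rewrite ler_piMl// cos_le1.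
  have h' z : 0 <= z -> - z <= sin z :> R.
    move=> z0; have [c _] := @MVT_segment R (@sin R) (@cos R) 0 z z0 (fun x _ => is_derive_sin x) (continuous_subspaceT (@continuous_sin R)).
    by rewrite sin0 !subr0 => ->; rewrite -mulN1r ler_wpM2r// cos_geN1.
  have [y0|y0] := leP 0 y; first by rewrite (ger0_norm y0) ler_norml h'// h.
  have y0' : 0 <= - y by rewrite oppr_ge0 ltW.
  by rewrite (ltr0_norm y0) -normrN -sinN ler_norml h'// h.
rewrite normrM ger0_norm//; apply: (@le_trans _ _ (n.+1%:R * `|n.+1%:R^-1 * x|)).
  by rewrite ler_wpM2l.
by rewrite normrM ger0_norm ?invr_ge0// mulrA divff ?mul1r.
Qed.

(** A linear factor B is the limit of (n + 1) sin (B / (n + 1)), dominated by |B|. Mixed moments of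
    a trigonometric and a linear factor thus follow from purely trigonometric ones. *)
Let quot_limit (f : R -> R) A B : (forall x, `|f x| <= 1) -> continuous f -> H A -> H B ->
  Ex P (fun w => n.+1%:R * (f (A w) * sin (n.+1%:R^-1 * B w))) @[n --> \oo] --> Ex P (fun w => f (A w) * B w).
Proof.
move=> f1 cf hA hB.
have mf : measurable_fun setT (fun w => f (A w)).
  by apply: measurableT_comp (sq_intg_meas (Hsq hA)); exact: continuous_measurable_fun.
apply: (@Ex_dct _ _ _ _ _ _ (fun w => `|B w|)).
- move=> n; apply: measurable_funM => //; apply: measurable_funM => //.
  exact: (msin (HZ n.+1%:R^-1 hB)).
- by apply: measurable_funM => //; exact: sq_intg_meas (Hsq hB).
- move=> w; under eq_fun do rewrite mulrCA; apply: cvgMr; exact: sin_quot_cvg.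
- by move=> n w; rewrite mulrCA normrM -[leRHS]mul1r ler_pM// sin_quot_le.
- exact: integrable_norm (sq_intg_intg (Hsq hB)).
Qed.

Lemma gaussian_sin_lin A B : H A -> H B ->
  cov (fun w => sin (A w)) B = wt A * cov A B.
Proof.
move=> hA hB; have := quot_limit norm_sin (@continuous_sin R) hA hB.
have iAB := sq_intgM (Hsq hA) (Hsq hB). have iBB := sq_intgM (Hsq hB) (Hsq hB).
have E n : Ex P (fun w => n.+1%:R * (sin (A w) * sin (n.+1%:R^-1 * B w))) =
    wt A * expR (- (n.+1%:R^-1 * n.+1%:R^-1 * cov B B) / 2) *
    (n.+1%:R * ((expR (n.+1%:R^-1 * cov A B) - expR (- (n.+1%:R^-1 * cov A B))) / 2)).
  rewrite ExZ; last exact: sq_intgM (sqsin hA) (sqsin (HZ _ hB)).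
  rewrite (gaussian_sin_sin hA (HZ _ hB)).
  have -> : cov (fun w => n.+1%:R^-1 * B w) (fun w => n.+1%:R^-1 * B w) = n.+1%:R^-1 * n.+1%:R^-1 * cov B B.
    by rewrite -ExZ//; congr Ex; apply/funext => w; ring.
  have -> : cov A (fun w => n.+1%:R^-1 * B w) = n.+1%:R^-1 * cov A B.
    by rewrite -ExZ//; congr Ex; apply/funext => w; ring.
  ring.
under eq_fun do rewrite E.
move=> h; apply: (cvg_unique _ h) => //.
apply: cvgM; last exact: sinh_quot_cvg.
have c0 : - (n.+1%:R^-1 * n.+1%:R^-1 * cov B B) / 2 @[n --> \oo] --> (0 : R).
  have : - (n.+1%:R^-1 * n.+1%:R^-1 * cov B B) / 2 @[n --> \oo] --> (- (0 * 0 * cov B B) / 2 : R).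
    by apply: cvgMl; apply: cvgN; apply: cvgMl; apply: cvgM; exact: cvg_harmonic.
  by rewrite mulr0 mul0r oppr0 mul0r.
have c1 := cvg_comp _ _ c0 (@continuous_expR R 0); rewrite expR0 in c1.
by rewrite -[X in _ --> X]mulr1; apply: cvgMr; exact: c1.
Qed.

Lemma gaussian_cos_lin A B : H A -> H B ->
  cov (fun w => cos (A w)) B = 0.
Proof.
move=> hA hB; have := quot_limit norm_cos (@continuous_cos R) hA hB.
under eq_fun => n.
  rewrite ExZ; last exact: sq_intgM (sqcos hA) (sqsin (HZ _ hB)).
  rewrite (gaussian_cos_sin hA (HZ _ hB)) mulr0; over.
by move=> h; apply: cvg_unique h (cvg_cst _).
Qed.

End GaussianSpace.

(** * Reduction to the linear regression *)

Section TrigReduction.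
Context {R : realType} d (T : measurableType d) (P : probability T R).
Variable H : (T -> R) -> Prop.
Hypothesis gH : gaussian_space P H.
Local Notation cov A B := (Ex P (fun w => A w * B w)).
Local Notation wt A := (expR (- cov A A / 2)).

Let Hsq N : H N -> sq_intg P N. Proof. by case: gH => _ _ h _ /h[]. Qed.
Let HE N : H N -> Ex P N = 0. Proof. by case: gH => _ _ h _ /h[]. Qed.

Lemma gaussian_sq_cos N : H N -> sq_intg P (fun w => cos (N w)).
Proof.
move=> hN; apply: (@sq_intg_bounded _ _ _ _ _ 1) => [|w]; last by rewrite ler_norml cos_geN1 cos_le1.
apply: measurableT_comp; last exact: sq_intg_meas (Hsq hN).
by apply: continuous_measurable_fun; exact: continuous_cos.
Qed.

Lemma gaussian_sq_sin N : H N -> sq_intg P (fun w => sin (N w)).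
Proof.
move=> hN; apply: (@sq_intg_bounded _ _ _ _ _ 1) => [|w]; last by rewrite ler_norml sin_geN1 sin_le1.
apply: measurableT_comp; last exact: sq_intg_meas (Hsq hN).
by apply: continuous_measurable_fun; exact: continuous_sin.
Qed.

(* cos A and sin A with their projections on the constants and on H removed *)
Let k A w := cos (A w) - wt A.
Let s A w := sin (A w) - wt A * A w.

Let Ecos N : H N -> Ex P (fun w => cos (N w)) = wt N.
Proof.
by case: gH => _ _ _ h /h[-> _].
Qed.
Let Esin N : H N -> Ex P (fun w => sin (N w)) = 0. Proof. by case: gH => _ _ _ h /h[]. Qed.

Let sqk A : H A -> sq_intg P (k A).
Proof. by move=> hA; apply: sq_intgB (gaussian_sq_cos hA) (sq_intg_cst _ _). Qed.

Let sqs A : H A -> sq_intg P (s A).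
Proof. by move=> hA; apply: sq_intgB (gaussian_sq_sin hA) (sq_intgZ _ (Hsq hA)). Qed.

Let icos A : H A -> intg P (fun w => cos (A w)).
Proof. by move=> hA; exact: sq_intg_intg (gaussian_sq_cos hA). Qed.

Let isin A : H A -> intg P (fun w => sin (A w)).
Proof. by move=> hA; exact: sq_intg_intg (gaussian_sq_sin hA). Qed.

Let Ek A : H A -> Ex P (k A) = 0.
Proof.
move=> hA; have i1 := icos hA; have i2 := intg_cst P (wt A).
by rewrite ExB// Ex_cst Ecos// subrr.
Qed.

Let Es A : H A -> Ex P (s A) = 0.
Proof.
move=> hA; have iA := sq_intg_intg (Hsq hA).
have i1 := isin hA; have i2 := intgZ (wt A) iA.
by rewrite ExB// ExZ// (HE hA) Esin// mulr0 subrr.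
Qed.

Let covBl A A' B : sq_intg P A -> sq_intg P A' -> sq_intg P B ->
  cov (fun w => A w - A' w) B = cov A B - cov A' B.
Proof.
move=> hA hA' hB; rewrite -ExB; [|exact: sq_intgM|exact: sq_intgM].
by congr Ex; apply/funext => w; rewrite mulrBl.
Qed.

Let covC A B : cov A B = cov B A.
Proof. by congr Ex; apply/funext => w; rewrite mulrC. Qed.

Let covZl c A B : sq_intg P A -> sq_intg P B -> cov (fun w => c * A w) B = c * cov A B.
Proof.
move=> hA hB; rewrite -ExZ; last exact: sq_intgM.
by congr Ex; apply/funext => w; rewrite mulrA.
Qed.

Let kN A N : H A -> H N -> cov (k A) N = 0.
Proof.
move=> hA hN; rewrite covBl ?(gaussian_cos_lin gH)//; [|exact: gaussian_sq_cos|exact: sq_intg_cst|exact: Hsq].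
by rewrite ExZ ?(HE hN) ?mulr0 ?subrr//; exact: sq_intg_intg (Hsq hN).
Qed.

Let sN A N : H A -> H N -> cov (s A) N = 0.
Proof.
move=> hA hN; rewrite covBl ?(gaussian_sin_lin gH)//; [|exact: gaussian_sq_sin|exact: sq_intgZ (Hsq hA)|exact: Hsq].
by rewrite covZl ?subrr//; exact: Hsq.
Qed.

Let kk A B : H A -> H B -> cov (k A) (k B) = wt A * wt B * cosh_tail (cov A B).
Proof.
move=> hA hB; have sk := sqk hB; have sc := gaussian_sq_cos hA.
rewrite covBl//; last exact: sq_intg_cst.
rewrite [X in _ - X]ExZ; last exact: sq_intg_intg.
rewrite Ek// mulr0 subr0 covC covBl//; [|exact: gaussian_sq_cos|exact: sq_intg_cst].
rewrite [X in _ - X]ExZ; last exact: sq_intg_intg.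
rewrite Ecos// (gaussian_cos_cos gH hB hA) (covC B A) /cosh_tail; ring.
Qed.

Let ks A B : H A -> H B -> cov (k A) (s B) = 0.
Proof.
move=> hA hB; have sk := sqk hA; have sB := gaussian_sq_sin hB.
rewrite covC covBl//; last exact: sq_intgZ (Hsq hB).
rewrite covZl//; last exact: Hsq.
rewrite (covC B) kN// mulr0 subr0 covC covBl//; [|exact: gaussian_sq_cos|exact: sq_intg_cst].
rewrite (gaussian_cos_sin gH)// ExZ ?Esin ?mulr0 ?subrr//; exact: sq_intg_intg.
Qed.

Let ss A B : H A -> H B -> cov (s A) (s B) = wt A * wt B * sinh_tail (cov A B).
Proof.
move=> hA hB; have sk := sqs hA; have sB := gaussian_sq_sin hB.
rewrite covC covBl//; last exact: sq_intgZ (Hsq hB).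
rewrite covZl//; last exact: Hsq.
rewrite (covC B) sN// mulr0 subr0 covC covBl//; [|exact: gaussian_sq_sin|exact: sq_intgZ (Hsq hA)].
rewrite covZl//; last exact: Hsq.
rewrite (covC A (fun w => sin (B w))) !(gaussian_sin_sin gH, gaussian_sin_lin gH)// (covC B A) /sinh_tail; ring.
Qed.

Variables (I : finType) (A B : I -> T -> R) (c e : I -> R) (th : R).
Hypothesis (HA : forall i, H (A i)) (HB : forall i, H (B i)).
Hypothesis (th01 : 0 <= th <= 1).
Let S i j := cov (A i) (A j).
Let C i j := cov (A i) (B j).
Hypothesis SB : forall i j, cov (B i) (B j) = S i j.
Hypothesis Cpos : forall x y : I -> R, 0 <= th * \sum_i \sum_j x i * x j * S i j
      + 2 * \sum_i \sum_j x i * y j * C i j + th * \sum_i \sum_j y i * y j * S i j.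

Let G (A : I -> T -> R) w := \sum_i (c i * cos (A i w) + e i * sin (A i w)).
Let Z (A : I -> T -> R) w := \sum_i (c i * k (A i) w + e i * s (A i) w).

Let sqZ1 A' i : H (A' i) -> sq_intg P (fun w => c i * k (A' i) w + e i * s (A' i) w).
Proof. by move=> h; apply: sq_intgD; apply: sq_intgZ; [exact: sqk|exact: sqs]. Qed.

Let sqlin (A' : I -> T -> R) (y : I -> R) : (forall i, H (A' i)) -> sq_intg P (fun w => \sum_i y i * A' i w).
Proof. by move=> h; apply: sq_intg_sum => i; apply: sq_intgZ; exact: Hsq. Qed.

Let ZZ1 A' B' i j : H (A' i) -> H (B' j) ->
  cov (fun w => c i * k (A' i) w + e i * s (A' i) w) (fun w => c j * k (B' j) w + e j * s (B' j) w) =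
  wt (A' i) * wt (B' j) * (c i * c j * cosh_tail (cov (A' i) (B' j)) + e i * e j * sinh_tail (cov (A' i) (B' j))).
Proof.
move=> hA hB.
transitivity (c i * c j * cov (k (A' i)) (k (B' j)) + c i * e j * cov (k (A' i)) (s (B' j))
   + e i * c j * cov (k (B' j)) (s (A' i)) + e i * e j * cov (s (A' i)) (s (B' j))); last first.
  by rewrite kk// ks// ks// ss//; ring.
have i1 := sq_intgM (sqk hA) (sqk hB). have i2 := sq_intgM (sqk hA) (sqs hB).
have i3 := sq_intgM (sqk hB) (sqs hA). have i4 := sq_intgM (sqs hA) (sqs hB).
rewrite -!ExZ// -!ExD; try by [exact: intgZ | apply: intgD; try apply: intgD; exact: intgZ].
by congr Ex; apply/funext => w; ring.
Qed.

Let ZZ (A' B' : I -> T -> R) : (forall i, H (A' i)) -> (forall i, H (B' i)) ->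
  (forall i, wt (A' i) = wt (A i)) -> (forall i, wt (B' i) = wt (A i)) ->
  cov (Z A') (Z B') = \sum_i \sum_j (wt (A i) * c i * (wt (A j) * c j) * cosh_tail (cov (A' i) (B' j))
     + wt (A i) * e i * (wt (A j) * e j) * sinh_tail (cov (A' i) (B' j))).
Proof.
move=> hA hB wA wB; rewrite Ex_sum2 => [|i|j]; [|exact: sqZ1|exact: sqZ1].
apply: eq_bigr => i _; apply: eq_bigr => j _.
by rewrite ZZ1// wA wB; ring.
Qed.

Let Zorth j : cov (Z A) (A j) = 0.
Proof.
transitivity (\sum_i Ex P (fun w => c i * (k (A i) w * A j w) + e i * (s (A i) w * A j w))).
  rewrite -Ex_sum => [|i]; last first.
    by apply: intgD; apply: intgZ; apply: sq_intgM (Hsq (HA j)); [exact: sqk|exact: sqs].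
  congr Ex; apply/funext => w; rewrite mulr_suml; apply: eq_bigr => i _; ring.
rewrite big1// => i _; have i1 := sq_intgM (sqk (HA i)) (Hsq (HA j)).
have i2 := sq_intgM (sqs (HA i)) (Hsq (HA j)).
by rewrite ExD ?ExZ ?kN ?sN ?mulr0 ?addr0//; exact: intgZ.
Qed.

Let sqZ (A' : I -> T -> R) : (forall i, H (A' i)) -> sq_intg P (Z A').
Proof. by move=> h; apply: sq_intg_sum => i; exact: sqZ1. Qed.

Let EZ : Ex P (Z A) = 0.
Proof.
rewrite Ex_sum => [|i]; last exact: sq_intg_intg (sqZ1 (HA i)).
rewrite big1// => i _; have i1 := sq_intg_intg (sqk (HA i)); have i2 := sq_intg_intg (sqs (HA i)).
by rewrite ExD ?ExZ ?Ek ?Es ?mulr0 ?addr0//; exact: intgZ.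
Qed.

Let wtB i : wt (B i) = wt (A i). Proof. by rewrite SB. Qed.

Let p := \sum_i wt (A i) * c i.
Let lin (A' : I -> T -> R) w := \sum_i wt (A i) * e i * A' i w.

(** [Z A] is [G A] minus its projections on the constants and on the linear span of the A i. Its
    covariances are forms in the tail kernels, so the cross-covariance is at most th^2 times its
    variance, and by orthogonality this variance is at most E G^2. *)
Lemma trig_reduction :
  `|cov (fun w => G A w - p - lin A w) (fun w => G B w - p - lin B w)| <=
  th ^+ 2 * Ex P (fun w => G A w ^+ 2).
Proof.
have GZ A' w : (forall i, wt (A' i) = wt (A i)) -> G A' w - p - lin A' w = Z A' w.
  move=> wA; rewrite /G /Z /p /lin -!sumrB; apply: eq_bigr => i _.
  by rewrite /k /s wA; ring.
have -> : cov (fun w => G A w - p - lin A w) (fun w => G B w - p - lin B w) = cov (Z A) (Z B).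
  by congr Ex; apply/funext => w; rewrite !GZ.
have h : `|cov (Z A) (Z B)| <= th ^+ 2 * cov (Z A) (Z A).
  rewrite !ZZ//; apply: hyperbolic_tail_bound => //.
  move=> x; have -> : \sum_i \sum_j x i * x j * Ex P (fun w => A i w * A j w) =
     cov (fun w => \sum_i x i * A i w) (fun w => \sum_i x i * A i w).
    rewrite Ex_sum2 => [|i|i]; [|exact: sq_intgZ (Hsq (HA i))|exact: sq_intgZ (Hsq (HA i))].
    apply: eq_bigr => i _; apply: eq_bigr => j _.
    rewrite -ExZ; last exact: sq_intgM (Hsq (HA i)) (Hsq (HA j)).
    by congr Ex; apply/funext => w; ring.
  by apply: Ex_ge0 => w; rewrite -expr2 sqr_ge0.
apply: (le_trans h); apply: ler_wpM2l; first exact: sqr_ge0.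
have sqp : sq_intg P (fun w => p + lin A w) by apply: sq_intgD; [exact: sq_intg_cst|exact: sqlin].
have Zp : cov (Z A) (fun w => p + lin A w) = 0.
  transitivity (Ex P (fun w => p * Z A w) + Ex P (fun w => \sum_j wt (A j) * e j * (Z A w * A j w))).
    have i1 : intg P (fun w => p * Z A w) by apply: intgZ; exact: sq_intg_intg (sqZ HA).
    rewrite -ExD//; last first.
      by apply: intg_sum => j; apply: intgZ; exact: sq_intgM (sqZ HA) (Hsq (HA j)).
    congr Ex; apply/funext => w; rewrite mulrDr mulrC; congr (_ + _).
    by rewrite /lin mulr_sumr; apply: eq_bigr => j _; ring.
  rewrite ExZ ?EZ ?mulr0 ?add0r; last exact: sq_intg_intg (sqZ HA).
  rewrite Ex_sum => [|j]; last by apply: intgZ; exact: sq_intgM (sqZ HA) (Hsq (HA j)).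
  rewrite big1// => j _; rewrite ExZ ?Zorth ?mulr0//.
  exact: sq_intgM (sqZ HA) (Hsq (HA j)).
have -> : Ex P (fun w => G A w ^+ 2) = cov (Z A) (Z A) + 2 * cov (Z A) (fun w => p + lin A w) +
   cov (fun w => p + lin A w) (fun w => p + lin A w).
  have i1 := sq_intgM (sqZ HA) (sqZ HA). have i2 := sq_intgM (sqZ HA) sqp.
  have i3 := sq_intgM sqp sqp.
  rewrite -ExZ// -ExD//; last exact: intgZ.
  rewrite -ExD//; last by apply: intgD => //; exact: intgZ.
  by congr Ex; apply/funext => w; rewrite -GZ//; ring.
rewrite Zp mulr0 addr0 lerDl; apply: Ex_ge0 => w; rewrite -expr2; exact: sqr_ge0.
Qed.

End TrigReduction.

(** * From trigonometric polynomials to bounded pointwise limits *)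

Section VectorReduction.
Context {R : realType} d (T : measurableType d) (P : probability T R).
Variable H : (T -> R) -> Prop.
Hypothesis gH : gaussian_space P H.
Hypothesis H0 : H (fun=> 0).
Variables (h : nat) (U V : 'I_h -> T -> R) (W : 'I_h -> 'I_h -> R) (th : R).
Local Notation cov A B := (Ex P (fun w => A w * B w)).
Let Sig p q := cov (U p) (U q).
Hypothesis (HU : forall p, H (U p)) (HV : forall p, H (V p)).
Hypothesis SigV : forall p q, cov (V p) (V q) = Sig p q.
Hypothesis WSig : forall p q, \sum_k W p k * Sig k q = (p == q)%:R.
Hypothesis th01 : 0 <= th <= 1.
Hypothesis Cpos : forall x y : 'I_h -> R, 0 <= th * \sum_p \sum_q x p * x q * Sig p q
      + 2 * \sum_p \sum_q x p * y q * cov (U p) (V q) + th * \sum_p \sum_q y p * y q * Sig p q.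

Let Hsq N : H N -> sq_intg P N. Proof. by case: gH => _ _ h' _ /h'[]. Qed.

Let Hsum (I : Type) (s : seq I) (F : I -> T -> R) : (forall i, H (F i)) -> H (fun w => \sum_(i <- s) F i w).
Proof.
move=> HF; elim: s => [|i s IH]; first by under eq_fun do rewrite big_nil.
by under eq_fun do rewrite big_cons; case: gH => hD _ _ _; exact: hD.
Qed.

Definition at_ (X : 'I_h -> T -> R) (w : T) : 'I_h -> R := fun p => X p w.

(** The vector of regression coefficients of f on U, with W a left inverse of the covariance matrix.
    In [residual], mean and coefficients are those at U even when the argument is V, so both
    residuals subtract the same function. *)
Definition reg_coef (f : ('I_h -> R) -> R) (p : 'I_h) : R :=
  \sum_k W p k * Ex P (fun w => f (at_ U w) * U k w).

Definition residual (f : ('I_h -> R) -> R) (X : 'I_h -> T -> R) (w : T) : R :=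
  f (at_ X w) - Ex P (fun w => f (at_ U w)) - \sum_p reg_coef f p * X p w.

(** The moment equalities express what is needed of the equality in law of U and V. They are
    explicit for trigonometric polynomials, pass to limits with the covariance bound, and later
    allow the base window of the regression to be changed. *)
Definition reducible (f : ('I_h -> R) -> R) : Prop :=
  [/\ measurable_fun setT (fun w => f (at_ U w)),
      measurable_fun setT (fun w => f (at_ V w)),
      Ex P (fun w => f (at_ U w)) = Ex P (fun w => f (at_ V w)),
      forall k, Ex P (fun w => f (at_ U w) * U k w) = Ex P (fun w => f (at_ V w) * V k w) &
      `|cov (residual f U) (residual f V)| <= th ^+ 2 * Ex P (fun w => f (at_ U w) ^+ 2)].

(** Each entry holds a cosine coefficient, a sine coefficient and a frequency vector, arbitrary in
    R^h. *)
Definition trig_poly (f : ('I_h -> R) -> R) : Prop :=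
  exists s : seq (R * R * ('I_h -> R)), forall u, f u =
    \sum_(t <- s) (t.1.1 * cos (\sum_p t.2 p * u p) + t.1.2 * sin (\sum_p t.2 p * u p)).

Let combo (a : 'I_h -> R) (X : 'I_h -> T -> R) w := \sum_p a p * X p w.

Let Hcombo a X : (forall p, H (X p)) -> H (combo a X).
Proof. by move=> HX; apply: Hsum => p; case: gH => _ hZ _ _; exact: hZ. Qed.

Let cov_combo a b X Y : (forall p, H (X p)) -> (forall p, H (Y p)) ->
  cov (combo a X) (combo b Y) = \sum_p \sum_q a p * b q * cov (X p) (Y q).
Proof.
move=> HX HY; rewrite Ex_sum2 => [|p|q]; [|exact: sq_intgZ (Hsq (HX p))|exact: sq_intgZ (Hsq (HY q))].
apply: eq_bigr => p _; apply: eq_bigr => q _.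
rewrite -ExZ; last exact: sq_intgM (Hsq (HX p)) (Hsq (HY q)).
by congr Ex; apply/funext => w; ring.
Qed.

(** The regression is explicit: a sine term with coefficient e and frequency a has covariances wt e
    (S a) with the window, and W cancels S, leaving wt e a. Hence the residual is the one of
    [trig_reduction], whose positivity hypothesis is [Cpos] evaluated at combinations of the
    frequencies. *)
Lemma trig_poly_reducible f : trig_poly f -> reducible f.
Proof.
move=> [s fE].
pose I := 'I_(size s); pose t (i : I) := tnth (in_tuple s) i.
pose c i := (t i).1.1; pose e i := (t i).1.2; pose a i := (t i).2.
pose A (X : 'I_h -> T -> R) i := combo (a i) X.
have HA X i : (forall p, H (X p)) -> H (A X i) by exact: Hcombo.
have fA X w : f (at_ X w) = \sum_i (c i * cos (A X i w) + e i * sin (A X i w)).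
  by rewrite fE big_tnth.
pose wt i := expR (- cov (A U i) (A U i) / 2).
have sqf X : (forall p, H (X p)) -> sq_intg P (fun w => f (at_ X w)).
  move=> HX; under eq_fun do rewrite fA; apply: sq_intg_sum => i; apply: sq_intgD; apply: sq_intgZ.
    exact: (gaussian_sq_cos gH (HA _ _ HX)).
  exact: (gaussian_sq_sin gH (HA _ _ HX)).
have cAA X Y i j : (forall p, H (X p)) -> (forall p, H (Y p)) ->
    (forall p q, cov (X p) (X q) = cov (Y p) (Y q)) -> cov (A X i) (A X j) = cov (A Y i) (A Y j).
  move=> HX HY XY; rewrite !cov_combo//; apply: eq_bigr => p _; apply: eq_bigr => q _.
  by rewrite XY.
have SB i j : cov (A V i) (A V j) = cov (A U i) (A U j) by apply: cAA.
have pE X : (forall p, H (X p)) -> (forall p q, cov (X p) (X q) = Sig p q) ->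
    Ex P (fun w => f (at_ X w)) = \sum_i wt i * c i.
  move=> HX SX; under eq_fun do rewrite fA.
  have icos i := sq_intg_intg (gaussian_sq_cos gH (HA X i HX)).
  have isin i := sq_intg_intg (gaussian_sq_sin gH (HA X i HX)).
  rewrite Ex_sum => [|i]; last by apply: intgD; apply: intgZ.
  apply: eq_bigr => i _; rewrite ExD ?ExZ//; [|exact: intgZ|exact: intgZ].
  have [_ _ _ /(_ _ (HA X i HX))[-> ->]] := gH.
  rewrite mulr0 addr0 mulrC; congr (expR (- _ / 2) * _); rewrite -(cAA X U)//.
have AX X i k : (forall p, H (X p)) -> cov (A X i) (X k) = \sum_r a i r * cov (X k) (X r).
  move=> HX; transitivity (Ex P (fun w => \sum_r a i r * (X k w * X r w))).
    by congr Ex; apply/funext => w; rewrite mulr_suml; apply: eq_bigr => r _; ring.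
  rewrite Ex_sum => [|r]; last by apply: intgZ; exact: sq_intgM (Hsq (HX k)) (Hsq (HX r)).
  by apply: eq_bigr => r _; rewrite ExZ//; exact: sq_intgM (Hsq (HX k)) (Hsq (HX r)).
have mE X k : (forall p, H (X p)) -> (forall p q, cov (X p) (X q) = Sig p q) ->
    Ex P (fun w => f (at_ X w) * X k w) = \sum_i wt i * e i * \sum_r a i r * Sig k r.
  move=> HX SX.
  have ic i := sq_intgM (gaussian_sq_cos gH (HA X i HX)) (Hsq (HX k)).
  have is_ i := sq_intgM (gaussian_sq_sin gH (HA X i HX)) (Hsq (HX k)).
  transitivity (Ex P (fun w => \sum_i (c i * (cos (A X i w) * X k w) + e i * (sin (A X i w) * X k w)))).
    congr Ex; apply/funext => w; rewrite fA mulr_suml; apply: eq_bigr => i _; ring.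
  rewrite Ex_sum => [|i]; last by apply: intgD; apply: intgZ.
  apply: eq_bigr => i _; rewrite ExD ?ExZ//; [|exact: intgZ|exact: intgZ].
  rewrite (gaussian_cos_lin gH)// ?(gaussian_sin_lin gH)//; try exact: HA.
  rewrite AX// (cAA X U)// /wt; under [in LHS]eq_bigr do rewrite SX.
  by ring.
have alphaE p : reg_coef f p = \sum_i wt i * e i * a i p.
  rewrite /reg_coef.
  transitivity (\sum_k \sum_i \sum_r wt i * e i * a i r * (W p k * Sig k r)).
    apply: eq_bigr => k _; rewrite mE// mulr_sumr; apply: eq_bigr => i _.
    by rewrite !mulr_sumr; apply: eq_bigr => r _; ring.
  rewrite exchange_big/=; apply: eq_bigr => i _; rewrite exchange_big/=.
  rewrite (bigD1 p)//= -mulr_sumr WSig eqxx mulr1 big1 ?addr0// => r rp.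
  by rewrite -mulr_sumr WSig eq_sym (negbTE rp) mulr0.
have linE X w : \sum_p reg_coef f p * X p w = \sum_i wt i * e i * A X i w.
  transitivity (\sum_p \sum_i wt i * e i * a i p * X p w).
    by apply: eq_bigr => p _; rewrite alphaE mulr_suml.
  rewrite exchange_big/=; apply: eq_bigr => i _; rewrite /A /combo mulr_sumr.
  by apply: eq_bigr => p _; rewrite mulrA.
have form_combo (X Y : 'I_h -> T -> R) (x y : I -> R) : (forall p, H (X p)) -> (forall p, H (Y p)) ->
  \sum_i \sum_j x i * y j * cov (A X i) (A Y j) =
  \sum_p \sum_q (\sum_i x i * a i p) * (\sum_j y j * a j q) * cov (X p) (Y q).
  move=> HX HY.
  rewrite -(cov_combo (fun p => \sum_i x i * a i p) (fun q => \sum_j y j * a j q) HX HY).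
  have cE (z : I -> R) (Z : 'I_h -> T -> R) w : combo (fun p => \sum_i z i * a i p) Z w = \sum_i z i * A Z i w.
    rewrite /combo; under eq_bigr do rewrite mulr_suml.
    rewrite exchange_big/=; apply: eq_bigr => i _; rewrite mulr_sumr.
    by apply: eq_bigr => p _; rewrite mulrA.
  under [in RHS]eq_fun do rewrite !cE.
  rewrite Ex_sum2 => [|i|j]; [|exact: sq_intgZ (Hsq (HA X i HX))|exact: sq_intgZ (Hsq (HA Y j HY))].
  apply: eq_bigr => i _; apply: eq_bigr => j _.
  rewrite -ExZ; last exact: sq_intgM (Hsq (HA X i HX)) (Hsq (HA Y j HY)).
  by congr Ex; apply/funext => w; ring.
split; [exact: sq_intg_meas (sqf U HU)|exact: sq_intg_meas (sqf V HV)| | |].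
- by rewrite !pE.
- by move=> k; rewrite !mE.
have AC (x y : I -> R) : 0 <= th * \sum_i \sum_j x i * x j * cov (A U i) (A U j)
      + 2 * \sum_i \sum_j x i * y j * cov (A U i) (A V j) + th * \sum_i \sum_j y i * y j * cov (A U i) (A U j).
  by rewrite !form_combo.
have := trig_reduction gH c e (fun i => HA U i HU) (fun i => HA V i HV) th01 SB AC.
have -> : (fun w => (\sum_i (c i * cos (A U i w) + e i * sin (A U i w))) ^+ 2) = (fun w => f (at_ U w) ^+ 2).
  by apply/funext => w; rewrite fA.
congr (`|Ex P _| <= _); apply/funext => w.
by rewrite /residual pE// !linE !fA.
Qed.

(** Dominated convergence in every clause. [K] bounds the regression coefficients uniformly in n, so
    the square integrable [Dom] dominates all residuals. *)
Lemma reducible_limit (f : ('I_h -> R) -> R) (F : nat -> ('I_h -> R) -> R) (B : R) :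
  (forall n, reducible (F n)) -> (forall n u, `|F n u| <= B) ->
  (forall u, F n u @[n --> \oo] --> f u) -> reducible f.
Proof.
move=> rF FB Ff.
have mU : measurable_fun setT (fun w => f (at_ U w)).
  apply: (@measurable_fun_cvg _ _ _ _ (fun n w => F n (at_ U w))) => [n|w _]; last exact: Ff.
  by have [] := rF n.
have mV : measurable_fun setT (fun w => f (at_ V w)).
  apply: (@measurable_fun_cvg _ _ _ _ (fun n w => F n (at_ V w))) => [n|w _]; last exact: Ff.
  by have [] := rF n.
have mFU n : measurable_fun setT (fun w => F n (at_ U w)) by have [] := rF n.
have mFV n : measurable_fun setT (fun w => F n (at_ V w)) by have [] := rF n.
have B0 : 0 <= B by apply: le_trans (FB 0%N (fun=> 0)).
have E1 : Ex P (fun w => F n (at_ U w)) @[n --> \oo] --> Ex P (fun w => f (at_ U w)).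
  by apply: (@Ex_dct _ _ _ _ _ _ (fun=> B)) => //; exact: intg_cst.
have E2 k : Ex P (fun w => F n (at_ U w) * U k w) @[n --> \oo] --> Ex P (fun w => f (at_ U w) * U k w).
  apply: (@Ex_dct _ _ _ _ _ _ (fun w => B * `|U k w|)).
  - by move=> n; apply: measurable_funM => //; exact: sq_intg_meas (Hsq (HU k)).
  - by apply: measurable_funM => //; exact: sq_intg_meas (Hsq (HU k)).
  - by move=> w; apply: cvgMl; exact: Ff.
  - by move=> n w; rewrite normrM ler_wpM2r.
  - by apply: intgZ; exact: integrable_norm (sq_intg_intg (Hsq (HU k))).
have E3 p : reg_coef (F n) p @[n --> \oo] --> reg_coef f p.
  by apply: cvg_seq_sum => k; apply: cvgMr; exact: E2.
have E4 : Ex P (fun w => F n (at_ U w) ^+ 2) @[n --> \oo] --> Ex P (fun w => f (at_ U w) ^+ 2).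
  apply: (@Ex_dct _ _ _ _ _ _ (fun=> B ^+ 2)).
  - by move=> n; apply: measurable_funX.
  - by apply: measurable_funX.
  - by move=> w; rewrite expr2; under eq_fun do rewrite expr2; apply: cvgM; exact: Ff.
  - by move=> n w; rewrite normrX lerXn2r// nnegrE.
  - exact: intg_cst.
pose K p := \sum_k `|W p k| * (B * Ex P (fun w => `|U k w|)).
have K0 p : 0 <= K p by apply: sumr_ge0 => k _; rewrite !mulr_ge0// Ex_ge0.
have aK n p : `|reg_coef (F n) p| <= K p.
  rewrite (le_trans (ler_norm_sum _ _ _))//; apply: ler_sum => k _.
  rewrite normrM ler_wpM2l//.
  have iU := integrable_norm (sq_intg_intg (Hsq (HU k))).
  have iFU : intg P (fun w => F n (at_ U w) * U k w).
    apply: intg_le (intgZ B iU); first by apply: measurable_funM => //; exact: sq_intg_meas (Hsq (HU k)).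
    by move=> w; rewrite normrM ler_wpM2r.
  rewrite (le_trans (Ex_norm iFU))// -ExZ//; apply: Ex_le => [||w].
  - exact: integrable_norm iFU.
  - exact: intgZ.
  - by rewrite normrM ler_wpM2r.
pose Dom (X : 'I_h -> T -> R) w := 2 * B + \sum_p K p * `|X p w|.
have sqDom X : (forall p, H (X p)) -> sq_intg P (Dom X).
  move=> HX; apply: sq_intgD; first exact: sq_intg_cst.
  apply: sq_intg_sum => p; apply: sq_intgZ; have [mX iX] := Hsq (HX p); split.
    exact: measurableT_comp.
  by under eq_fun do rewrite real_normK ?num_real//.
have resDom X n w : `|residual (F n) X w| <= Dom X w.
  rewrite /residual /Dom (le_trans (ler_normB _ _))// lerD//.
    rewrite (le_trans (ler_normB _ _))// mulr2n mulrDl mul1r lerD//.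
    have iF : intg P (fun w => F n (at_ U w)) by apply: (@intg_bounded _ _ _ _ _ B).
    rewrite (le_trans (Ex_norm iF))// -[leRHS](Ex_cst P); apply: Ex_le => //.
      exact: integrable_norm iF.
    exact: intg_cst.
  rewrite (le_trans (ler_norm_sum _ _ _))//; apply: ler_sum => p _.
  by rewrite normrM ler_wpM2r.
have mres g (X : 'I_h -> T -> R) : (forall p, H (X p)) -> measurable_fun setT (fun w => g (at_ X w)) ->
    measurable_fun setT (residual g X).
  move=> HX mg; apply: measurable_funB; first by apply: measurable_funB.
  apply: (@intg_meas _ _ _ P); apply: intg_sum => p; apply: intgZ; exact: sq_intg_intg (Hsq (HX p)).
have res_cvg X w : residual (F n) X w @[n --> \oo] --> residual f X w.
  apply: cvgB; first by apply: cvgB => //; exact: Ff.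
  by apply: cvg_seq_sum => p; apply: cvgMl; exact: E3.
have E5 : cov (residual (F n) U) (residual (F n) V) @[n --> \oo] --> cov (residual f U) (residual f V).
  apply: (@Ex_dct _ _ _ _ _ _ (fun w => Dom U w * Dom V w)).
  - by move=> n; apply: measurable_funM; apply: mres.
  - by apply: measurable_funM; apply: mres.
  - by move=> w; apply: cvgM; exact: res_cvg.
  - by move=> n w; rewrite normrM ler_pM.
  - by apply: sq_intgM; exact: sqDom.
split => //.
- have E1' : Ex P (fun w => F n (at_ U w)) @[n --> \oo] --> Ex P (fun w => f (at_ V w)).
    under eq_fun => n do (have [_ _ -> _ _] := rF n).
    by apply: (@Ex_dct _ _ _ _ _ _ (fun=> B)) => //; exact: intg_cst.
  exact: cvg_unique E1 E1'.
- move=> k.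
  have E2' : Ex P (fun w => F n (at_ U w) * U k w) @[n --> \oo] --> Ex P (fun w => f (at_ V w) * V k w).
    under eq_fun => n do (have [_ _ _ -> _] := rF n).
    apply: (@Ex_dct _ _ _ _ _ _ (fun w => B * `|V k w|)).
    + by move=> n; apply: measurable_funM => //; exact: sq_intg_meas (Hsq (HV k)).
    + by apply: measurable_funM => //; exact: sq_intg_meas (Hsq (HV k)).
    + by move=> w; apply: cvgMl; exact: Ff.
    + by move=> n w; rewrite normrM ler_wpM2r.
    + by apply: intgZ; exact: integrable_norm (sq_intg_intg (Hsq (HV k))).
  exact: cvg_unique (E2 k) E2'.
have hC : `|cov (residual (F n) U) (residual (F n) V)| @[n --> \oo] --> `|cov (residual f U) (residual f V)|.
  exact: cvg_norm.
have hS : th ^+ 2 * Ex P (fun w => F n (at_ U w) ^+ 2) @[n --> \oo] --> th ^+ 2 * Ex P (fun w => f (at_ U w) ^+ 2).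
  exact: cvgMr.
by apply: (ler_cvg_to hC hS); apply: nearW => n; have [] := rF n.
Qed.

End VectorReduction.

(** * Trigonometric approximation of orthant functions *)

Section TrigPolyAlgebra.
Context {R : realType} {h : nat}.
Implicit Types f g : ('I_h -> R) -> R.

Lemma trig_poly_eq f g : f =1 g -> trig_poly f -> trig_poly g.
Proof. by move=> fg [s fE]; exists s => u; rewrite -fg. Qed.

Let dot0 (u : 'I_h -> R) : \sum_p 0 * u p = 0.
Proof. by rewrite big1// => p _; rewrite mul0r. Qed.

Lemma trig_poly_cst (c : R) : trig_poly (fun _ : 'I_h -> R => c).
Proof.
exists [:: (c, 0, fun=> 0)] => u; rewrite big_seq1/= dot0 cos0.
by rewrite mulr1 mul0r addr0.
Qed.

Lemma trig_poly_sin (l : 'I_h -> R) : trig_poly (fun u => sin (\sum_p l p * u p)).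
Proof. by exists [:: (0, 1, l)] => u; rewrite big_seq1/= mul0r add0r mul1r. Qed.

Lemma trig_polyD f g : trig_poly f -> trig_poly g -> trig_poly (fun u => f u + g u).
Proof. by move=> [s fE] [t gE]; exists (s ++ t) => u; rewrite fE gE big_cat. Qed.

Lemma trig_poly_sum (I : Type) (s : seq I) (F : I -> ('I_h -> R) -> R) :
  (forall i, trig_poly (F i)) -> trig_poly (fun u => \sum_(i <- s) F i u).
Proof.
move=> tF; elim: s => [|i s IH].
  by apply: trig_poly_eq (trig_poly_cst 0) => u; rewrite big_nil.
by apply: trig_poly_eq (trig_polyD (tF i) IH) => u; rewrite big_cons.
Qed.

(* product-to-sum formulas *)
Lemma trig_polyM f g : trig_poly f -> trig_poly g -> trig_poly (fun u => f u * g u).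
Proof.
move=> [s fE] [s' gE].
pose F (t t' : R * R * ('I_h -> R)) u := (t.1.1 * cos (\sum_p t.2 p * u p) + t.1.2 * sin (\sum_p t.2 p * u p)) *
  (t'.1.1 * cos (\sum_p t'.2 p * u p) + t'.1.2 * sin (\sum_p t'.2 p * u p)).
apply: (@trig_poly_eq (fun u => \sum_(t <- s) \sum_(t' <- s') F t t' u)).
  move=> u; rewrite fE gE mulr_suml; apply: eq_bigr => t _; rewrite mulr_sumr.
  exact: eq_bigr.
apply: trig_poly_sum => -[[c e] a]; apply: trig_poly_sum => -[[c' e'] a'].
exists [:: ((c * c' + e * e') / 2, (e * c' - c * e') / 2, fun p => a p - a' p);
           ((c * c' - e * e') / 2, (e * c' + c * e') / 2, fun p => a p + a' p)] => u.
rewrite /F big_cons big_seq1/=.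
have -> : \sum_p (a p - a' p) * u p = \sum_p a p * u p - \sum_p a' p * u p.
  by rewrite -sumrB; apply: eq_bigr => p _; rewrite mulrBl.
have -> : \sum_p (a p + a' p) * u p = \sum_p a p * u p + \sum_p a' p * u p.
  by rewrite -big_split; apply: eq_bigr => p _; rewrite mulrDl.
by rewrite cosB cosD sinB sinD; field.
Qed.

Lemma trig_polyZ (c : R) f : trig_poly f -> trig_poly (fun u => c * f u).
Proof. by move=> tf; exact: trig_polyM (trig_poly_cst c) tf. Qed.

Lemma trig_poly_prod (I : Type) (s : seq I) (F : I -> ('I_h -> R) -> R) :
  (forall i, trig_poly (F i)) -> trig_poly (fun u => \prod_(i <- s) F i u).
Proof.
move=> tF; elim: s => [|i s IH].
  by apply: trig_poly_eq (trig_poly_cst 1) => u; rewrite big_nil.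
by apply: trig_poly_eq (trig_polyM (tF i) IH) => u; rewrite big_cons.
Qed.

End TrigPolyAlgebra.

Section SignApproximation.
Context {R : realType}.

(* Iterating (3 x - x^3) / 2 pushes [-1, 1] to the sign of x while remaining
   polynomial, so that sharpened sines are trigonometric polynomials. *)
Definition sharpen (x : R) : R := 2^-1 * (3 * x + (-1) * (x * (x * x))).

Lemma sharpenN x : sharpen (- x) = - sharpen x.
Proof. by rewrite /sharpen; ring. Qed.

Lemma sharpen_itv x : 0 <= x <= 1 -> x <= sharpen x <= 1.
Proof.
move=> /andP[x0 x1]; apply/andP; split; rewrite /sharpen.
  have : 0 <= x * ((1 - x) * (1 + x)) by rewrite !mulr_ge0//; lra.
  lra.
have : 0 <= (1 - x) * (1 - x) * (2 + x) by rewrite !mulr_ge0//; lra.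
lra.
Qed.

Lemma iter_sharpenN k x : iter k sharpen (- x) = - iter k sharpen x.
Proof. by elim: k => //= k ->; rewrite sharpenN. Qed.

Lemma iter_sharpen_itv k x : 0 <= x <= 1 -> x <= iter k sharpen x <= 1.
Proof.
move=> x01; elim: k => [|k /andP[h1 h2]] /=; first by case/andP: x01 => _ ->; rewrite lexx.
have x0 : 0 <= x by case/andP: x01.
have /sharpen_itv/andP[h3 ->] : 0 <= iter k sharpen x <= 1 by rewrite h2 (le_trans x0).
by rewrite (le_trans h1).
Qed.

Lemma iter_sharpen_norm k x : `|x| <= 1 -> `|iter k sharpen x| <= 1.
Proof.
move=> x1; have [x0|x0] := leP 0 x.
  have /andP[h1 h2] : x <= iter k sharpen x <= 1 by apply: iter_sharpen_itv; rewrite x0 -(ger0_norm x0).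
  by rewrite ger0_norm// (le_trans x0).
have x0' : 0 <= - x by rewrite oppr_ge0 ltW.
have /andP[h1 h2] : - x <= iter k sharpen (- x) <= 1.
  by apply: iter_sharpen_itv; rewrite x0' -(ltr0_norm x0).
by rewrite -normrN -iter_sharpenN ger0_norm// (le_trans x0').
Qed.

(** 1 - [sharpen z] = (1 - z) (1 - z / 2 - z^2 / 2), so for y > 0 each step on [y, 1] shrinks the
    distance to 1 by a factor of at most 1 - y / 2. Oddness covers negative x. *)
Lemma iter_sharpen_cvg x : `|x| <= 1 -> iter k sharpen x @[k --> \oo] --> Num.sg x.
Proof.
have pos (y : R) : 0 < y -> y <= 1 -> iter k sharpen y @[k --> \oo] --> (1 : R).
  move=> y0 y1.
  have itv k : y <= iter k sharpen y <= 1 by apply: iter_sharpen_itv; rewrite ltW.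
  have h k : 1 - iter k sharpen y <= (1 - y / 2) ^+ k.
    elim: k => [|k IH] /=; first by rewrite expr0; lra.
    have /andP[h1 h2] := itv k; rewrite exprS.
    apply: (@le_trans _ _ ((1 - y / 2) * (1 - iter k sharpen y))); last by rewrite ler_wpM2l//; lra.
    rewrite /sharpen; set z := iter k sharpen y in h1 h2 *.
    have : 0 <= (1 - z) * (z - y) by apply: mulr_ge0; lra.
    have : 0 <= (1 - z) * (z * z) by apply: mulr_ge0; [lra|apply: mulr_ge0; lra].
    by lra.
  have h0 : (1 - y / 2) ^+ k @[k --> \oo] --> 0.
    by apply: cvg_expr; rewrite ger0_norm; lra.
  have hc : 1 - (1 - iter k sharpen y) @[k --> \oo] --> (1 - 0 : R).
    apply: cvgB; first exact: cvg_cst.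
    apply: (@squeeze_cvgr _ _ _ _ (cst 0) _ _ _ _ _ h0); last exact: cvg_cst.
    by apply: nearW => k /=; rewrite h andbT subr_ge0; case/andP: (itv k).
  by move: hc; rewrite subr0; under eq_fun do rewrite subKr.
move=> x1; have [x0|x0|->] := ltgtP x 0.
- rewrite ltr0_sg//.
  have : - iter k sharpen (- x) @[k --> \oo] --> (- 1 : R).
    by apply: cvgN; apply: pos; rewrite ?oppr_gt0// -(ltr0_norm x0).
  by under eq_fun do rewrite iter_sharpenN opprK.
- by rewrite gtr0_sg//; apply: pos => //; rewrite -(gtr0_norm x0).
- rewrite sgr0; under eq_fun => k.
    have -> : iter k sharpen 0 = 0.
      by elim: k => //= k ->; rewrite /sharpen !(mulr0, mul0r, addr0).
    over.
  exact: cvg_cst.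
Qed.

(** Dividing x by n + 1 eventually brings it into (- pi, pi), where sine has the sign of its
    argument; this removes the periodicity. *)
Lemma sgr_sin_cvg (x : R) : Num.sg (sin (n.+1%:R^-1 * x)) @[n --> \oo] --> Num.sg x.
Proof.
have pos (y : R) : 0 < y -> \forall n \near \oo, Num.sg (sin (n.+1%:R^-1 * y)) = 1.
  move=> y0; near=> n; rewrite gtr0_sg// sin_gt0_pi// mulr_gt0//=.
  rewrite mulrC ltr_pdivrMr// -ltr_pdivrMl ?pi_gt0//.
  rewrite (@le_lt_trans _ _ n%:R) ?ltr_nat//.
  by near: n; exact: nbhs_infty_ger.
apply: cvg_near_cst; have [x0|x0|->] := ltgtP x 0.
- have /pos : 0 < - x by rewrite oppr_gt0.
  by apply: filterS => n; rewrite mulrN sinN sgrN (ltr0_sg x0) => /eqP; rewrite eqr_oppLR => /eqP.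
- by have := pos _ x0; apply: filterS => n ->; rewrite gtr0_sg.
- by apply: nearW => n; rewrite mulr0 sin0.
Unshelve. all: by end_near. Qed.

End SignApproximation.

Lemma cvg_seq_prod (R : realType) (I : Type) (s : seq I) (f : I -> nat -> R) (l : I -> R) :
  (forall i, f i n @[n --> \oo] --> l i) ->
  \prod_(i <- s) f i n @[n --> \oo] --> \prod_(i <- s) l i.
Proof.
move=> fl; elim: s => [|i s IH].
  by under eq_fun do rewrite big_nil; rewrite big_nil; exact: cvg_cst.
by under eq_fun do rewrite big_cons; rewrite big_cons; exact: cvgM.
Qed.

(* The indicator of the cone where all the forms [l i] are positive, except
   that a vanishing form contributes a factor 1/2. *)
Definition orthant_fun (R : realType) (h n : nat) (l : 'I_n -> 'I_h -> R) (u : 'I_h -> R) : R :=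
  \prod_i (2^-1 * (1 + Num.sg (\sum_p l i p * u p))).

Lemma prod_norm_le1 (R : realType) (I : Type) (s : seq I) (a : I -> R) :
  (forall i, `|a i| <= 1) -> `|\prod_(i <- s) (2^-1 * (1 + a i))| <= 1.
Proof.
move=> a1; elim: s => [|i s IH]; first by rewrite big_nil normr1.
rewrite big_cons normrM mulr_ile1//.
by move: (a1 i); rewrite !ler_norml => /andP[h1 h2]; apply/andP; split; lra.
Qed.

Section OrthantReducible.
Context {R : realType} d (T : measurableType d) (P : probability T R).
Variable H : (T -> R) -> Prop.
Hypothesis gH : gaussian_space P H.
Hypothesis H0 : H (fun=> 0).
Variables (h : nat) (U V : 'I_h -> T -> R) (W : 'I_h -> 'I_h -> R) (th : R).
Local Notation cov A B := (Ex P (fun w => A w * B w)).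
Let Sig p q := cov (U p) (U q).
Hypothesis (HU : forall p, H (U p)) (HV : forall p, H (V p)).
Hypothesis SigV : forall p q, cov (V p) (V q) = Sig p q.
Hypothesis WSig : forall p q, \sum_k W p k * Sig k q = (p == q)%:R.
Hypothesis th01 : 0 <= th <= 1.
Hypothesis Cpos : forall x y : 'I_h -> R, 0 <= th * \sum_p \sum_q x p * x q * Sig p q
      + 2 * \sum_p \sum_q x p * y q * cov (U p) (V q) + th * \sum_p \sum_q y p * y q * Sig p q.

(** Two nested pointwise limits: sharpening at a fixed scale m turns each sine into its sign, then m
    -> oo turns the sign of the sine into the sign of the form. *)
Lemma orthant_reducible n (l : 'I_n -> 'I_h -> R) : reducible P U V W th (orthant_fun l).
Proof.
pose F m k (u : 'I_h -> R) := \prod_i (2^-1 * (1 + iter k sharpen (sin (m.+1%:R^-1 * \sum_p l i p * u p)))).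
pose G m (u : 'I_h -> R) := \prod_i (2^-1 * (1 + Num.sg (sin (m.+1%:R^-1 * \sum_p l i p * u p)))).
have sin1 x : `|sin x| <= 1 :> R by rewrite ler_norml sin_geN1 sin_le1.
have rF m k : reducible P U V W th (F m k).
  apply: (trig_poly_reducible gH H0 HU HV SigV WSig th01 Cpos).
  apply: trig_poly_prod => i; apply: trig_polyZ; apply: trig_polyD; first exact: trig_poly_cst.
  elim: k => [|k IH] /=.
    apply: trig_poly_eq (trig_poly_sin (fun p => m.+1%:R^-1 * l i p)) => u.
    by rewrite mulr_sumr; congr sin; apply: eq_bigr => p _; rewrite mulrA.
  apply: trig_polyZ; apply: trig_polyD; apply: trig_polyZ => //.
  by apply: trig_polyM => //; exact: trig_polyM.
have rG m : reducible P U V W th (G m).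
  apply: (reducible_limit gH HU HV (F := F m) (B := 1)) => [k|k u|u]; first exact: rF.
    by apply: prod_norm_le1 => i; exact: iter_sharpen_norm.
  apply: cvg_seq_prod => i; apply: cvgMr; apply: cvgD; first exact: cvg_cst.
  exact: iter_sharpen_cvg.
apply: (reducible_limit gH HU HV (F := G) (B := 1)) => [m|m u|u]; first exact: rG.
  by apply: prod_norm_le1 => i; rewrite normr_sg; case: (_ != 0); rewrite ?normr0.
apply: cvg_seq_prod => i; apply: cvgMr; apply: cvgD; first exact: cvg_cst.
exact: sgr_sin_cvg.
Qed.

End OrthantReducible.

(** * Ordinal patterns as orthants *)

Section PatternOrthant.
Context {R : realType} {h : nat} (s : 'S_h.+1).

(* x_(s i) - x_(s (i + 1)) as a linear form in the increments. *)
Definition pattern_form (i p : 'I_h) : R :=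
  (p < s (widen_ord (leqnSn h) i))%N%:R - (p < s (lift ord0 i))%N%:R.

(** The form is a difference of partial sums of distinct lengths; the increment indexed by the
    smaller length occurs in exactly one of them. *)
Lemma pattern_form_neq0 i : exists p, pattern_form i p != 0.
Proof.
rewrite /pattern_form; set a := s _; set b := s _.
have ab : (a : nat) != b.
  apply/negP => /eqP/val_inj/perm_inj/(congr1 val)/= /eqP.
  by rewrite /bump /= add1n -{1}(addn0 i) -addn1 eqn_add2l.
have [lt|gt|e] := ltngtP a b; last by rewrite e eqxx in ab.
  have ah : (a < h)%N by rewrite -ltnS (leq_trans _ (ltn_ord b)).
  by exists (Ordinal ah); rewrite /= ltnn lt sub0r oppr_eq0 oner_eq0.
have bh : (b < h)%N by rewrite -ltnS (leq_trans _ (ltn_ord a)).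
by exists (Ordinal bh); rewrite /= ltnn gt subr0 oner_eq0.
Qed.

(** Off the hyperplanes where a form vanishes, adjacent values in the order of s are distinct:
    neither the tie-breaking rule nor the weight 1/2 of [orthant_fun] intervenes. *)
Lemma increment_pattern_orthant (u : 'I_h -> R) :
  (forall i, \sum_p pattern_form i p * u p != 0) ->
  (increment_pattern u == s)%:R = orthant_fun pattern_form u.
Proof.
move=> u0; pose x (j : 'I_h.+1) := \sum_(i < h | (i < j)%N) u i.
have xE i : \sum_p pattern_form i p * u p = x (s (widen_ord (leqnSn h) i)) - x (s (lift ord0 i)).
  rewrite /x !(big_mkcond (fun _ => (_ < _)%N))/= -sumrB; apply: eq_bigr => p _.
  rewrite /pattern_form mulrBl; congr (_ - _); case: ifP; by rewrite ?mul1r ?mul0r.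
have -> : (increment_pattern u == s) = [forall i, 0 < \sum_p pattern_form i p * u p].
  apply/eqP/forallP => [/ordinal_patternP/forallP us i|us].
    have /andP[+ _] := us i; rewrite -/(x _) -/(x _) -subr_ge0 -xE le_eqVlt eq_sym.
    by rewrite (negbTE (u0 i)).
  apply/ordinal_patternP/forallP => i /=.
  have := us i; rewrite xE subr_gt0 => lt.
  by rewrite (ltW lt) (gt_eqF lt).
have [/forallP us|/forallPn[i iu]] := boolP [forall i, 0 < \sum_p pattern_form i p * u p].
  by rewrite /orthant_fun big1// => i _; rewrite gtr0_sg//; field.
rewrite /orthant_fun (bigD1 i)//= ltr0_sg; last by rewrite lt_neqAle u0 leNgt.
by rewrite subrr mulr0 mul0r.
Qed.

End PatternOrthant.

(** * The limit theorem *)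

Section GaussianSpan.
Context {R : realType} d (T : measurableType d) (P : probability T R).
Variables (Y : nat -> T -> R) (r : nat -> R).
Hypothesis sqY : forall t, sq_intg P (Y t).
Hypothesis EY : forall t, Ex P (Y t) = 0.
Hypothesis gY : gaussian_process P Y.
Hypothesis stY : stationary P Y.
Hypothesis varY : forall t, Ex P (fun w => Y t w * Y t w) = r 0%N.
Hypothesis covY0 : forall k, (1 <= k)%N -> Ex P (fun w => Y 0%N w * Y k w) = r k.

(** Lists of coefficients and times, in which a time may recur, make sums mere concatenations. *)
Definition gaussian_span (N : T -> R) : Prop :=
  exists s : seq (R * nat), N = fun w => \sum_(p <- s) p.1 * Y p.2 w.

Lemma gaussian_span0 : gaussian_span (fun=> 0).
Proof. by exists [::]; apply/funext => w; rewrite big_nil. Qed.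

Lemma gaussian_span_mem t : gaussian_span (Y t).
Proof. by exists [:: (1, t)]; apply/funext => w; rewrite big_seq1 mul1r. Qed.

Lemma gaussian_spanD N N' : gaussian_span N -> gaussian_span N' -> gaussian_span (fun w => N w + N' w).
Proof. by move=> [s ->] [s' ->]; exists (s ++ s'); apply/funext => w; rewrite big_cat. Qed.

Lemma gaussian_spanZ c N : gaussian_span N -> gaussian_span (fun w => c * N w).
Proof.
move=> [s ->]; exists [seq (c * p.1, p.2) | p <- s]; apply/funext => w.
by rewrite big_map mulr_sumr; apply: eq_bigr => p _; rewrite mulrA.
Qed.

Lemma gaussian_span_sum (I : Type) (s : seq I) (F : I -> T -> R) :
  (forall i, gaussian_span (F i)) -> gaussian_span (fun w => \sum_(i <- s) F i w).
Proof.
move=> HF; elim: s => [|i s IH].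
  by under eq_fun do rewrite big_nil; exact: gaussian_span0.
by under eq_fun do rewrite big_cons; exact: gaussian_spanD.
Qed.

Lemma gaussian_span_sq N : gaussian_span N -> sq_intg P N.
Proof. by move=> [s ->]; apply: sq_intg_sum => p; exact: sq_intgZ. Qed.

Lemma gaussian_span_mean N : gaussian_span N -> Ex P N = 0.
Proof.
move=> [s ->]; rewrite Ex_sum => [|p]; last by apply: intgZ; exact: sq_intg_intg.
by rewrite big1// => p _; rewrite ExZ ?EY ?mulr0//; exact: sq_intg_intg.
Qed.

Lemma gaussian_span_law N : gaussian_span N -> forall A : set R, measurable A ->
  P [set w | A (N w)] = gaussian_law 0 (Ex P (fun w => N w ^+ 2)) A.
Proof.
move=> sN; have [s NE] := sN.
have [m [v [v0 law]]] := gY (fun i : 'I_(size s) => (tnth (in_tuple s) i).2) (fun i => (tnth (in_tuple s) i).1).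
have law' (A : set R) : measurable A -> P [set w | A (N w)] = gaussian_law m v A.
  move=> mA; rewrite -law//; congr (P _); apply/funext => w.
  by rewrite /mkset NE big_tnth.
have [m0 v2] := gaussian_moments v0 (gaussian_span_sq sN) law'.
have m00 : m = 0 := etrans (esym m0) (gaussian_span_mean sN).
have v2' : Ex P (fun w => N w ^+ 2) = v by rewrite v2 m00 expr0n add0r.
by move=> A mA; rewrite v2' -m00; exact: law'.
Qed.

Lemma gaussian_space_span : gaussian_space P gaussian_span.
Proof.
split; [exact: gaussian_spanD|exact: gaussian_spanZ| |].
  by move=> N hN; split; [exact: gaussian_span_sq|exact: gaussian_span_mean].
move=> N hN; have v0 : 0 <= Ex P (fun w => N w ^+ 2) by apply: Ex_ge0 => w; exact: sqr_ge0.
exact: (gaussian_trig v0 (gaussian_span_sq hN) (gaussian_span_law hN) erefl).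
Qed.

Let var_sum i j : Ex P (fun w => (Y i w + Y j w) ^+ 2) = 2 * r 0%N + 2 * Ex P (fun w => Y i w * Y j w).
Proof.
have i1 := sq_intgM (sqY i) (sqY i). have i2 := sq_intgM (sqY i) (sqY j).
have i3 := sq_intgM (sqY j) (sqY j).
transitivity (Ex P (fun w => Y i w * Y i w + 2 * (Y i w * Y j w) + Y j w * Y j w)).
  by congr Ex; apply/funext => w; ring.
rewrite ExD//; last by apply: intgD => //; exact: intgZ.
by rewrite ExD//; [rewrite ExZ// !varY; ring|exact: intgZ].
Qed.

(** Stationarity speaks of laws. Y_i + Y_(k+i) and Y_0 + Y_k share one Gaussian law, hence their
    second moment, and polarization yields the covariances. *)
Let cov_shift i k : Ex P (fun w => Y i w * Y (k + i)%N w) = Ex P (fun w => Y 0%N w * Y k w).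
Proof.
pose t (j : 'I_2) := if j == ord0 then 0%N else k.
have sumE (Z : 'I_2 -> R) : \sum_(j < 2) 1 * Z j = Z ord0 + Z (lift ord0 ord0).
  by rewrite big_ord_recl big_ord1 !mul1r.
have [m [v [v0 law]]] := gY t (fun=> 1).
pose N1 w := Y i w + Y (k + i)%N w; pose N2 w := Y 0%N w + Y k w.
have law2 (A : set R) : measurable A -> P [set w | A (N2 w)] = gaussian_law m v A.
  by move=> mA; rewrite -law//; congr (P _); apply/funext => w; rewrite /mkset sumE.
have law1 (A : set R) : measurable A -> P [set w | A (N1 w)] = gaussian_law m v A.
  move=> mA; rewrite -law2//.
  pose A' : set (2.-tuple R) := [set u | A (tnth u ord0 + tnth u (lift ord0 ord0))].
  have mA' : measurable A'.
    rewrite -[A']setTI; apply: (measurable_funD _ _ measurableT mA).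
      exact: measurable_tnth.
    exact: measurable_tnth.
  have := stY i t mA'.
  by congr (P _ = P _); apply/funext => w; rewrite /A' /mkset /= !tnth_mktuple.
have sq1 : sq_intg P N1 by exact: sq_intgD.
have sq2 : sq_intg P N2 by exact: sq_intgD.
have [_ e1] := gaussian_moments v0 sq1 law1.
have [_ e2] := gaussian_moments v0 sq2 law2.
have : Ex P (fun w => N1 w ^+ 2) = Ex P (fun w => N2 w ^+ 2) by rewrite e1 e2.
by rewrite !var_sum; lra.
Qed.

Lemma gaussian_cov i j : Ex P (fun w => Y i w * Y j w) = r (ndist i j).
Proof.
wlog ij : i j / (i <= j)%N.
  move=> W; have [/W//|/ltnW/W ji] := leqP i j.
  by rewrite ndistC -ji; congr Ex; apply/funext => w; rewrite mulrC.
have [->|ne] := eqVneq i j; first by rewrite ndistxx varY.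
have -> : ndist i j = (j - i)%N by rewrite /ndist; move/eqP: ij => ->.
rewrite -covY0 ?subn_gt0 ?ltn_neqAle ?ne//.
by rewrite -{1}(subnK ij) cov_shift.
Qed.

Lemma gaussian_cov_psd n (t : 'I_n -> nat) : psd (fun i j => r (ndist (t i) (t j))).
Proof.
move=> x; have -> : \sum_i \sum_j x i * x j * r (ndist (t i) (t j)) =
  Ex P (fun w => (\sum_i x i * Y (t i) w) * (\sum_i x i * Y (t i) w)).
  rewrite Ex_sum2 => [|i|i]; [|exact: sq_intgZ|exact: sq_intgZ].
  apply: eq_bigr => i _; apply: eq_bigr => j _; rewrite -gaussian_cov -ExZ; last exact: sq_intgM.
  by congr Ex; apply/funext => w; ring.
by apply: Ex_ge0 => w; rewrite -expr2 sqr_ge0.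
Qed.

End GaussianSpan.

(** * Residuals of sliding windows *)

Section WindowResidual.
Context {R : realType} d (T : measurableType d) (P : probability T R).
Variables (Y : nat -> T -> R) (r l : nat -> R) (D : R) (h : nat).
Hypothesis sqY : forall t, sq_intg P (Y t).
Hypothesis EY : forall t, Ex P (Y t) = 0.
Hypothesis gY : gaussian_process P Y.
Hypothesis stY : stationary P Y.
Hypothesis varY : forall t, Ex P (fun w => Y t w * Y t w) = r 0%N.
Hypothesis covY0 : forall k, (1 <= k)%N -> Ex P (fun w => Y 0%N w * Y k w) = r k.
Hypothesis r01 : r 0%N = 1.
Hypotheses (D0 : 0 < D) (D1 : D < 1).
Hypothesis svl : seq_slowly_varying l.
Hypothesis rE : forall k, (1 <= k)%N -> r k = l k * k%:R `^ (- D).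

Definition window (i : nat) (p : 'I_h) : T -> R := Y (i + p)%N.

Let r_cvg0 : r @ \oo --> 0 := long_range_cvg0 D0 svl rE.
Let rpsd n (t : 'I_n -> nat) : psd (fun i j => r (ndist (t i) (t j))) :=
  gaussian_cov_psd sqY gY stY varY covY0 t.
Let W (p q : 'I_h) : R := invmx (toeplitz_mx r h) p q.
Let span := gaussian_span Y.

Lemma window_cov i j p q :
  Ex P (fun w => window i p w * window j q w) = r (ndist (i + p) (j + q)).
Proof. exact: (gaussian_cov sqY gY stY varY covY0). Qed.

Lemma window_cov_same i p q : Ex P (fun w => window i p w * window i q w) = r (ndist p q).
Proof. by rewrite window_cov /ndist !subnDl. Qed.

Lemma window_inv (p q : 'I_h) : \sum_k W p k * r (ndist k q) = (p == q)%:R.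
Proof.
have U := toeplitz_unit r01 r_cvg0 rpsd h.
have := congr1 (fun M : 'M[R]_h => M p q) (mulVmx U).
by rewrite !mxE => <-; apply: eq_bigr => k _; rewrite !mxE.
Qed.

Let HU i p : span (window i p).
Proof. exact: gaussian_span_mem. Qed.

Lemma window_reducible i j th n (a : 'I_n -> 'I_h -> R) : 0 <= th <= 1 ->
  (forall x y : 'I_h -> R, 0 <= th * \sum_p \sum_q x p * x q * r (ndist p q)
     + 2 * \sum_p \sum_q x p * y q * r (ndist (i + p) (j + q))
     + th * \sum_p \sum_q y p * y q * r (ndist p q)) ->
  reducible P (window i) (window j) W th (orthant_fun a).
Proof.
move=> th01 Cpos.
apply: (orthant_reducible (gaussian_space_span sqY EY gY) (gaussian_span0 Y)) => //.
- by move=> p; exact: HU.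
- by move=> p; exact: HU.
- by move=> p q /=; rewrite !window_cov_same.
- by move=> p q /=; rewrite -window_inv; apply: eq_bigr => k _; rewrite window_cov_same.
- move=> x y /=; have := Cpos x y.
  congr (0 <= th * _ + 2 * _ + th * _); apply: eq_bigr => p _; apply: eq_bigr => q _.
  + by rewrite window_cov_same.
  + by rewrite window_cov.
  + by rewrite window_cov_same.
Qed.

(** The value th = 1 is admissible for all pairs of windows, overlapping ones included: the form is
    then E (A + B)^2. *)
Lemma window_reducible1 i j n (a : 'I_n -> 'I_h -> R) :
  reducible P (window i) (window j) W 1 (orthant_fun a).
Proof.
apply: window_reducible; first by rewrite ler01 lexx.
move=> x y; rewrite !mul1r.
pose A w := \sum_p x p * window i p w; pose B w := \sum_p y p * window j p w.
have sZ (x' : 'I_h -> R) i' p : sq_intg P (fun w => x' p * window i' p w).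
  by apply: sq_intgZ; exact: sqY.
have EAB (x' y' : 'I_h -> R) i' j' :
    Ex P (fun w => (\sum_p x' p * window i' p w) * (\sum_p y' p * window j' p w)) =
    \sum_p \sum_q x' p * y' q * r (ndist (i' + p) (j' + q)).
  rewrite Ex_sum2 => [|p|p]; [|exact: sZ|exact: sZ].
  apply: eq_bigr => p _; apply: eq_bigr => q _; rewrite -window_cov -ExZ; last by apply: sq_intgM; exact: sqY.
  by congr Ex; apply/funext => w; ring.
have same (x' : 'I_h -> R) i' : \sum_p \sum_q x' p * x' q * r (ndist p q) =
    \sum_p \sum_q x' p * x' q * r (ndist (i' + p) (i' + q)).
  by apply: eq_bigr => p _; apply: eq_bigr => q _; rewrite /ndist !subnDl.
rewrite (same x i) (same y j) -!EAB -/A -/B.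
have qA : sq_intg P A by apply: sq_intg_sum => p; exact: sZ.
have qB : sq_intg P B by apply: sq_intg_sum => p; exact: sZ.
have -> : Ex P (fun w => A w * A w) + 2 * Ex P (fun w => A w * B w) + Ex P (fun w => B w * B w) =
    Ex P (fun w => (A w + B w) ^+ 2).
  rewrite -ExZ; last exact: sq_intgM.
  rewrite -ExD; [|exact: sq_intgM|by apply: intgZ; exact: sq_intgM].
  rewrite -ExD; [|by apply: intgD; [exact: sq_intgM|apply: intgZ; exact: sq_intgM]|exact: sq_intgM].
  by congr Ex; apply/funext => w; ring.
by apply: Ex_ge0 => w; exact: sqr_ge0.
Qed.

Lemma orthant_norm_le1 n (a : 'I_n -> 'I_h -> R) u : `|orthant_fun a u| <= 1.
Proof. by apply: prod_norm_le1 => i; rewrite normr_sg; case: (_ != 0); rewrite ?normr0// ler01. Qed.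

Section Orthant.
Variables (n : nat) (a : 'I_n -> 'I_h -> R).
Let f := orthant_fun a.

Definition window_residual (i : nat) : T -> R := residual P (window 0) W f (window i).

(** Mean and regression coefficients agree for all windows, so a bound obtained with window i as
    base applies to [window_residual], which is based at window 0. *)
Let base i : residual P (window i) W f = residual P (window 0) W f.
Proof.
have [_ _ e0 ek _] := window_reducible1 i 0 a.
apply/funext => X; apply/funext => w; rewrite /residual e0; congr (_ - _).
apply: eq_bigr => p _; congr (_ * _); rewrite /reg_coef.
by apply: eq_bigr => k _; rewrite ek.
Qed.

Lemma window_orthant_meas i : measurable_fun setT (fun w => f (at_ (window i) w)).
Proof. by have [m _ _ _ _] := window_reducible1 i 0 a. Qed.

Lemma window_residual_sq i : sq_intg P (window_residual i).
Proof.
apply: sq_intgB; last by apply: sq_intg_sum => p; apply: sq_intgZ; exact: sqY.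
apply: sq_intgB; last exact: sq_intg_cst.
by apply: (@sq_intg_bounded _ _ _ _ _ 1); [exact: window_orthant_meas|move=> w; exact: orthant_norm_le1].
Qed.

Let cov_bound i j th : reducible P (window i) (window j) W th f ->
  `|Ex P (fun w => window_residual i w * window_residual j w)| <= th ^+ 2.
Proof.
move=> [_ _ _ _]; rewrite base => /le_trans; apply.
rewrite ler_piMr ?sqr_ge0// -[leRHS](Ex_cst P).
have sf : sq_intg P (fun w => f (at_ (window i) w)).
  by apply: (@sq_intg_bounded _ _ _ _ _ 1); [exact: window_orthant_meas|move=> w; exact: orthant_norm_le1].
apply: Ex_le; [by case: sf|exact: intg_cst|move=> w].
by rewrite -(real_normK (num_real _)) exprn_ile1// orthant_norm_le1.
Qed.

(** At distance k the cross-covariances of two windows are at most 4 r k, so th = c r k satisfies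
    the positivity hypothesis, and th <= 1 for large k since r -> 0. *)
Let cov_far : exists2 c, 0 <= c & \forall k \near \oo,
  0 < r k /\ forall i j, ndist i j = k ->
  `|Ex P (fun w => window_residual i w * window_residual j w)| <= (c * r k) ^+ 2.
Proof.
have [lam lam0 coer] := toeplitz_coercive r01 r_cvg0 rpsd h.
(* 4 comes from [long_range_shift], h from summing 2 |x_p y_q| <= x_p^2 + y_q^2 over all pairs, and
   1 / lam from replacing sums of squares by the covariance form. *)
pose c := 4 * h%:R / lam; have c0 : 0 <= c by apply: divr_ge0; [rewrite mulr_ge0|exact: ltW].
have cr : c * r k @[k --> \oo] --> 0 by rewrite -(mulr0 c); exact: cvgMr.
exists c => //.
have e1 : \forall k \near \oo, c * r k <= 1 by apply: cvgr_le cr _ _; exact: ltr01.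
have e2 := long_range_shift D0 D1 svl rE h.
near=> k.
have sh : forall j, (k <= j + h)%N -> (j <= k + h)%N -> 0 < r j <= 4 * r k by near: k; exact: e2.
have ck1 : c * r k <= 1 by near: k; exact: e1.
have [rk0 _] := andP (sh k (leq_addr _ _) (leq_addr _ _)).
split => // i j ijk; apply: cov_bound; apply: window_reducible.
  by rewrite ck1 andbT mulr_ge0// ltW.
move=> x y; set X := \sum_p x p ^+ 2; set Z := \sum_p y p ^+ 2.
have cx := coer x; have cy := coer y.
have low : - (2 * \sum_p \sum_q x p * y q * r (ndist (i + p) (j + q))) <= 4 * h%:R * r k * (X + Z).
  have -> : 4 * h%:R * r k * (X + Z) = \sum_(p < h) \sum_(q < h) 4 * r k * (x p ^+ 2 + y q ^+ 2).
    have XZ : \sum_(p < h) \sum_(q < h) (x p ^+ 2 + y q ^+ 2) = h%:R * (X + Z).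
      under eq_bigr => p _ do rewrite big_split/= sumr_const card_ord -/Z.
      by rewrite big_split/= sumr_const card_ord sumrMnl -/X -mulrnDl mulr_natl.
    under [RHS]eq_bigr => p _ do rewrite -mulr_sumr.
    by rewrite -mulr_sumr XZ; ring.
  rewrite mulr_sumr -sumrN; apply: ler_sum => p _; rewrite mulr_sumr -sumrN; apply: ler_sum => q _.
  have /andP[rj0 rj4] : 0 < r (ndist (i + p) (j + q)) <= 4 * r k.
    by apply: sh; move: ijk (ltn_ord p) (ltn_ord q); clear; rewrite /ndist; lia.
  set rr := r _ in rj0 rj4 *.
  have -> : - (2 * (x p * y q * rr)) = rr * (- (2 * (x p * y q))) by ring.
  apply: (@le_trans _ _ (rr * (x p ^+ 2 + y q ^+ 2))).
    by rewrite ler_pM2l// -subr_ge0 (_ : _ - _ = (x p + y q) ^+ 2) ?sqr_ge0//; ring.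
  by rewrite ler_wpM2r// addr_ge0// sqr_ge0.
have thE : 4 * h%:R * r k * (X + Z) = c * r k * (lam * X) + c * r k * (lam * Z).
  by rewrite /c; field; rewrite gt_eqF.
have ck0 : 0 <= c * r k by rewrite mulr_ge0// ltW.
have := ler_wpM2l ck0 cx; have := ler_wpM2l ck0 cy; rewrite -/X -/Z; lra.
Unshelve. all: by end_near. Qed.

(** At far lags the covariance is at most (c r k)^2, which is o(r k); at the finitely many near ones
    the bound 1 given by th = 1 suffices. *)
Lemma window_residual_negligible :
  Ex P (fun w => (\sum_(i < n0) window_residual i w) ^+ 2) / (n0%:R `^ (2 - D) * l n0)
    @[n0 --> \oo] --> 0.
Proof.
have [c c0 [K0 _ HK]] := cov_far.
pose F k : R := if (k < K0)%N then 1 else (c * r k) ^+ 2.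
have F0 k : 0 <= F k by rewrite /F; case: ifP => _; rewrite ?ler01 ?sqr_ge0.
have Fr (e : R) : 0 < e -> \forall k \near \oo, F k <= e * r k.
  move=> e0; have cr : c ^+ 2 * r k @[k --> \oo] --> 0 by rewrite -(mulr0 (c ^+ 2)); exact: cvgMr.
  have e1 : \forall k \near \oo, c ^+ 2 * r k <= e by apply: cvgr_le cr _ _.
  near=> k.
  have kK : (K0 <= k)%N by near: k; exact: nbhs_infty_ge.
  have [rk0 _] := HK k kK.
  rewrite /F ltnNge kK /= exprMn expr2 mulrA ler_pM2r//.
  by near: k.
have neg := long_range_negligible D1 svl rE F0 Fr.
apply/cvgr0Pnorm_le => e e0; have /cvgr0Pnorm_le/(_ e e0) := neg.
apply: filterS => m; apply: le_trans; rewrite !normrM ler_wpM2r//.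
rewrite [leRHS]ger0_norm; last by apply: sumr_ge0 => i _; apply: sumr_ge0.
under eq_fun do rewrite expr2.
rewrite Ex_sum2 => [|i|i]; [|exact: window_residual_sq|exact: window_residual_sq].
apply: le_trans (ler_norm_sum _ _ _) _; apply: ler_sum => i _.
apply: le_trans (ler_norm_sum _ _ _) _; apply: ler_sum => j _.
rewrite /F; case: ltnP => kK; last by apply: (HK _ kK).2.
by rewrite -(expr1n _ 2); apply: cov_bound; exact: window_reducible1.
Unshelve. all: by end_near. Qed.

End Orthant.
End WindowResidual.

(** * Slutsky's lemma and convergence of Gaussian laws *)

(** Heine-Cantor, except that [x + t] may leave the segment. *)
Lemma continuous_uniform_segment (R : realType) (phi : R -> R) (K e : R) :
  continuous phi -> 0 < e -> exists2 del, 0 < del &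
  forall x, `|x| <= K -> forall t, `|t| <= del -> `|phi (x + t) - phi x| <= e.
Proof.
move=> cphi e0.
have cK : compact (`[- K, K]%classic : set R) by exact: segment_compact.
have /compact_near_coveringP nc := cK.
pose Q (del x : R) := forall t, `|t| <= del -> `|phi (x + t) - phi x| <= e.
have : \forall del \near 0^'+, `[- K, K]%classic `<=` Q del.
  apply: nc => x _.
  have e2 : 0 < e / 2 by rewrite divr_gt0.
  have /cvgrPdist_lt/(_ _ e2)/nbhs_ballP[rho /= rho0 brho] := cphi x.
  have rho2 : 0 < rho / 2 by rewrite divr_gt0.
  exists (ball x (rho / 2), [set del : R | del < rho / 2]) => /=.
    by split; [exact: nbhsx_ballx|exact: nbhs_right_lt].
  move=> [y del]/= [xy dl] t td.
  have h1 : `|phi x - phi y| < e / 2.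
    apply: brho; rewrite /ball/= in xy *; rewrite (lt_le_trans xy)//.
    by rewrite ler_pdivrMr// ler_pMr// ler1n.
  have h2 : `|phi x - phi (y + t)| < e / 2.
    apply: brho; rewrite /ball/= in xy *; rewrite opprD addrA.
    apply: le_lt_trans (ler_normB _ _) _; lra.
  rewrite (_ : _ - _ = (phi x - phi y) - (phi x - phi (y + t))); last by ring.
  apply: le_trans (ler_normB _ _) _; lra.
move=> ne; have [del [del0 H]] : exists del : R, 0 < del /\ `[- K, K]%classic `<=` Q del.
  near (0 : R)^'+ => del; exists del; split; near: del; last exact: ne.
  exact: nbhs_right_gt.
exists del => // x xK t td; apply: H => //=.
by rewrite in_itv/= -ler_norml.
Unshelve. all: by end_near. Qed.

Section Slutsky.
Context {R : realType} d (T : measurableType d) (P : probability T R).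

(** The function phi is uniformly continuous on bounded sets only. In [pw] the first term serves
    where G is bounded and Z small; the quadratic terms are Chebyshev bounds for the events where G
    is large or Z is not small. *)
Lemma slutsky (phi : R -> R) (B M : R) (G Z : nat -> T -> R) :
  continuous phi -> (forall x, `|phi x| <= B) ->
  (forall n, sq_intg P (G n)) -> (forall n, sq_intg P (Z n)) ->
  (\forall n \near \oo, Ex P (fun w => G n w ^+ 2) <= M) ->
  Ex P (fun w => Z n w ^+ 2) @[n --> \oo] --> 0 ->
  Ex P (fun w => phi (G n w + Z n w)) - Ex P (fun w => phi (G n w)) @[n --> \oo] --> 0.
Proof.
move=> cphi phiB sG sZ GM Z0.
have mphi : measurable_fun setT phi by exact: continuous_measurable_fun.
have B0 : 0 <= B := le_trans (normr_ge0 _) (phiB 0).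
apply/cvgr0Pnorm_le => e e0.
have e3 : 0 < e / 3 by rewrite divr_gt0.
(* Makes 2 B (|M| + 1) / K2 at most e / 3; the final 1 keeps K2 positive even if B = 0. *)
pose K2 := 2 * B * (`|M| + 1) / (e / 3) + 1.
have K20 : 0 < K2.
  rewrite ltr_wpDl// divr_ge0 ?(ltW e3)// mulr_ge0 ?addr_ge0// mulr_ge0//.
have [del del0 unif] := continuous_uniform_segment (Num.sqrt K2) cphi e3.
have Zs : 2 * B / del ^+ 2 * Ex P (fun w => Z n w ^+ 2) @[n --> \oo] --> 0.
  by rewrite -(mulr0 (2 * B / del ^+ 2)); exact: cvgMr.
have Zs' : \forall n \near \oo, 2 * B / del ^+ 2 * Ex P (fun w => Z n w ^+ 2) <= e / 3.
  exact: cvgr_le Zs _ e3.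
near=> n.
have pw w : `|phi (G n w + Z n w) - phi (G n w)| <=
    e / 3 + 2 * B / K2 * G n w ^+ 2 + 2 * B / del ^+ 2 * Z n w ^+ 2.
  have B2 : `|phi (G n w + Z n w) - phi (G n w)| <= 2 * B.
    by apply: le_trans (ler_normB _ _) _; rewrite mulr2n mulrDl mul1r lerD.
  have t1 : 0 <= 2 * B / K2 * G n w ^+ 2.
    by apply: mulr_ge0 (sqr_ge0 _); apply: divr_ge0 (ltW K20); exact: mulr_ge0.
  have t2 : 0 <= 2 * B / del ^+ 2 * Z n w ^+ 2.
    by apply: mulr_ge0 (sqr_ge0 _); apply: divr_ge0 (sqr_ge0 _); exact: mulr_ge0.
  have [gK|gK] := leP (G n w ^+ 2) K2.
    have [zd|zd] := leP `|Z n w| del.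
      have gK' : `|G n w| <= Num.sqrt K2.
        by rewrite -sqrtr_sqr ler_sqrt// ltW.
      have := unif (G n w) gK' (Z n w) zd; lra.
    have : 2 * B <= 2 * B / del ^+ 2 * Z n w ^+ 2.
      rewrite -mulrA ler_peMr ?mulr_ge0// mulrC ler_pdivlMr ?exprn_gt0// mul1r.
      by rewrite -[leRHS]real_normK ?num_real// lerXn2r ?nnegrE//; exact: ltW.
    lra.
  have : 2 * B <= 2 * B / K2 * G n w ^+ 2.
    by rewrite -mulrA ler_peMr ?mulr_ge0// mulrC ler_pdivlMr// mul1r ltW.
  lra.
have mGZ : measurable_fun setT (fun w => phi (G n w + Z n w)).
  by apply: (measurableT_comp mphi); apply: measurable_funD; [case: (sG n)|case: (sZ n)].
have mG : measurable_fun setT (fun w => phi (G n w)).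
  by apply: (measurableT_comp mphi); case: (sG n).
have i1 : intg P (fun w => phi (G n w + Z n w)) by apply: (@intg_bounded _ _ _ _ _ B).
have i2 : intg P (fun w => phi (G n w)) by apply: (@intg_bounded _ _ _ _ _ B).
rewrite -ExB//; apply: le_trans (Ex_norm _) _; first exact: intgB.
have iG := (sG n).2; have iZ := (sZ n).2.
have iR : intg P (fun w => e / 3 + 2 * B / K2 * G n w ^+ 2 + 2 * B / del ^+ 2 * Z n w ^+ 2).
  by apply: intgD; [apply: intgD; [exact: intg_cst|exact: intgZ]|exact: intgZ].
apply: le_trans (Ex_le _ iR pw) _.
  by apply: (intg_le _ _ iR); [exact: measurableT_comp (measurable_funB mGZ mG)|move=> w; rewrite normr_id].
rewrite ExD; [|by apply: intgD; [exact: intg_cst|exact: intgZ]|exact: intgZ].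
rewrite ExD; [|exact: intg_cst|exact: intgZ].
rewrite Ex_cst !ExZ//.
have h1 : 2 * B / K2 * Ex P (fun w => G n w ^+ 2) <= e / 3.
  have GMn : Ex P (fun w => G n w ^+ 2) <= `|M| + 1.
    have : Ex P (fun w => G n w ^+ 2) <= M by near: n.
    move=> /le_trans; apply; rewrite (le_trans (ler_norm M))//; lra.
  apply: (@le_trans _ _ (2 * B / K2 * (`|M| + 1))).
    by apply: ler_wpM2l GMn; apply: divr_ge0 (ltW K20); exact: mulr_ge0.
  rewrite mulrAC ler_pdivrMr//.
  have -> : e / 3 * K2 = 2 * B * (`|M| + 1) + e / 3 by rewrite /K2; field; rewrite gt_eqF.
  by rewrite lerDl ltW.
have h2 : 2 * B / del ^+ 2 * Ex P (fun w => Z n w ^+ 2) <= e / 3 by near: n.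
lra.
Unshelve. all: by end_near. Qed.

Variables (Y : nat -> T -> R).
Hypothesis sqY : forall t, sq_intg P (Y t).
Hypothesis EY : forall t, Ex P (Y t) = 0.
Hypothesis gY : gaussian_process P Y.

Lemma gaussian_span_integral (phi : R -> R) (N : T -> R) (B : R) :
  continuous phi -> (forall x, `|phi x| <= B) -> gaussian_span Y N ->
  (\int[(gaussian_law 0 (Ex P (fun w => N w ^+ 2)))%R]_x (phi x)%:E)%E = (Ex P (fun w => phi (N w)))%:E.
Proof.
move=> cphi phiB sN.
have mphi : measurable_fun setT phi by exact: continuous_measurable_fun.
have mN : measurable_fun setT N by case: (gaussian_span_sq sqY sN).
have mpN : measurable_fun setT (fun w => phi (N w)) by exact: measurableT_comp.
have ip : intg P (fun w => phi (N w)) by apply: (@intg_bounded _ _ _ _ _ B).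
have [_ ->] := law_integral mN (gaussian_span_law sqY EY gY sN) mphi ip.
by rewrite /Ex /Rintegral fineK//; exact: integrable_fin_num.
Qed.

(** All centered Gaussian laws are realized on the same space as sqrt(u) Y_t with Y_t standard, so
    convergence of variances becomes pointwise convergence. The case v = 0 needs no separate
    treatment. *)
Lemma gaussian_span_cvg (phi : R -> R) (B v : R) (G Z : nat -> T -> R) :
  continuous phi -> (forall x, `|phi x| <= B) -> 0 <= v ->
  (forall n, gaussian_span Y (G n)) -> (forall n, sq_intg P (Z n)) ->
  (exists t, Ex P (fun w => Y t w ^+ 2) = 1) ->
  Ex P (fun w => G n w ^+ 2) @[n --> \oo] --> v ->
  Ex P (fun w => Z n w ^+ 2) @[n --> \oo] --> 0 ->
  (Ex P (fun w => phi (G n w + Z n w)))%:E @[n --> \oo] --> (\int[(gaussian_law 0 v)%R]_x (phi x)%:E)%E.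
Proof.
move=> cphi phiB v0 sG sZ [t Yt] Gv Z0.
have mphi : measurable_fun setT phi by exact: continuous_measurable_fun.
pose N (u : R) w := Num.sqrt u * Y t w.
have sN u : gaussian_span Y (N u) by apply: gaussian_spanZ; exact: gaussian_span_mem.
have N2 (u : R) : 0 <= u -> Ex P (fun w => N u w ^+ 2) = u.
  move=> u0; rewrite /N; under eq_fun do rewrite exprMn.
  by rewrite ExZ ?Yt ?mulr1 ?sqr_sqrtr//; case: (sqY t).
have GN n : Ex P (fun w => phi (G n w)) = Ex P (fun w => phi (N (Ex P (fun w => G n w ^+ 2)) w)).
  have g0 : 0 <= Ex P (fun w => G n w ^+ 2) by apply: Ex_ge0 => w; exact: sqr_ge0.
  apply/EFin_inj; rewrite -(gaussian_span_integral cphi phiB (sG n)).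
  by rewrite -(gaussian_span_integral cphi phiB (sN _)) N2.
have -> : (\int[(gaussian_law 0 v)%R]_x (phi x)%:E)%E = (Ex P (fun w => phi (N v w)))%:E.
  by rewrite -(gaussian_span_integral cphi phiB (sN _)) N2.
have mN u : measurable_fun setT (fun w => phi (N u w)).
  by apply: (measurableT_comp mphi); case: (gaussian_span_sq sqY (sN u)).
have lim : Ex P (fun w => phi (G n w)) @[n --> \oo] --> Ex P (fun w => phi (N v w)).
  under eq_fun do rewrite GN.
  apply: (Ex_dct (g := fun=> B)) => //; last exact: intg_cst.
  move=> w /=; apply: continuous_cvg; first exact: cphi.
  by apply: cvgMl; apply: continuous_cvg => //; exact: sqrt_continuous.
have dif : Ex P (fun w => phi (G n w + Z n w)) - Ex P (fun w => phi (G n w)) @[n --> \oo] --> 0.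
  apply: (slutsky (B := B) (M := v + 1)) => //.
    by move=> n; exact: (gaussian_span_sq sqY (sG n)).
  have v1 : v < v + 1 by rewrite ltrDl.
  exact: cvgr_le Gv _ v1.
have sum : Ex P (fun w => phi (G n w + Z n w)) @[n --> \oo] --> Ex P (fun w => phi (N v w)).
  rewrite -[X in _ --> X]add0r.
  rewrite (_ : (fun n => _) = (fun n => (Ex P (fun w => phi (G n w + Z n w)) - Ex P (fun w => phi (G n w)))
    + Ex P (fun w => phi (G n w)))); first exact: cvgD.
  by apply/funext => n; rewrite subrK.
by apply: cvg_EFin; [exact: nearW|exact: sum].
Qed.

End Slutsky.

Section L2Bounded.
Context {R : realType} d (T : measurableType d) (P : probability T R).

Definition L2_bounded (X : nat -> T -> R) : Prop :=
  (forall n, sq_intg P (X n)) /\ exists C, forall n, Ex P (fun w => X n w ^+ 2) <= C.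

Lemma Ex_sqrD (A B : T -> R) : sq_intg P A -> sq_intg P B ->
  Ex P (fun w => (A w + B w) ^+ 2) <= 2 * (Ex P (fun w => A w ^+ 2) + Ex P (fun w => B w ^+ 2)).
Proof.
move=> sA sB; have [_ iA] := sA; have [_ iB] := sB.
rewrite -ExD// -ExZ; last exact: intgD.
apply: Ex_le; [by case: (sq_intgD sA sB)|by apply: intgZ; exact: intgD|move=> w].
rewrite -subr_ge0 (_ : _ - _ = (A w - B w) ^+ 2) ?sqr_ge0//; ring.
Qed.

Lemma L2_bounded_cst A : sq_intg P A -> L2_bounded (fun=> A).
Proof. by move=> sA; split => //; exists (Ex P (fun w => A w ^+ 2)). Qed.

Lemma L2_boundedD X Z : L2_bounded X -> L2_bounded Z -> L2_bounded (fun n w => X n w + Z n w).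
Proof.
move=> [sX [C XC]] [sZ [C' ZC]]; split => [n|]; first exact: sq_intgD.
exists (2 * (C + C')) => n; apply: le_trans (Ex_sqrD (sX n) (sZ n)) _.
by rewrite ler_pM2l// lerD.
Qed.

Lemma L2_boundedZ c X : L2_bounded X -> L2_bounded (fun n w => c * X n w).
Proof.
move=> [sX [C XC]]; split => [n|]; first exact: sq_intgZ.
exists (c ^+ 2 * C) => n; under eq_fun do rewrite exprMn.
rewrite ExZ; last by case: (sX n).
by apply: ler_wpM2l => //; exact: sqr_ge0.
Qed.

Lemma L2_bounded_sum (I : Type) (s : seq I) (F : I -> nat -> T -> R) :
  (forall i, L2_bounded (F i)) -> L2_bounded (fun n w => \sum_(i <- s) F i n w).
Proof.
move=> HF; elim: s => [|i s IH].
  rewrite (_ : (fun n w => _) = (fun=> fun=> 0)); first by apply: L2_bounded_cst; exact: sq_intg_cst.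
  by apply/funext => n; apply/funext => w; rewrite big_nil.
rewrite (_ : (fun n w => _) = (fun n w => F i n w + \sum_(j <- s) F j n w)); first exact: L2_boundedD.
by apply/funext => n; apply/funext => w; rewrite big_cons.
Qed.

End L2Bounded.

(** Shifting the range by p trades p terms at one end for p at the other; the number of boundary
    terms does not grow with n. *)
Lemma sum_shift (V : zmodType) (y : nat -> V) n p :
  \sum_(i < n) y (i + p)%N = \sum_(i < n) y i + \sum_(j < p) (y (n + j)%N - y j).
Proof.
elim: p => [|p IH]; first by rewrite big_ord0 addr0; apply: eq_bigr => i _; rewrite addn0.
rewrite big_ord_recr/= addrA -IH.
have e : \sum_(i < n) y (i + p)%N + y (n + p)%N = y p + \sum_(i < n) y (i + p.+1)%N.
  transitivity (\sum_(i < n.+1) y (i + p)%N); first by rewrite big_ord_recr.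
  by rewrite big_ord_recl; congr (_ + _); apply: eq_bigr => i _; rewrite -addSnnS.
by rewrite addrA e addrC addKr.
Qed.

(** * Limit theorem for orthant functions *)

Section OrthantCLT.
Context {R : realType} d (T : measurableType d) (P : probability T R).
Variables (Y : nat -> T -> R) (r l : nat -> R) (D : R) (h : nat).
Hypothesis sqY : forall t, sq_intg P (Y t).
Hypothesis EY : forall t, Ex P (Y t) = 0.
Hypothesis gY : gaussian_process P Y.
Hypothesis stY : stationary P Y.
Hypothesis varY : forall t, Ex P (fun w => Y t w * Y t w) = r 0%N.
Hypothesis covY0 : forall k, (1 <= k)%N -> Ex P (fun w => Y 0%N w * Y k w) = r k.
Hypothesis r01 : r 0%N = 1.
Hypotheses (D0 : 0 < D) (D1 : D < 1).
Hypothesis svl : seq_slowly_varying l.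
Hypothesis rE : forall k, (1 <= k)%N -> r k = l k * k%:R `^ (- D).
Variables (m : nat) (a : 'I_m -> 'I_h -> R).

Let f := orthant_fun a.
Let U i : 'I_h -> T -> R := window Y i.
Let W (p q : 'I_h) : R := invmx (toeplitz_mx r h) p q.
Let A := reg_coef P (U 0%N) W f.
Let kap (n : nat) : R := n%:R `^ (D / 2) * l n `^ (- (1 / 2)) * n%:R^-1.
Let nrm (n : nat) : R := n%:R `^ (2 - D) * l n.

(** Holds eventually, since [l n] is known to be positive for large n only. *)
Let kap_sq : \forall n \near \oo, kap n ^+ 2 = (nrm n)^-1.
Proof.
have l0 : \forall n \near \oo, 0 < l n.
  by apply: filterS (svl ltr01) => n /(_ n)[]//; rewrite leqnn andbT leq_uphalf_double -addnn leq_addr.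
near=> n.
have n0 : (0 < n)%N by near: n; exact: nbhs_infty_gt.
have ln : 0 < l n by near: n.
have nR : 0 < n%:R :> R by rewrite ltr0n.
have sqp (x b : R) : 0 <= x -> (x `^ b) ^+ 2 = x `^ (b * 2).
  by move=> x0; rewrite -powR_mulrn ?powR_ge0// -powRrM.
rewrite /kap !exprMn !sqp ?ltW//.
have -> : D / 2 * 2 = D by field.
have -> : - (1 / 2) * 2 = -1 :> R by field.
rewrite /nrm powRN powRr1 ?ltW// invfM exprVn.
have -> : n%:R `^ (2 - D) = n%:R ^+ 2 / n%:R `^ D.
  by rewrite powRB ?(gt_eqF nR) ?implybT// (@powR_mulrn _ _ 2).
have nD : n%:R `^ D != 0 :> R by rewrite gt_eqF// powR_gt0.
by field; rewrite nD !gt_eqF.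
Unshelve. all: by end_near. Qed.

Let Delta n w := \sum_p A p * \sum_(j < p) (Y (n + j)%N w - Y j w).

Let Delta_bounded : L2_bounded P Delta.
Proof.
have bY j : L2_bounded P (fun n => Y (n + j)%N).
  by split => // ; exists 1 => n; under eq_fun do rewrite expr2; rewrite varY r01.
apply: L2_bounded_sum => p; apply: L2_boundedZ; apply: L2_bounded_sum => j.
have := L2_boundedD (bY j) (L2_boundedZ (-1) (L2_bounded_cst (sqY j))).
by congr L2_bounded; apply/funext => n; apply/funext => w; rewrite mulN1r.
Qed.

Let rho := window_residual P Y r a.

Let decomposition n w : \sum_(i < n) (f (at_ (U i) w) - Ex P (fun w => f (at_ (U 0%N) w))) =
  (\sum_p A p) * (\sum_(i < n) Y i w) + (Delta n w + \sum_(i < n) rho i w).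
Proof.
have -> : \sum_(i < n) (f (at_ (U i) w) - Ex P (fun w => f (at_ (U 0%N) w))) =
    \sum_(i < n) (\sum_p A p * Y (i + p)%N w + rho i w).
  by apply: eq_bigr => i _; rewrite [RHS]addrC; exact: (esym (subrK _ _)).
rewrite big_split/= addrA; congr (_ + _).
rewrite exchange_big mulr_suml -big_split/=; apply: eq_bigr => p _.
by rewrite -mulr_sumr (sum_shift (fun t => Y t w)) mulrDr.
Qed.

(** [G] is the regression part, exactly Gaussian, whose variance converges by
    [long_range_double_sum]; [Z] gathers boundary terms and residuals and tends to 0 in L^2. *)
Lemma orthant_clt (phi : R -> R) (B : R) : continuous phi -> (forall x, `|phi x| <= B) ->
  (Ex P (fun w => phi (kap n * \sum_(i < n) (f (at_ (U i) w) - Ex P (fun w => f (at_ (U 0%N) w))))))%:E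
    @[n --> \oo] --> (\int[(gaussian_law 0 (2 / ((1 - D) * (2 - D)) * (\sum_p A p) ^+ 2))%R]_x (phi x)%:E)%E.
Proof.
move=> cphi phiB.
pose S n w := \sum_(i < n) Y i w.
pose G n w := (kap n * \sum_p A p) * S n w.
pose Z n w := kap n * (Delta n w + \sum_(i < n) rho i w).
have sS n : gaussian_span Y (S n).
  by apply: gaussian_span_sum => i; exact: gaussian_span_mem.
have srho n : sq_intg P (fun w => \sum_(i < n) rho i w).
  apply: sq_intg_sum => i.
  exact: (window_residual_sq sqY EY gY stY varY covY0 r01 D0 svl rE).
have [sD [C DC]] := Delta_bounded.
have -> : (fun n => (Ex P (fun w => phi (kap n *
      \sum_(i < n) (f (at_ (U i) w) - Ex P (fun w => f (at_ (U 0%N) w))))))%:E) =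
    (fun n => (Ex P (fun w => phi (G n w + Z n w)))%:E).
  apply/funext => n; congr (_%:E); congr Ex; apply/funext => w.
  by rewrite decomposition /G /Z /S; congr phi; ring.
have cov := gaussian_cov sqY gY stY varY covY0.
apply: (gaussian_span_cvg sqY EY gY cphi phiB) => [|n|n|||].
- apply: mulr_ge0 (sqr_ge0 _); apply: divr_ge0 => //; apply: mulr_ge0; rewrite subr_ge0; [exact: ltW|by apply: ltW; apply: lt_trans D1 _; rewrite ltr1n].
- exact: gaussian_spanZ.
- by apply: sq_intgZ; exact: sq_intgD.
- by exists 0%N; under eq_fun do rewrite expr2; rewrite varY.
- have lim := long_range_double_sum D1 svl rE.
  have lim2 : (\sum_(i < n) \sum_(j < n) r (ndist i j)) / nrm n * (\sum_p A p) ^+ 2 @[n --> \oo] -->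
      2 / ((1 - D) * (2 - D)) * (\sum_p A p) ^+ 2 by apply: cvgMl; exact: lim.
  apply: cvg_trans lim2; apply: near_eq_cvg; apply: filterS kap_sq => n kn.
  have -> : (fun w => G n w ^+ 2) = (fun w => (kap n * \sum_p A p) ^+ 2 * (S n w * S n w)).
    by apply/funext => w; rewrite /G; ring.
  rewrite ExZ; last by apply: sq_intgM; exact: (gaussian_span_sq sqY (sS n)).
  rewrite exprMn kn Ex_sum2 => [|i|i]; [|exact: sqY|exact: sqY].
  have -> : \sum_(i < n) \sum_(j < n) Ex P (fun w => Y i w * Y j w) = \sum_(i < n) \sum_(j < n) r (ndist i j).
    by apply: eq_bigr => i _; apply: eq_bigr => j _; rewrite cov.
  by rewrite [RHS]mulrC [RHS]mulrA.
have neg := window_residual_negligible sqY EY gY stY varY covY0 r01 D0 D1 svl rE a.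
have nor := long_range_normalizer D1 svl.
have C0 : 0 <= C by apply: le_trans (DC 0%N); apply: Ex_ge0 => w; exact: sqr_ge0.
(* The bounded second moment C of the boundary terms is weakened to C n, so that
   [long_range_normalizer] applies. *)
have up : 2 * (C * (n%:R / nrm n) + Ex P (fun w => (\sum_(i < n) rho i w) ^+ 2) / nrm n)
    @[n --> \oo] --> 0.
  rewrite [X in _ --> X](_ : 0 = 2 * (C * 0 + 0)); last by rewrite mulr0 addr0 mulr0.
  by apply: cvgMr; apply: cvgD; [apply: cvgMr; exact: nor|exact: neg].
apply: (squeeze_cvgr _ (cvg_cst 0) up); near=> n.
have n1 : (1 <= n)%N by near: n; exact: nbhs_infty_gt.
have kn : kap n ^+ 2 = (nrm n)^-1 by near: n.
have nrm0 : 0 <= (nrm n)^-1 by rewrite -kn sqr_ge0.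
rewrite Ex_ge0 => [/=|w]; last exact: sqr_ge0.
have -> : (fun w => Z n w ^+ 2) = (fun w => kap n ^+ 2 * (Delta n w + \sum_(i < n) rho i w) ^+ 2).
  by apply/funext => w; rewrite /Z exprMn.
rewrite ExZ; last by case: (sq_intgD (sD n) (srho n)).
rewrite kn; apply: (@le_trans _ _ ((nrm n)^-1 * (2 * (C + Ex P (fun w => (\sum_(i < n) rho i w) ^+ 2))))).
  apply: ler_wpM2l => //; apply: le_trans (Ex_sqrD (sD n) (srho n)) _.
  by rewrite ler_pM2l// lerD2r.
rewrite mulrCA ler_pM2l// mulrDr [X in _ + X <= _]mulrC lerD2r.
rewrite mulrC; apply: ler_wpM2l => //; apply: ler_peMl => //.
by rewrite ler1n.
Unshelve. all: by end_near. Qed.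

End OrthantCLT.

(** * Transfer to the pattern estimator *)

Lemma gaussian_law_point (R : realType) (m v x : R) : 0 < v -> gaussian_law m v [set x] = 0%E.
Proof.
move=> v0; rewrite /gaussian_law gt_eqF//.
have /null_content_dominatesP H := normal_prob_dominates m (Num.sqrt v).
by apply: H; [exact: measurable_set1|exact: lebesgue_measure_set1].
Qed.

(** With the tie-breaking rule each adjacent condition becomes one comparison, weak if the indices
    decrease and strict otherwise; the indicator is the product of these. *)
Lemma measurable_ordinal_pattern (R : realType) d (T : measurableType d) h
    (x : 'I_h.+1 -> T -> R) (s : 'S_h.+1) : (forall j, measurable_fun setT (x j)) ->
  measurable_fun setT (fun w => (ordinal_pattern (fun j => x j w) == s)%:R : R).
Proof.
move=> mx.
pose b (i : 'I_h) w : bool :=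
  if (s (lift ord0 i) < s (widen_ord (leqnSn h) i))%N
  then x (s (lift ord0 i)) w <= x (s (widen_ord (leqnSn h) i)) w
  else x (s (lift ord0 i)) w < x (s (widen_ord (leqnSn h) i)) w.
have -> : (fun w => (ordinal_pattern (fun j => x j w) == s)%:R : R) =
    (fun w => \prod_(i < h) (if b i w then 1 else 0)).
  apply/funext => w.
  have -> : (ordinal_pattern (fun j => x j w) == s) = [forall i, b i w].
    transitivity (is_ordinal_pattern (fun j => x j w) s).
      by apply/eqP/idP => /ordinal_patternP.
    apply: eq_forallb => i; rewrite /b; case: ifP => _; first by rewrite implybT andbT.
    by rewrite implybF lt_neqAle andbC eq_sym.
  have [/forallP H|/forallPn[i Hi]] := boolP [forall i, b i w].
    by rewrite big1// => i _; rewrite H.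
  by rewrite (bigD1 i)//= (negbTE Hi) mul0r.
apply: measurable_prod => i _; apply: measurable_fun_ifT => //.
by rewrite /b; case: (_ < _)%N; [exact: measurable_fun_ler|exact: measurable_fun_ltr].
Qed.

Section Centered.
Context {R : realType} d (T : measurableType d) (P : probability T R).

Lemma covariance_centered (A B : T -> R) : ('E_P[A] = 0)%E -> ('E_P[B] = 0)%E ->
  covariance P A B = (\int[P]_w (A w * B w)%:E)%E.
Proof.
move=> EA EB; rewrite covariance.unlock EA EB expectation.unlock /=.
by apply: eq_integral => w _; congr EFin; rewrite /= /GRing.mul/= !subr0.
Qed.

(** For a centered variable the variance is the integral of A^2, so its finite value is itself the
    source of square integrability. *)
Lemma sq_intg_variance (A : T -> R) (v : R) : measurable_fun setT A ->
  ('E_P[A] = 0)%E -> ('V_P[A] = v%:E)%E -> sq_intg P A.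
Proof.
move=> mA EA VA; split => //; apply/integrableP; split.
  by apply/measurable_EFinP; exact: measurable_funX.
have -> : (\int[P]_w `|(A w ^+ 2)%:E|)%E = v%:E; last exact: ltry.
rewrite -VA /variance (covariance_centered EA EA); apply: eq_integral => w _ /=.
by rewrite ger0_norm ?sqr_ge0.
Qed.

Lemma expectation_Ex (A : T -> R) : intg P A -> 'E_P[A]%E = (Ex P A)%:E.
Proof. by move=> iA; rewrite expectation.unlock /Ex /Rintegral fineK//; exact: integrable_fin_num. Qed.

End Centered.

Section PatternIndicator.
Context {R : realType} d (T : measurableType d) (P : probability T R).
Variables (Y : nat -> T -> R) (r l : nat -> R) (D : R) (h : nat).
Hypothesis sqY : forall t, sq_intg P (Y t).
Hypothesis EY : forall t, Ex P (Y t) = 0.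
Hypothesis gY : gaussian_process P Y.
Hypothesis stY : stationary P Y.
Hypothesis varY : forall t, Ex P (fun w => Y t w * Y t w) = r 0%N.
Hypothesis covY0 : forall k, (1 <= k)%N -> Ex P (fun w => Y 0%N w * Y k w) = r k.
Hypothesis r01 : r 0%N = 1.
Hypothesis r_cvg0 : r @ \oo --> 0.

(** By coercivity a nonzero form in the window has positive variance, and a nondegenerate Gaussian
    law has no atom at 0. *)
Lemma window_form_neq0 i (b : 'I_h -> R) : (exists p, b p != 0) ->
  {ae P, forall w, \sum_p b p * Y (i + p)%N w != 0}.
Proof.
move=> [p0 bp0]; pose N w := \sum_p b p * Y (i + p)%N w.
have sN : gaussian_span Y N.
  by apply: gaussian_span_sum => p; apply: gaussian_spanZ; exact: gaussian_span_mem.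
have v0 : 0 < Ex P (fun w => N w ^+ 2).
  have [lam lam0 coer] := toeplitz_coercive r01 r_cvg0 (gaussian_cov_psd sqY gY stY varY covY0) h.
  have -> : Ex P (fun w => N w ^+ 2) = \sum_p \sum_q b p * b q * r (ndist p q).
    have -> : (fun w => N w ^+ 2) = (fun w => (\sum_p b p * window Y i p w) * (\sum_p b p * window Y i p w)).
      by apply/funext => w; rewrite expr2.
    rewrite Ex_sum2 => [|p|p]; [|by apply: sq_intgZ; exact: sqY|by apply: sq_intgZ; exact: sqY].
    apply: eq_bigr => p _; apply: eq_bigr => q _.
    rewrite -(window_cov_same (h := h) sqY gY stY varY covY0 i) -ExZ; last by apply: sq_intgM; exact: sqY.
    by congr Ex; apply/funext => w; ring.
  apply: lt_le_trans (coer b); apply: mulr_gt0 => //.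
  rewrite (bigD1 p0)//=; apply: ltr_wpDr; first by apply: sumr_ge0 => p _; exact: sqr_ge0.
  by rewrite exprn_even_gt0.
exists [set w | N w = 0]; split.
- have mN : measurable_fun setT N by case: (gaussian_span_sq sqY sN).
  by rewrite -[X in measurable X]setTI; exact: (mN measurableT [set 0] (measurable_set1 _)).
- have := gaussian_span_law sqY EY gY sN (measurable_set1 0).
  by rewrite gaussian_law_point.
- by move=> w /= /negP; rewrite negbK => /eqP.
Qed.

Lemma increment_pattern_ae (s : 'S_h.+1) i : {ae P, forall w,
  (increment_pattern (fun p : 'I_h => Y (i + p)%N w) == s)%:R =
  orthant_fun (pattern_form s) (at_ (window Y i) w) :> R}.
Proof.
have := filter_forall (F := almost_everywhere P) _
  (fun j => window_form_neq0 i (pattern_form_neq0 s j)).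
move=> /(_ _)/filterS; apply => w H.
exact: increment_pattern_orthant.
Qed.

End PatternIndicator.

Theorem theorem3p5 (R : realType) (d : measure_display) (T : measurableType d)
    (P : probability T R) (h : nat) (h_gt0 : (0 < h)%N) (s : 'S_h.+1)
    (xi : nat -> {RV P >-> R}) (D : R) (L : R -> R) :
  let X := increment (fun t => xi t) in
  stationary P (fun t => X t.+1) ->
  gaussian_process P (fun t => X t.+1) ->
  (forall t, (1 <= t)%N -> ('E_P[X t] = 0)%E) ->
  (forall t, (1 <= t)%N -> ('V_P[X t] = 1)%E) ->
  0 < D -> D < 1 ->
  slowly_varying L ->
  (forall k : nat, (1 <= k)%N ->
     covariance P (X 1%N) (X (1 + k)%N) = (L k%:R * k%:R `^ (- D))%:E) ->
  let cD := 2 / ((1 - D) * (2 - D)) in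
  let alpha := pattern_alpha P X s in
  cvg_in_distribution P
    (fun n w => n%:R `^ (D / 2) * L n%:R `^ (- (1 / 2)) *
       (pattern_estimator (fun t => xi t) s n w
        - fine (P (increment_pattern_event X s))))
    (gaussian_law 0 (cD * (\sum_(j < h) alpha j ord0) ^+ 2)).
Proof.
move=> X stX gX EX VX D0 D1 svL covX cD alpha.
pose Y t := X t.+1; pose l n := L n%:R.
(* The formula with L describes lags k >= 1 only; lag 0 receives the variance 1. *)
pose r k : R := if k == 0%N then 1 else l k * k%:R `^ (- D).
have mX t : measurable_fun setT (X t) by apply: measurable_funB; exact: measurable_funPT.
have sqY t : sq_intg P (Y t) by apply: (sq_intg_variance (mX _) (EX _ _) (VX _ _)).
have EY t : Ex P (Y t) = 0.
  by apply: EFin_inj; rewrite -expectation_Ex ?EX//; exact: sq_intg_intg.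
have covY i j : (Ex P (fun w => Y i w * Y j w))%:E = covariance P (Y i) (Y j).
  rewrite covariance_centered ?EX// /Ex /Rintegral fineK//.
  by apply: integrable_fin_num => //; exact: sq_intgM.
have varY t : Ex P (fun w => Y t w * Y t w) = r 0%N.
  by apply: EFin_inj; rewrite covY; exact: VX.
have covY0 k : (1 <= k)%N -> Ex P (fun w => Y 0%N w * Y k w) = r k.
  case: k => // k _; apply: EFin_inj; rewrite covY; exact: covX.
have r01 : r 0%N = 1 by [].
have svl : seq_slowly_varying l := slowly_varying_seq svL.
have rE k : (1 <= k)%N -> r k = l k * k%:R `^ (- D) by case: k.
have r_cvg0 := long_range_cvg0 D0 svl rE.
pose f := orthant_fun (pattern_form (R := R) s).
pose ind i w : R := (increment_pattern (fun p : 'I_h => Y (i + p)%N w) == s)%:R.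
have indE i w : ind i w = (ordinal_pattern (fun j : 'I_h.+1 => xi (i + j)%N w) == s)%:R.
  rewrite /ind -(@increment_pattern_increment _ _ _ h i (fun t => xi t) w).
  congr (nat_of_bool (increment_pattern _ == _))%:R.
  by apply/funext => p; rewrite /Y /X -addnS.
have mind i : measurable_fun setT (ind i).
  rewrite (funext (indE i)).
  by apply: measurable_ordinal_pattern => j; exact: measurable_funPT.
have mf i : measurable_fun setT (fun w => f (at_ (window Y i) w)).
  exact: (window_orthant_meas sqY EY gX stX varY covY0 r01 D0 svl rE).
have ind_ae i : {ae P, forall w, ind i w = f (at_ (window Y i) w)}.
  exact: (increment_pattern_ae sqY EY gX stX varY covY0 r01 r_cvg0).
have eventE w : \1_(increment_pattern_event X s) w = ind 0%N w.
  rewrite indicE /ind; congr (nat_of_bool _)%:R.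
  by apply/idP/eqP => [/set_mem//|e]; apply/mem_set.
(* The pattern probability, and below the vector c, are rewritten with the orthant function, which
   differs from the indicator on a null set. *)
have fineE : fine (P (increment_pattern_event X s)) = Ex P (fun w => f (at_ (window Y 0) w)).
  rewrite -(Ex_ae (mind 0%N) (mf 0%N) (ind_ae 0%N)) /Ex /Rintegral.
  under eq_integral do rewrite -eventE.
  rewrite integral_indic ?setIT//.
  have -> : increment_pattern_event X s = ind 0%N @^-1` [set 1].
    apply/seteqP; split => w /=; rewrite /ind.
      by rewrite /increment_pattern_event /= => ->; rewrite eqxx.
    by case: eqP => // _ /eqP; rewrite eq_sym oner_eq0.
  by rewrite -[X in measurable X]setTI; exact: (mind 0%N measurableT _ (measurable_set1 _)).
pose W (p q : 'I_h) : R := invmx (toeplitz_mx r h) p q.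
have covmxE : covariance_mx P h X = toeplitz_mx r h.
  apply/matrixP => i j; rewrite !mxE -/(Y i) -/(Y j) -covY/=.
  exact: (gaussian_cov sqY gX stX varY covY0).
have coefE k : pattern_coef P X s k ord0 = Ex P (fun w => f (at_ (window Y 0) w) * window Y 0 k w).
  have mWk : measurable_fun setT (window Y 0 k) by exact: mX.
  have -> : Ex P (fun w => f (at_ (window Y 0) w) * window Y 0 k w) = Ex P (fun w => ind 0%N w * X k.+1 w).
    apply: Ex_ae; [exact: measurable_funM|exact: measurable_funM|].
    by apply: filterS (ind_ae 0%N) => w ->.
  rewrite mxE expectation.unlock; congr fine.
  by apply: eq_integral => w _; rewrite eventE.
have alphaE : \sum_(j < h) alpha j ord0 = \sum_p reg_coef P (window Y 0) W f p.
  apply: eq_bigr => p _; rewrite /alpha /pattern_alpha mxE covmxE.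
  by apply: eq_bigr => k _; rewrite coefE.
have mZ n : measurable_fun setT (fun w => n%:R `^ (D / 2) * L n%:R `^ (- (1 / 2)) *
    (pattern_estimator (fun t => xi t) s n w - fine (P (increment_pattern_event X s)))).
  apply: measurable_funM => //; apply: measurable_funB => //; apply: measurable_funM => //.
  apply: measurable_sum => i; apply: measurable_ordinal_pattern => j; exact: measurable_funPT.
split => [//|phi cphi [M [_ bM]]].
(* [bounded_fun] gives as bounds all numbers strictly above M, hence [M + 1]. *)
have phiB x : `|phi x| <= M + 1 by apply: bM => //; rewrite ltrDl.
rewrite alphaE.
have := orthant_clt sqY EY gX stX varY covY0 r01 D0 D1 svl rE (a := pattern_form s) cphi phiB.
apply: cvg_trans; apply: near_eq_cvg; near=> n.
have n0 : (0 < n)%N by near: n; exact: nbhs_infty_gt.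
have mphi : measurable_fun setT phi by exact: continuous_measurable_fun.
have mphiZ := measurableT_comp mphi (mZ n).
rewrite expectation_Ex; last by apply: (@intg_bounded _ _ _ _ _ (M + 1)) => [//|w]; exact: phiB.
congr (_%:E); apply: Ex_ae => //.
  apply: (measurableT_comp mphi); apply: measurable_funM => //; apply: measurable_sum => i.
  by apply: measurable_funB => //; exact: mf.
have := filter_forall (F := almost_everywhere P) _ (fun i : 'I_n => ind_ae i).
move=> /(_ _)/filterS; apply => w H.
congr phi; rewrite -/f -fineE -mulrA; congr (_ * _).
rewrite sumrB mulrBr sumr_const card_ord -[fine _ *+ n]mulr_natl mulrA mulVf ?mul1r ?pnatr_eq0 -?lt0n//.
congr (_ * _ - _); apply: eq_bigr => i _; rewrite -indE; exact/esym/H.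
Unshelve. all: by end_near. Qed.
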